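(* Let $d\geq 3$. Let $a$ and $b$ be two nested strictly convex $C^2$-smooth closed hypersurfaces in $\mathbb{R}^d$, i.e. $a=\partial\Omega_a$ and $b=\partial\Omega_b$ where $\Omega_a\Subset\Omega_b\subset\mathbb{R}^d$ are bounded domains. Suppose that the corresponding billiard transformations $\sigma_a$ and $\sigma_b$, acting on the space of oriented lines in $\mathbb{R}^d$, commute: $\sigma_a\circ\sigma_b=\sigma_b\circ\sigma_a$. Then $a$ and $b$ are confocal ellipsoids.
   Context: Strict convexity: a germ of $C^2$-smooth hypersurface $S$ at a point $p$ is strictly convex if it has quadratic tangency with its tangent hyperplane $\Gamma_p$ at $p$, i.e. there exists a constant $C>0$ such that $\mathrm{dist}(q,\Gamma_p)>C\,\|q-p\|^2$ for every $q\in S$, $q\neq p$, close to $p$, where $\|q-p\|=\mathrm{dist}(q,p)$. A hypersurface is strictly convex if all its germs are. Billiard transformation: for $g\in\{a,b\}$ bounding the domain $\Omega_g$, the map $\sigma_g$ acts on the space of all oriented lines as follows. It is the identity on lines disjoint from $g$. If an oriented line $l$ intersects $g$, let $x$ be its last intersection point with $g$ in the sense of the orientation (the orienting arrow of $l$ at $x$ is directed outside $\Omega_g$). Then $\sigma_g(l)$ is the line through $x$ obtained by reflecting $l$ from the hyperplane $T_xg$ (angle of incidence equals angle of reflection), oriented by a tangent vector at $x$ directed inside $\Omega_g$. (Lines tangent to $g$ are fixed by $\sigma_g$.) Confocal quadrics: a pencil of confocal quadrics in $\mathbb{R}^d$ is a one-parameter family of quadrics given, in some orthogonal coordinates $(x_1,\dots,x_d)$,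 by the equations $\sum_{j=1}^d\frac{x_j^2}{a_j^2+\lambda}=1$, where $a_j\in\mathbb{R}$ are fixed and $\lambda\in\mathbb{R}$ is the parameter. Two ellipsoids are confocal if they belong to one such pencil.
   Formalization: The closed hypersurfaces a and b are assumed connected; otherwise Ω_a={1/2<|x|<1}, Ω_b={|x|<2} satisfies every hypothesis (the billiard only sees the outer sphere of a) while a, a union of two spheres, is not an ellipsoid. *)

(* Defs.v *)
From HB Require Import structures.
From mathcomp Require Import all_boot all_order all_algebra.
From mathcomp Require Import all_classical all_reals all_analysis.
From mathcomp Require Import ring.

Set Implicit Arguments.
Unset Strict Implicit.
Unset Printing Implicit Defensive.

Import Order.TTheory GRing.Theory Num.Theory.
Import numFieldNormedType.Exports.

Local Open Scope classical_set_scope.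
Local Open Scope ring_scope.

(** The library norm on ['rV[R]_d] is the sup norm (it induces the usual
    topology); metric notions below use the Euclidean structure instead. *)
Definition dot (R : realType) (d : nat) (u v : 'rV[R]_d) : R :=
  \sum_(i < d) u 0 i * v 0 i.

Definition enorm (R : realType) (d : nat) (u : 'rV[R]_d) : R :=
  Num.sqrt (dot u u).

Definition edist_to (R : realType) (d : nat) (q : 'rV[R]_d) (A : set 'rV[R]_d) : R :=
  inf [set enorm (q - y) | y in A].

Definition boundary (T : topologicalType) (A : set T) : set T :=
  closure A `\` interior A.

Definition bounded_domain (R : realType) (d : nat) (Om : set 'rV[R]_d) : Prop :=
  [/\ open Om, connected Om, Om !=set0 & bounded_set Om].

Fixpoint Ck_on (R : realType) (d k : nat) (U : set 'rV[R]_d) (F : 'rV[R]_d -> R)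
    : Prop :=
  match k with
  | 0%N => forall x, U x -> {for x, continuous F}
  | k'.+1 => (forall x, U x -> differentiable F x) /\
             (forall v : 'rV[R]_d, Ck_on k' U (fun x => 'D_v F x))
  end.

(** [n] is the nonzero gradient at [p] of a local [C^2] equation [F = 0]
    of [S] near [p]. *)
Definition normal_at (R : realType) (d : nat) (S : set 'rV[R]_d)
    (p n : 'rV[R]_d) : Prop :=
  n != 0 /\
  exists (U : set 'rV[R]_d) (F : 'rV[R]_d -> R),
    [/\ open U, U p, Ck_on 2 U F,
        S `&` U = U `&` [set x | F x = 0] &
        forall v, 'D_v F p = dot n v].

Definition C2_hypersurface (R : realType) (d : nat) (S : set 'rV[R]_d) : Prop :=
  forall p, S p -> exists n, normal_at S p n.

(** A choice of normal vector; on a [C^2] hypersurface the normal line is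
    unique, and all uses below depend only on that line. *)
Definition normal (R : realType) (d : nat) (S : set 'rV[R]_d) (p : 'rV[R]_d)
    : 'rV[R]_d :=
  xget 0 [set n | normal_at S p n].

Definition tangent_hyperplane (R : realType) (d : nat) (S : set 'rV[R]_d)
    (p : 'rV[R]_d) : set 'rV[R]_d :=
  [set q | dot (normal S p) (q - p) = 0].

Definition strictly_convex_at (R : realType) (d : nat) (S : set 'rV[R]_d)
    (p : 'rV[R]_d) : Prop :=
  exists2 C : R, 0 < C &
    \forall q \near p, S q -> q != p ->
      edist_to q (tangent_hyperplane S p) > C * enorm (q - p) ^+ 2.

Definition strictly_convex (R : realType) (d : nat) (S : set 'rV[R]_d) : Prop :=
  forall p, S p -> strictly_convex_at S p.

(** A closed hypersurface is understood to be connected.  Without this, a ball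
    with a smaller concentric closed ball removed would be admitted: both
    boundary spheres are strictly convex in the above local sense, and only the
    outer one is seen by the billiard map. *)
Definition strictly_convex_closed_boundary (R : realType) (d : nat)
    (Om : set 'rV[R]_d) : Prop :=
  [/\ bounded_domain Om, connected (boundary Om),
      C2_hypersurface (boundary Om) & strictly_convex (boundary Om)].

Definition line (R : realType) (d : nat) (p v : 'rV[R]_d) : set 'rV[R]_d :=
  [set p + t *: v | t in [set: R]].

Record oline (R : realType) (d : nat) := OLine {
  carrier : set 'rV[R]_d;
  dir : 'rV[R]_d;
  dir_unit : enorm dir = 1;
  carrier_line : exists p, carrier = line p dir
}.

Definition oline_through (R : realType) (d : nat) (p v : 'rV[R]_d)
    (hv : enorm v = 1) : oline R d :=
  OLine hv (ex_intro (fun q => line p v = line q v) p erefl).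

Definition reflect_dir (R : realType) (d : nat) (n v : 'rV[R]_d) : 'rV[R]_d :=
  v - (2 * dot v n / dot n n) *: n.

Lemma dotDl (R : realType) (d : nat) (u v w : 'rV[R]_d) : dot (u + v) w = dot u w + dot v w.
Proof.
by rewrite /dot -big_split; apply: eq_bigr => i _; rewrite mxE mulrDl.
Qed.

Lemma dotZl (R : realType) (d : nat) a (u w : 'rV[R]_d) : dot (a *: u) w = a * dot u w.
Proof. by rewrite /dot mulr_sumr; apply: eq_bigr => i _; rewrite mxE mulrA. Qed.

Lemma dotC (R : realType) (d : nat) (u v : 'rV[R]_d) : dot u v = dot v u.
Proof. by apply: eq_bigr => i _; rewrite mulrC. Qed.

Lemma dot_eq0 (R : realType) (d : nat) (n : 'rV[R]_d) : (dot n n == 0) = (n == 0).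
Proof.
apply/eqP/eqP => [h|->]; last first.
  by rewrite /dot big1 // => i _; rewrite mxE mul0r.
apply/rowP => i; rewrite mxE; apply/eqP; rewrite -sqrf_eq0 expr2.
move/eqP: h; rewrite /dot psumr_eq0 => [/allP/(_ i)|j _].
  by rewrite mem_index_enum; apply.
by rewrite -expr2 sqr_ge0.
Qed.

Lemma enorm_reflect_dir (R : realType) (d : nat) (n v : 'rV[R]_d) : enorm v = 1 ->
  enorm (reflect_dir n v) = 1.
Proof.
move=> <-; rewrite /enorm; congr (Num.sqrt _).
have [->|n0] := eqVneq n 0; first by rewrite /reflect_dir scaler0 subr0.
have nn0 : dot n n != 0 by rewrite dot_eq0.
rewrite /reflect_dir -scaleNr; set c := - _.
rewrite dotDl dotZl ![dot _ (v + _)]dotC !dotDl !dotZl (dotC n v) /c.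
by field.
Qed.

Definition reflect_oline (R : realType) (d : nat) (n x : 'rV[R]_d)
    (l : oline R d) : oline R d :=
  oline_through x (enorm_reflect_dir n (dir_unit l)).

Definition last_intersection (R : realType) (d : nat) (S : set 'rV[R]_d)
    (l : oline R d) (x : 'rV[R]_d) : Prop :=
  [/\ S x, carrier l x &
      forall y, S y -> carrier l y -> dot (y - x) (dir l) <= 0].

(** At the last intersection point with [S = boundary Om] the direction of [l]
    points outside [Om] (or is tangent to [S]), so its mirror image in the
    tangent hyperplane, which is the new direction, points inside (or equals
    the old one). *)
Definition billiard (R : realType) (d : nat) (S : set 'rV[R]_d)
    (l : oline R d) : oline R d :=
  if pselect (exists x, last_intersection S l x) is left h
  then let x := projT1 (cid h) in reflect_oline (normal S x) x l
  else l.

Definition is_orthogonal_mx (R : realType) (d : nat) (Q : 'M[R]_d) : Prop :=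
  Q *m Q^T = 1%:M.

(** The coordinate system has origin [c] and axes directed by the rows of the
    orthogonal matrix [Q]. *)
Definition coordinate (R : realType) (d : nat) (c : 'rV[R]_d) (Q : 'M[R]_d)
    (x : 'rV[R]_d) (j : 'I_d) : R :=
  dot (x - c) (row j Q).

Definition quadric (R : realType) (d : nat) (c : 'rV[R]_d) (Q : 'M[R]_d)
    (m : 'I_d -> R) : set 'rV[R]_d :=
  [set x | \sum_(j < d) coordinate c Q x j ^+ 2 / m j = 1].

Definition ellipsoid (R : realType) (d : nat) (E : set 'rV[R]_d) : Prop :=
  exists (c : 'rV[R]_d) (Q : 'M[R]_d) (s : 'I_d -> R),
    [/\ is_orthogonal_mx Q, forall j, 0 < s j &
        E = quadric c Q (fun j => s j ^+ 2)].

(** The nonvanishing condition excludes parameters at which the equation of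
    the pencil is undefined ([x / 0 = 0] in the library). *)
Definition in_confocal_pencil (R : realType) (d : nat) (c : 'rV[R]_d)
    (Q : 'M[R]_d) (al : 'I_d -> R) (E : set 'rV[R]_d) : Prop :=
  exists2 lam : R, (forall j, al j ^+ 2 + lam != 0) &
    E = quadric c Q (fun j => al j ^+ 2 + lam).

Definition confocal (R : realType) (d : nat) (E1 E2 : set 'rV[R]_d) : Prop :=
  exists (c : 'rV[R]_d) (Q : 'M[R]_d) (al : 'I_d -> R),
    [/\ is_orthogonal_mx Q, in_confocal_pencil c Q al E1 &
        in_confocal_pencil c Q al E2].

Definition confocal_ellipsoids (R : realType) (d : nat)
    (E1 E2 : set 'rV[R]_d) : Prop :=
  [/\ ellipsoid E1, ellipsoid E2 & confocal E1 E2].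

(* Main.v *)
Require Import Defs.
From HB Require Import structures.
From mathcomp Require Import all_boot all_order all_algebra.
From mathcomp Require Import all_classical all_reals all_analysis.
From mathcomp Require Import ring lra.

Set Implicit Arguments.
Unset Strict Implicit.
Unset Printing Implicit Defensive.

Import Order.TTheory GRing.Theory Num.Theory.
Import numFieldNormedType.Exports.

Local Open Scope classical_set_scope.
Local Open Scope ring_scope.

(** A line misses the inner domain exactly when [sigma_a] fixes it, so commutation says that
    reflection in [b] preserves the lines missing the inner domain.  Call a flag at a point [x] of
    [b] a point [y] of [a] with outward normal [N] such that the tangent hyperplane of [a] at [y]
    passes through [x].  Moving [x] inside this hyperplane, tangent lines from [y] reflect to lines
    that still miss the inner domain, and the resulting first-order condition (Berger's identity)
    relates the second fundamental form of [b] at [x] to the flag.  It has two consequences.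

    First, [k(N) = n.N / n.(x - y)], with [n] normal to [b] at [x], is the same for all [x] in the
    section of [b] by the hyperplane.  Secondly, for two flags at the same [x] the expression
    [k(N) (y - x).N'] is symmetric, so there is a symmetric matrix [B_x] with
    [N B_x = k(N) (y - x)] for all flags at [x], and then [n B_x = - n].

    For nearby points the difference [B_x - B_x'] is a symmetric product of [x - x'] with some
    vector, since it maps the flags common to both points to multiples of [x - x'].  Elementary
    algebra, using that no three points of [b] are collinear, gives
    [B_x = A + r.x + al x.x] (symmetric products) near each point, hence on all of [b] by
    connectedness.  Substituting this back yields a centre [c], a symmetric matrix [M] and [a > 0]
    with [(N.(y - c)) (y - c) = N M] on the inner hypersurface and
    [(n.(x - c)) (x - c) = n (M + 1 / a)] on the outer one: two confocal ellipsoids. *)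

(** * The Euclidean product *)

Lemma cvg_sumr (R : realType) (T : Type) (E : set_system T) {FE : Filter E} (I : Type)
    (r : seq I) (F : I -> T -> R) (l : I -> R) :
  (forall i, F i x @[x --> E] --> l i) ->
  \sum_(i <- r) F i x @[x --> E] --> \sum_(i <- r) l i.
Proof.
move=> cF; elim: r => [|i r IH].
  by rewrite big_nil; under eq_fun do rewrite big_nil; exact: cvg_cst.
rewrite big_cons; under eq_fun do rewrite big_cons.
by apply: cvgD; [exact: cF | exact: IH].
Qed.

Lemma connected_propagate (T : topologicalType) (A : set T) (P : T -> Prop) :
  connected A -> (exists2 x, A x & P x) ->
  (forall x, A x -> P x -> \forall y \near x, A y -> P y) ->
  (forall x, A x -> (forall V, nbhs x V -> exists y, [/\ A y, V y & P y]) -> P x) ->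
  forall x, A x -> P x.
Proof.
move=> cA [x0 Ax0 Px0] oP cP.
suff AE : A `&` P = A by move=> x; rewrite -{1}AE => -[].
apply: cA.
- by exists x0.
- exists (interior [set y | A y -> P y]); first exact: open_interior.
  apply/seteqP; split=> [x [Ax Px]|x [Ax /interior_subset]].
    by split=> //; exact: oP.
  by move=> /(_ Ax) Px.
- exists (closure (A `&` P)); first exact: closed_closure.
  apply/seteqP; split=> [x [Ax Px]|x [Ax xc]].
    by split=> //; exact: subset_closure.
  split=> //; apply: cP => // V /xc[y [[Ay Py] Vy]].
  by exists y.
Qed.

Section Dot.
Context {R : realType} {d : nat}.
Implicit Types (u v w n : 'rV[R]_d) (a : R).

Lemma dotDr u v w : dot u (v + w) = dot u v + dot u w.
Proof. by rewrite dotC dotDl !(dotC u). Qed.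

Lemma dotZr a u v : dot u (a *: v) = a * dot u v.
Proof. by rewrite dotC dotZl dotC. Qed.

Lemma dotNl u v : dot (- u) v = - dot u v.
Proof. by rewrite -scaleN1r dotZl mulN1r. Qed.

Lemma dotNr u v : dot u (- v) = - dot u v.
Proof. by rewrite dotC dotNl dotC. Qed.

Lemma dot0l v : dot 0 v = 0.
Proof. by rewrite -(scale0r v) dotZl mul0r. Qed.

Lemma dot0r v : dot v 0 = 0.
Proof. by rewrite dotC dot0l. Qed.

Lemma dot_suml (I : Type) (r : seq I) (P : pred I) (F : I -> 'rV[R]_d) v :
  dot (\sum_(i <- r | P i) F i) v = \sum_(i <- r | P i) dot (F i) v.
Proof.
elim/big_rec2: _ => [|i x y _ <-]; first exact: dot0l.
by rewrite dotDl.
Qed.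

Definition dotE := (dotDl, dotDr, dotNl, dotNr, dotZl, dotZr, dot0l, dot0r).

Lemma dot_ge0 u : 0 <= dot u u.
Proof. by apply: sumr_ge0 => i _; rewrite -expr2 sqr_ge0. Qed.

Lemma dot_gt0 u : (0 < dot u u) = (u != 0).
Proof. by rewrite lt_def dot_ge0 andbT dot_eq0. Qed.

Lemma dot_delta u i : dot u (delta_mx 0 i) = u 0 i.
Proof.
rewrite /dot (bigD1 i)//= big1 => [|j ji]; rewrite !mxE !eqxx ?mulr1 ?addr0//.
by rewrite (negbTE ji) mulr0.
Qed.

Lemma dot_inj u v : (forall w, dot u w = dot v w) -> u = v.
Proof. by move=> uv; apply/rowP => i; rewrite -!dot_delta. Qed.

Lemma cauchy_schwarz u v : dot u v ^+ 2 <= dot u u * dot v v.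
Proof.
have [->|v0] := eqVneq v 0; first by rewrite !dotE expr0n mulr0.
have vv : 0 < dot v v by rewrite dot_gt0.
have := dot_ge0 (dot v v *: u - dot u v *: v).
rewrite !dotE (dotC v u).
rewrite (_ : _ + _ = dot v v * (dot u u * dot v v - dot u v ^+ 2)); last by ring.
by rewrite pmulr_rge0// subr_ge0.
Qed.

Lemma coord_le_norm u i : `|u 0 i| <= `|u|.
Proof.
rewrite [leRHS]/Num.Def.normr/= mx_normrE.
exact: (le_bigmax _ (fun k : 'I_1 * 'I_d => `|u k.1 k.2|) (0, i)).
Qed.

Lemma sqr_norm_le_dot u : `|u| ^+ 2 <= dot u u.
Proof.
have [->|u0] := eqVneq u 0; first by rewrite normr0 expr0n dot_ge0.
have /mx_norm_neq0[[i j] /= E] : mx_norm u != 0 by rewrite -[mx_norm u]/(`|u|) normr_eq0.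
rewrite [X in X ^+ 2](_ : _ = `|u 0 j|); last by rewrite -[LHS]/(mx_norm u) E ord1.
rewrite real_normK ?num_real// /dot (bigD1 j)//= -expr2 lerDl.
by apply: sumr_ge0 => k _; rewrite -expr2 sqr_ge0.
Qed.

Lemma norm_le_of_dot u a : 0 <= a -> dot u u <= a ^+ 2 -> `|u| <= a.
Proof.
move=> a0 ua; rewrite -(@ler_pXn2r _ 2)// ?nnegrE//.
exact: le_trans (sqr_norm_le_dot u) ua.
Qed.

Lemma dot_continuous u : continuous (dot u).
Proof.
move=> v; apply: (@cvg_sumr R _ (nbhs v)) => i.
by apply: continuousM; [exact: cst_continuous | exact: coord_continuous].
Qed.

Lemma dot_self_continuous : continuous (fun v : 'rV[R]_d => dot v v).
Proof.
by move=> v; apply: (@cvg_sumr R _ (nbhs v)) => i; apply: continuousM; exact: coord_continuous.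
Qed.

Lemma exists_orthogonal u v : (3 <= d)%N ->
  exists2 w, w != 0 & dot u w = 0 /\ dot v w = 0.
Proof.
move=> d3; set M := col_mx u v.
have /rowV0Pn[w wK w0] : kermx M^T != 0.
  rewrite kermx_eq0 /row_free neq_ltn; apply/orP; left.
  by rewrite (leq_ltn_trans (rank_leq_col _)).
exists w => //; move/sub_kermxP: wK => wM.
suff E i : (M *m w^T) i 0 = 0.
  split.
    by have := E (lshift 1 0); rewrite mul_col_mx col_mxEu mxE => E1;
      rewrite -[RHS]E1; apply: eq_bigr => k _; rewrite mxE.
  by have := E (rshift 1 0); rewrite mul_col_mx col_mxEd mxE => E1;
      rewrite -[RHS]E1; apply: eq_bigr => k _; rewrite mxE.
by rewrite -(trmxK M) -trmx_mul wM trmx0 mxE.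
Qed.

Lemma half_space_normal u v : u != 0 -> v != 0 ->
  (forall z, dot u z < 0 -> dot v z <= 0) -> exists2 c, 0 < c & v = c *: u.
Proof.
move=> u0 v0 uv; have uu : 0 < dot u u by rewrite dot_gt0.
have [c cE] : exists c, c = dot v u / dot u u by eexists.
have [w wE] : exists w, w = v - c *: u by eexists.
have uw : dot u w = 0 by rewrite wE !dotE cE (dotC v); field; rewrite gt_eqF.
have w0 : w = 0.
  apply/eqP; apply: contraT => w0; have ww : 0 < dot w w by rewrite dot_gt0.
  have vw : dot v w = dot w w by rewrite {2}wE !dotE uw mulr0 subr0.
  have := uv (((dot v u + 1) / dot w w) *: w - u).
  rewrite !dotE uw mulr0 add0r oppr_lt0 uu vw divfK ?gt_eqF// => /(_ isT).
  by rewrite addrAC subrr add0r ler10.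
have vE : v = c *: u by apply/eqP; rewrite -subr_eq0 -wE w0.
exists c => //; have c0 : 0 <= c.
  have := uv (- u); rewrite !dotE oppr_lt0 uu => /(_ isT).
  by rewrite oppr_le0 => vu; rewrite cE divr_ge0// ltW.
rewrite lt_def c0 andbT; apply: contraNneq v0 => c00.
by rewrite vE c00 scale0r.
Qed.

End Dot.

(** * Derivatives along curves and second derivatives *)

HB.lock Definition hess (R : realType) (d : nat) (F : 'rV[R]_d -> R) (q v w : 'rV[R]_d) : R :=
  'D_w (fun x => 'D_v F x) q.

Section Calculus.
Context {R : realType} {d : nat}.
Implicit Types (u v w q : 'rV[R]_d) (F : 'rV[R]_d -> R) (X Y : R -> 'rV[R]_d) (t : R).

Definition grad F q : 'rV[R]_d := \row_i 'D_(delta_mx 0 i) F q.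

Lemma derive_grad F q v : differentiable F q -> 'D_v F q = dot (grad F q) v.
Proof.
move=> Fq; rewrite deriveE// {1}(row_sum_delta v) linear_sum.
apply: eq_bigr => i _; rewrite linearZ/= mxE deriveE//.
by rewrite [LHS]mulrC.
Qed.

Lemma hess_grad F q v w : differentiable (fun x => 'D_v F x) q ->
  hess F q v w = dot (grad (fun x => 'D_v F x) q) w.
Proof. by rewrite unlock; exact: derive_grad. Qed.

Lemma is_derive_rowP X t u :
  is_derive t 1 X u <-> forall i, is_derive t 1 (fun s => X s 0 i) (u 0 i).
Proof.
split=> [Xu i|Xu].
  have dX : derivable X t 1 by exact: ex_derive.
  apply: DeriveDef; first by have /derivable_mxP := dX; apply.
  by have := derive_mx dX; rewrite derive_val => ->; rewrite mxE.
have dX : derivable X t 1.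
  by apply/derivable_mxP => i j; rewrite ord1; exact: ex_derive.
apply: DeriveDef => //; rewrite derive_mx//; apply/rowP => i.
by rewrite mxE derive_val.
Qed.

Lemma is_derive_along F X t u : differentiable F (X t) -> is_derive t 1 X u ->
  is_derive t 1 (fun s => F (X s)) ('D_u F (X t)).
Proof.
move=> dF dX.
have Xt : differentiable X t by apply/derivable1_diffP; exact: ex_derive.
have cFX : differentiable (F \o X) t by exact: differentiable_comp.
apply: DeriveDef; first exact/derivable1_diffP.
rewrite -[LHS]/('D_1 (F \o X) t) !deriveE// diff_comp//=.
by congr ('d F (X t) _); rewrite -deriveE// derive_val.
Qed.

Lemma is_derive_mul (f g : R -> R) t (a b : R) : is_derive t 1 f a -> is_derive t 1 g b ->
  is_derive t 1 (fun s => f s * g s) (a * g t + f t * b).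
Proof.
move=> df dg; rewrite [a * _ + _](_ : _ = f t *: b + g t *: a); last first.
  by rewrite /GRing.scale/=; ring.
exact: (@is_deriveM _ _ f g).
Qed.

Lemma is_derive_sumr (I : Type) (r : seq I) (f : I -> R -> R) (df : I -> R) t :
  (forall i, is_derive t 1 (f i) (df i)) ->
  is_derive t 1 (fun s => \sum_(i <- r) f i s) (\sum_(i <- r) df i).
Proof.
move=> fP; elim: r => [|i r IH].
  by under eq_fun do rewrite big_nil; rewrite big_nil; exact: is_derive_cst.
by under eq_fun do rewrite big_cons; rewrite big_cons; exact: is_deriveD.
Qed.

Lemma is_derive_dot X Y t u v : is_derive t 1 X u -> is_derive t 1 Y v ->
  is_derive t 1 (fun s => dot (X s) (Y s)) (dot u (Y t) + dot (X t) v).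
Proof.
move=> /is_derive_rowP dX /is_derive_rowP dY.
have := is_derive_sumr (index_enum 'I_d) (fun i => is_derive_mul (dX i) (dY i)).
by rewrite big_split.
Qed.

Lemma is_derive_scale (c : R -> R) X t a u : is_derive t 1 c a -> is_derive t 1 X u ->
  is_derive t 1 (fun s => c s *: X s) (a *: X t + c t *: u).
Proof.
move=> dc /is_derive_rowP dX; apply/is_derive_rowP => i.
rewrite !mxE; have := is_derive_mul dc (dX i).
by congr is_derive; apply/funext => s; rewrite mxE.
Qed.

Lemma is_derive_line q v t : is_derive t 1 (fun s : R => q + s *: v) v.
Proof.
apply/is_derive_rowP => i; under eq_fun do rewrite !mxE.
apply: is_derive_eq; rewrite /GRing.scale/=; ring.
Qed.

Lemma is_derive_on_line F q v t : differentiable F (q + t *: v) ->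
  is_derive t 1 (fun s => F (q + s *: v)) ('D_v F (q + t *: v)).
Proof. by move=> dF; apply: is_derive_along (is_derive_line _ _ _). Qed.

Lemma is_derive_continuous (f : R -> R) t a : is_derive t 1 f a -> {for t, continuous f}.
Proof.
move=> df; apply: differentiable_continuous.
by apply/derivable1_diffP; exact: ex_derive.
Qed.

Lemma mvt (f df : R -> R) (a b : R) : a < b ->
  (forall x, x \in `[a, b]%R -> is_derive x 1 f (df x)) ->
  exists2 c, c \in `]a, b[%R & f b - f a = df c * (b - a).
Proof.
move=> ab dfP.
have cf : {within `[a, b], continuous f}.
  apply: derivable_within_continuous => x /dfP dfx.
  exact: ex_derive.
have dfI x : x \in `]a, b[%R -> is_derive x 1 f (df x).
  by move=> xab; apply: dfP; exact: subset_itv_oo_cc.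
by have [c cI E] := MVT ab dfI cf; exists c.
Qed.

Lemma mvt_line F q v (s : R) : 0 < s ->
  (forall t, 0 <= t <= s -> differentiable F (q + t *: v)) ->
  exists2 t, 0 < t < s & F (q + s *: v) - F q = 'D_v F (q + t *: v) * s.
Proof.
move=> s0 dF.
have [||t tI E] := @mvt (fun t => F (q + t *: v)) (fun t => 'D_v F (q + t *: v)) 0 s.
- by [].
- by move=> t; rewrite in_itv => /dF/is_derive_on_line.
exists t; first by rewrite in_itv in tI.
by move: E; rewrite scale0r addr0 subr0.
Qed.

Lemma ball_rowE q (e : R) v : ball q e v = (`|q - v| < e).
Proof. by rewrite -ball_normE. Qed.

Lemma ball_convex q (e : R) u v t : 0 <= t <= 1 -> ball q e u -> ball q e v ->
  ball q e (u + t *: (v - u)).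
Proof.
rewrite !ball_rowE => /andP[t0 t1] qu qv.
rewrite (_ : q - _ = (1 - t) *: (q - u) + t *: (q - v)); last first.
  by apply/rowP => i; rewrite !mxE; ring.
have t1' : 0 <= 1 - t by rewrite subr_ge0.
apply: le_lt_trans (ler_normD _ _) _; rewrite !normrZ (ger0_norm t0) (ger0_norm t1').
have [->|tN0] := eqVneq t 0; first by lra.
have : 0 < t * (e - `|q - v|) by rewrite mulr_gt0 ?subr_gt0// lt_def tN0.
have : 0 <= (1 - t) * (e - `|q - u|) by rewrite mulr_ge0// subr_ge0 ltW.
by lra.
Qed.

Local Opaque derive.

Lemma hess_sym (U : set 'rV[R]_d) F q v w : open U -> Ck_on 2 U F -> U q ->
  hess F q v w = hess F q w v.
Proof.
move=> oU [F1 F2] Uq.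
suff H e : 0 < e -> `|hess F q v w - hess F q w v| <= e.
  apply/eqP; rewrite -subr_eq0 -normr_le0; apply/ler_addgt0Pr => e e0.
  by rewrite add0r H.
move=> e0.
have [[Dv1 Dv2] [Dw1 Dw2]] := (F2 v, F2 w).
have c1 : {for q, continuous (fun x => hess F x v w)} by rewrite unlock; exact: (Dv2 w).
have c2 : {for q, continuous (fun x => hess F x w v)} by rewrite unlock; exact: (Dw2 v).
have e20 : 0 < e / 2 by rewrite divr_gt0.
have H1 : nbhs q U by apply: open_nbhs_nbhs.
have H2 : \forall x \near q, `|hess F q v w - hess F x v w| < e / 2.
  by move/cvgrPdist_lt : c1 => /(_ _ e20).
have H3 : \forall x \near q, `|hess F q w v - hess F x w v| < e / 2.
  by move/cvgrPdist_lt : c2 => /(_ _ e20).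
have /nbhs_ballP[r /= r0 rB] : nbhs q (U `&` ([set x | `|hess F q v w - hess F x v w| < e / 2]
    `&` [set x | `|hess F q w v - hess F x w v| < e / 2])).
  exact: (filterI H1 (filterI H2 H3)).
pose s := r / (2 * (`|v| + `|w| + 1)).
have D0 : 0 < 2 * (`|v| + `|w| + 1) by rewrite mulr_gt0// ltr_wpDl// addr_ge0.
have s0 : 0 < s by rewrite divr_gt0.
have sr : s * (2 * (`|v| + `|w| + 1)) = r by rewrite divfK// gt_eqF.
have inB a b : 0 <= a <= s -> 0 <= b <= s -> ball q r (q + a *: v + b *: w).
  move=> /andP[a0 sa] /andP[b0 sb]; rewrite ball_rowE.
  rewrite -addrA opprD addrA subrr add0r normrN.
  apply: le_lt_trans (ler_normD _ _) _; rewrite !normrZ !ger0_norm//.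
  have := normr_ge0 v; have := normr_ge0 w; nra.
have inU a b : 0 <= a <= s -> 0 <= b <= s -> U (q + a *: v + b *: w).
  by move=> ha hb; have [] := rB _ (inB _ _ ha hb).
have s0s : (0 : R) <= 0 <= s by apply/andP; split; [exact: lexx|exact: ltW].
have sss : 0 <= s <= s by apply/andP; split; [exact: ltW|exact: lexx].
pose Delta := F (q + s *: v + s *: w) - F (q + s *: v) - (F (q + s *: w) - F q).
have [x1 B1 E1] : exists2 x, ball q r x & Delta = hess F x v w * s ^+ 2.
  have [||a aI] := @mvt (fun a => F (q + s *: w + a *: v) - F (q + a *: v))
    (fun a => 'D_v F (q + s *: w + a *: v) - 'D_v F (q + a *: v)) 0 s.
  - exact: s0.
  - move=> a; rewrite in_itv/= => aI; apply: is_deriveB.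
    + apply: is_derive_on_line; apply: F1.
      by rewrite addrAC; exact: inU.
    + apply: is_derive_on_line; apply: F1.
      by have := inU a 0 aI s0s; rewrite scale0r addr0.
  rewrite !scale0r !addr0 subr0 => EE.
  have aI' : 0 <= a <= s by move: aI; rewrite in_itv/= => /andP[/ltW-> /ltW->].
  have [||b bI E] := @mvt_line (fun x => 'D_v F x) (q + a *: v) w s.
  - exact: s0.
  - by move=> b bI; apply: Dv1; exact: inU.
  exists (q + a *: v + b *: w).
    by apply: inB => //; move: bI => /andP[/ltW-> /ltW->].
  rewrite expr2 mulrA unlock -E; move: EE; rewrite !(addrAC q (s *: w)) => <-.
  by rewrite /Delta; ring.
have [x2 B2 E2] : exists2 x, ball q r x & Delta = hess F x w v * s ^+ 2.
  have [||b bI] := @mvt (fun b => F (q + s *: v + b *: w) - F (q + b *: w))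
    (fun b => 'D_w F (q + s *: v + b *: w) - 'D_w F (q + b *: w)) 0 s.
  - exact: s0.
  - move=> b; rewrite in_itv/= => bI; apply: is_deriveB.
    + by apply: is_derive_on_line; apply: F1; exact: inU.
    + apply: is_derive_on_line; apply: F1.
      by have := inU 0 b s0s bI; rewrite scale0r addr0.
  rewrite !scale0r !addr0 subr0 => EE.
  have bI' : 0 <= b <= s by move: bI; rewrite in_itv/= => /andP[/ltW-> /ltW->].
  have [||a aI E] := @mvt_line (fun x => 'D_w F x) (q + b *: w) v s.
  - exact: s0.
  - by move=> a aI; apply: Dw1; rewrite addrAC; exact: inU.
  exists (q + b *: w + a *: v).
    by rewrite addrAC; apply: inB => //; move: aI => /andP[/ltW-> /ltW->].
  rewrite expr2 mulrA unlock -E; move: EE; rewrite !(addrAC q (b *: w)) => <-.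
  by rewrite /Delta; ring.
have E : hess F x1 v w = hess F x2 w v.
  apply: (mulIf (lt0r_neq0 (exprn_gt0 2 s0))); by rewrite -E1 -E2.
have [_ [_ h2]] := rB _ B2; have [_ [h1 _]] := rB _ B1.
rewrite (_ : _ - _ = hess F q v w - hess F x1 v w - (hess F q w v - hess F x2 w v)).
  rewrite (le_trans (ler_normB _ _))// (splitr e) lerD// ltW//.
by rewrite E; ring.
Qed.

End Calculus.

Section LocalConvexity.
Context {R : realType} {d : nat}.
Implicit Types (u v w p q z n : 'rV[R]_d) (F : 'rV[R]_d -> R) (t : R).

Local Opaque derive.

Section Hessian.
Variables (U : set 'rV[R]_d) (F : 'rV[R]_d -> R).
Hypotheses (oU : open U) (CF : Ck_on 2 U F).

Definition hess_mx q : 'M[R]_d :=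
  \matrix_(i, j) hess F q (delta_mx 0 i) (delta_mx 0 j).

Let dF q : U q -> differentiable F q. Proof. by case: CF => + _; apply. Qed.

Let dDF v q : U q -> differentiable (fun x => 'D_v F x) q.
Proof. by case: CF => _ /(_ v)[+ _]; apply. Qed.

Let cDDF v w q : U q -> {for q, continuous (fun x => hess F x v w)}.
Proof. by rewrite unlock; case: CF => _ /(_ v)[_ /(_ w)]; apply. Qed.

Lemma hess_mxE q v w : U q -> hess F q v w = dot (v *m hess_mx q) w.
Proof.
move=> Uq; rewrite hess_grad; last exact: dDF.
apply: eq_bigr => j _; congr (_ * _).
rewrite [RHS]mxE -dot_delta -hess_grad; last exact: dDF.
rewrite (hess_sym _ _ oU CF Uq) hess_grad; last exact: dDF.
rewrite dotC; apply: eq_bigr => i _; congr (_ * _).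
rewrite [RHS]mxE -dot_delta -hess_grad; last exact: dDF.
by rewrite (hess_sym _ _ oU CF Uq).
Qed.

Lemma hess_mx_sym q : U q -> (hess_mx q)^T = hess_mx q.
Proof.
by move=> Uq; apply/matrixP => i j; rewrite !mxE (hess_sym _ _ oU CF Uq).
Qed.

Lemma is_derive_grad X t u : U (X t) -> is_derive t 1 X u ->
  is_derive t 1 (fun s => grad F (X s)) (u *m hess_mx (X t)).
Proof.
move=> UX dX; apply/is_derive_rowP => i.
have := is_derive_along (dDF (delta_mx 0 i) UX) dX.
rewrite (_ : 'D_u _ _ = hess F (X t) (delta_mx 0 i) u); last by rewrite unlock.
rewrite (hess_sym _ _ oU CF UX) hess_mxE// dot_delta.
by congr is_derive; apply/funext => s; rewrite mxE.
Qed.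

Lemma grad_near q e : U q -> 0 < e ->
  \forall x \near q, dot (grad F x - grad F q) (grad F x - grad F q) < e.
Proof.
move=> Uq e0.
have : dot (grad F x - grad F q) (grad F x - grad F q) @[x --> q] --> (0 : R).
  rewrite [X in _ --> X](_ : _ = \sum_(i < d) 0); last by rewrite big1.
  apply: (@cvg_sumr R _ (nbhs q)) => i; rewrite -[X in _ --> X](mulr0 (0 : R)).
  have H : (grad F x - grad F q) 0 i @[x --> q] --> (0 : R).
    rewrite -[X in _ --> X](subrr ('D_(delta_mx 0 i) F q)).
    under eq_fun do rewrite !mxE.
    have cD := differentiable_continuous (dDF (delta_mx 0 i) Uq).
    exact: (cvgB cD (cvg_cst _)).
  by apply: cvgM.
by move/cvgrPdist_lt/(_ _ e0); apply: filterS => x; rewrite sub0r normrN => /(le_lt_trans (ler_norm _)).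
Qed.

Lemma hess_near q e : U q -> 0 < e ->
  \forall x \near q, forall v, `|hess F x v v - hess F q v v| <= e * dot v v.
Proof.
move=> Uq e0.
have d0 : 0 < (d%:R + 1 : R) ^+ 2 by rewrite exprn_gt0// ltr_wpDl.
near=> x => v.
have Ux : U x by near: x; exact: open_nbhs_nbhs.
rewrite !hess_mxE// -[_ - _]/(_ + - _) -dotNl -dotDl -mulmxBr.
have small i j : `|(hess_mx x - hess_mx q) i j| <= e / (d%:R + 1) ^+ 2.
  rewrite !mxE distrC.
  move: i j; near: x; apply: filter_forall => i; apply: filter_forall => j.
  have /cvgrPdist_le := @cDDF (delta_mx 0 i) (delta_mx 0 j) q Uq.
  by apply; rewrite divr_gt0.
have big k : `|(v *m (hess_mx x - hess_mx q)) 0 k| <= d%:R * (`|v| * (e / (d%:R + 1) ^+ 2)).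
  rewrite mxE (le_trans (ler_norm_sum _ _ _))//.
  rewrite (le_trans (ler_sum _ (G := fun=> `|v| * (e / (d%:R + 1) ^+ 2)) _))//.
    by move=> i _; rewrite normrM ler_pM// coord_le_norm.
  by rewrite sumr_const card_ord mulr_natl.
rewrite (le_trans (ler_norm_sum _ _ _))//.
rewrite (le_trans (ler_sum _ (G := fun=> d%:R * (`|v| * (e / (d%:R + 1) ^+ 2)) * `|v|) _))//.
  by move=> i _; rewrite normrM ler_pM// coord_le_norm.
rewrite sumr_const card_ord -mulr_natl.
apply: le_trans (_ : e * `|v| ^+ 2 <= _); last by rewrite ler_pM2l// sqr_norm_le_dot.
rewrite [leLHS](_ : _ = (e * `|v| ^+ 2) * (d%:R ^+ 2 / (d%:R + 1) ^+ 2)); last first.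
  by field.
rewrite ler_piMr//; first by rewrite mulr_ge0// ?sqr_ge0// ltW.
by rewrite ler_pdivrMr// mul1r ler_sqr ?nnegrE ?addr_ge0// lerDl.
Unshelve. all: by end_near. Qed.

Lemma hess_quadD q u v t : U q ->
  hess F q (u + t *: v) (u + t *: v) =
  hess F q u u + 2 * t * hess F q u v + t ^+ 2 * hess F q v v.
Proof.
move=> Uq.
have symuv : dot (u *m hess_mx q) v = dot (v *m hess_mx q) u.
  by rewrite -!hess_mxE// (hess_sym _ _ oU CF Uq).
by rewrite !hess_mxE// mulmxDl -scalemxAl !dotE symuv; ring.
Qed.

End Hessian.

End LocalConvexity.

Section HessianBound.
Context {R : realType} {d : nat}.
Implicit Types (u v w p q z n : 'rV[R]_d) (F : 'rV[R]_d -> R) (t : R).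

Local Opaque derive.

Lemma edist_to_le q (A : set 'rV[R]_d) y : A y -> edist_to q A <= enorm (q - y).
Proof.
move=> Ay; apply: ge_inf; last by exists y.
by exists 0 => _ [x _ <-]; exact: sqrtr_ge0.
Qed.

Lemma enorm_sqr u : enorm u ^+ 2 = dot u u.
Proof. by rewrite sqr_sqrtr// dot_ge0. Qed.

Lemma enorm_gt0 u : (0 < enorm u) = (u != 0).
Proof. by rewrite sqrtr_gt0 dot_gt0. Qed.

Lemma enormZ (c : R) u : enorm (c *: u) = `|c| * enorm u.
Proof. by rewrite /enorm !dotE mulrA -expr2 sqrtrM ?sqr_ge0// sqrtr_sqr. Qed.

Lemma ivt_zero (f : R -> R) (a b : R) : a <= b ->
  (forall x, x \in `[a, b]%R -> {for x, continuous f}) -> f a <= 0 -> 0 <= f b ->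
  exists2 c, a <= c <= b & f c = 0.
Proof.
move=> ab cf fa fb.
have cfI : {within `[a, b], continuous f}.
  by apply: continuous_in_subspaceT => x; rewrite inE; exact: cf.
have H : Num.min (f a) (f b) <= 0 <= Num.max (f a) (f b).
  by rewrite ge_min fa le_max fb orbT.
by have [c cI E] := IVT ab cfI H; exists c => //; move: cI; rewrite in_itv.
Qed.

Lemma hess_tangent_bound (U S : set 'rV[R]_d) F p C : open U -> Ck_on 2 U F -> U p ->
  S `&` U = U `&` [set x | F x = 0] -> F p = 0 ->
  normal S p = grad F p -> grad F p != 0 -> 0 < C ->
  (\forall q \near p, S q -> q != p ->
     edist_to q (tangent_hyperplane S p) > C * enorm (q - p) ^+ 2) ->
  forall z, dot (grad F p) z = 0 -> C * enorm (grad F p) * dot z z <= `|hess F p z z|.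
Proof.
move=> oU CF Up SU Fp nS n0 C0 near_dist z nz; rewrite leNgt; apply/negP => small.
have dF q : U q -> differentiable F q by case: CF => + _; apply.
have dDF v q : U q -> differentiable (fun x => 'D_v F x) q.
  by case: CF => _ /(_ v)[+ _]; apply.
pose n := grad F p; pose a := enorm n; pose c := hess F p z z; pose B := C * dot z z.
have a0 : 0 < a by rewrite enorm_gt0.
have z0 : z != 0.
  by apply: contraTneq small => ->; rewrite dot0l mulr0 -leNgt.
have zz0 : 0 < dot z z by rewrite dot_gt0.
have B0 : 0 < B by rewrite mulr_gt0.
have smallB : `|c| < B * a by move: small; rewrite /B -/n -/a -/c; nra.
pose eta := a * (B * a - `|c|) / (2 * a + B).
have D0 : 0 < 2 * a + B by rewrite addr_gt0// mulr_gt0.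
have etaE : eta * (2 * a + B) = a * (B * a - `|c|) by rewrite divfK// gt_eqF.
have eta0 : 0 < eta by rewrite divr_gt0// mulr_gt0// subr_gt0.
pose m := a ^+ 2 - eta.
have c0 : 0 <= `|c| by exact: normr_ge0.
have m0 : 0 < m.
  rewrite -(pmulr_rgt0 _ D0) mulrC mulrBl etaE.
  have : 0 < a ^+ 2 * (2 * a) by rewrite mulr_gt0 ?exprn_gt0// mulr_gt0.
  have : 0 <= a * `|c| by rewrite mulr_ge0// ltW.
  by clear; lra.
pose K := (`|c| + 2 * eta) / m.
have K0 : 0 < K by rewrite divr_gt0// ltr_wpDl// mulr_gt0.
have Km : K * m = `|c| + 2 * eta by rewrite divfK// gt_eqF.
have N1 : nbhs p U by exact: open_nbhs_nbhs.
have N2 := hess_near oU CF Up (divr_gt0 eta0 zz0).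
have DnFp : 'D_n F p = a ^+ 2 by rewrite derive_grad ?enorm_sqr//; exact: dF.
have N3 : \forall x \near p, `|'D_n F p - 'D_n F x| < eta.
  by have /cvgrPdist_lt := differentiable_continuous (dDF n _ Up) => /(_ _ eta0).
have [r /= r0 rB] : exists2 r : R, 0 < r & forall x, ball p r x ->
   [/\ U x, `|hess F x z z - c| <= eta, m <= 'D_n F x &
     S x -> x != p -> edist_to x (tangent_hyperplane S p) > C * enorm (x - p) ^+ 2].
  have [r /= r0 rB] := (nbhs_ballP _ _).1 (filterI (filterI N1 N2) (filterI N3 near_dist)).
  exists r => // x /rB[[Ux h2] [h3 h4]]; split => //.
    by have := h2 z; rewrite divfK// gt_eqF.
  by move: h3; rewrite DnFp /m ltr_norml; clear; lra.
pose D := `|z| + K * `|n|.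
have D'0 : 0 <= D by rewrite addr_ge0// mulr_ge0// ltW.
pose eps := r / (D + r + 1).
have D1 : 0 < D + r + 1 by rewrite addr_gt0// ltr_wpDl.
have epsE : eps * (D + r + 1) = r by rewrite divfK// gt_eqF.
have eps0 : 0 < eps by rewrite divr_gt0.
have eps1 : eps <= 1 by rewrite ler_pdivrMr// mul1r; clear -D'0; lra.
pose sg := eps ^+ 2 * K.
have sg0 : 0 < sg by rewrite mulr_gt0// exprn_gt0.
have sgm : sg * m = eps ^+ 2 * (`|c| + 2 * eta) by rewrite -mulrA Km.
have inB t s : 0 <= t <= eps -> `|s| <= sg -> ball p r (p + t *: z + s *: n).
  move=> /andP[t0 te] ss; rewrite ball_rowE -addrA opprD addrA subrr add0r normrN.
  apply: le_lt_trans (ler_normD _ _) _; rewrite !normrZ (ger0_norm t0).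
  have h1 : t * `|z| <= eps * `|z| by rewrite ler_wpM2r.
  have h2 : `|s| * `|n| <= eps * (K * `|n|).
    rewrite mulrA ler_wpM2r// (le_trans ss)// /sg expr2 -mulrA ler_piMl//.
    by rewrite mulr_ge0// ltW.
  rewrite -epsE (le_lt_trans (lerD h1 h2))// -mulrDr ltr_pM2l//.
  by rewrite /D; clear -r0; lra.
have inB0 t : 0 <= t <= eps -> ball p r (p + t *: z).
  by move=> tI; have := inB t 0 tI; rewrite normr0 scale0r addr0; apply; exact: ltW.
pose q0 := p + eps *: z.
have Fq0 : `|F q0| <= (`|c| + eta) * eps ^+ 2.
  have [||t1 t1I E1] := @mvt_line _ _ F p z eps.
  - exact: eps0.
  - by move=> t tI; apply: dF; have [] := rB _ (inB0 _ tI).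
  have /andP[t10 t1e] := t1I.
  have [||t2 t2I E2] := @mvt_line _ _ (fun x => 'D_z F x) p z t1.
  - exact: t10.
  - move=> t /andP[tl tr]; apply: dDF.
    have Bt : ball p r (p + t *: z) by apply: inB0; rewrite tl (le_trans tr)// ltW.
    by have [] := rB _ Bt.
  have E3 : 'D_z (fun x => 'D_z F x) (p + t2 *: z) = hess F (p + t2 *: z) z z by rewrite unlock.
  have Dp : 'D_z F p = 0 by rewrite derive_grad//; exact: dF.
  move: E1; rewrite Fp subr0 => ->; move: E2; rewrite Dp subr0 => ->; rewrite E3.
  have /andP[t20 t2t] := t2I.
  have Bt2 : ball p r (p + t2 *: z).
    by apply: inB0; rewrite (ltW t20) (ltW (lt_trans t2t t1e)).
  have [_ hb _ _] := rB _ Bt2.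
  rewrite -mulrA normrM; apply: ler_pM => //.
    rewrite -lerBlDl; apply: le_trans hb.
    exact: lerB_dist.
  rewrite ger0_norm; last by rewrite mulr_ge0// ltW.
  by rewrite expr2 ler_pM2r// ltW.
have epsI : 0 <= eps <= eps by rewrite (ltW eps0) lexx.
have step s : `|s| <= sg -> U (q0 + s *: n).
  by move=> hs; have [] := rB _ (inB eps s epsI hs).
have gap : (`|c| + eta) * eps ^+ 2 < sg * m.
  rewrite sgm mulrC ltr_pM2l ?exprn_gt0//; clear -eta0; lra.
have Dn s : `|s| <= sg -> m <= 'D_n F (q0 + s *: n).
  by move=> hs; have [] := rB _ (inB eps s epsI hs).
have Fup : 0 <= F (q0 + sg *: n).
  have [||t tI E] := @mvt_line _ _ F q0 n sg.
  - exact: sg0.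
  - move=> t /andP[tl tr]; apply: dF; apply: step.
    by rewrite ger0_norm.
  have /andP[t0 tsg] := tI.
  have h := Dn t; rewrite ger0_norm in h; last exact: ltW.
  have := ler_wpM2r (ltW sg0) (h (ltW tsg)); rewrite -E => h1.
  by move: Fq0; rewrite ler_norml => /andP[h2 _]; clear -h1 h2 gap; lra.
have Fdn : F (q0 + (- sg) *: n) <= 0.
  have [||t tI E] := @mvt_line _ _ F (q0 + (- sg) *: n) n sg.
  - exact: sg0.
  - move=> t /andP[tl tr]; apply: dF; rewrite -addrA -scalerDl; apply: step.
    by rewrite ler_norml; clear -tl tr sg0; apply/andP; split; lra.
  have /andP[t0 tsg] := tI.
  have h : m <= 'D_n F (q0 + (- sg) *: n + t *: n).
    rewrite -addrA -scalerDl; apply: Dn.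
    by rewrite ler_norml; clear -t0 tsg; apply/andP; split; lra.
  have := ler_wpM2r (ltW sg0) h; rewrite -E.
  rewrite -addrA -scalerDl addNr scale0r addr0 => h1.
  by move: Fq0; rewrite ler_norml => /andP[_ h2]; clear -h1 h2 gap; lra.
have [||||s sI Fs] := @ivt_zero (fun s => F (q0 + s *: n)) (- sg) sg.
- by clear -sg0; lra.
- move=> s; rewrite in_itv/= => sI; apply: is_derive_continuous.
  by apply: is_derive_on_line; apply: dF; apply: step; rewrite ler_norml.
- exact: Fdn.
- exact: Fup.
have ssg : `|s| <= sg by rewrite ler_norml.
pose q := q0 + s *: n.
have Sq : S q.
  suff [] : (S `&` U) q by [].
  by rewrite SU; split => //; exact: step.
have qpE : q - p = eps *: z + s *: n.
  by rewrite /q /q0 addrAC (addrC p) addrK addrC.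
have zn : dot z n = 0 by rewrite dotC.
have qp : q != p.
  rewrite -subr_eq0 qpE; apply/eqP => E0.
  have : dot (eps *: z + s *: n) z = 0 by rewrite E0 dot0l.
  rewrite !dotE nz mulr0 addr0 => /eqP; rewrite mulf_eq0 (gt_eqF eps0) (gt_eqF zz0).
  by [].
have [_ _ _ /(_ Sq qp)] := rB _ (inB eps s epsI ssg).
have : edist_to q (tangent_hyperplane S p) <= enorm (q - q0).
  apply: edist_to_le; rewrite /tangent_hyperplane/= nS.
  by rewrite /q0 addrC addKr !dotE nz mulr0.
rewrite [q - q0](_ : _ = s *: n); last by rewrite /q addrC addKr.
rewrite enormZ -/a enorm_sqr -/q0 -/q qpE !dotE zn nz !mulr0 addr0 add0r => h1 h2.
have h3 : C * (eps * (eps * dot z z) + s * (s * dot n n)) < sg * a.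
  by apply: lt_le_trans h2 _; apply: le_trans h1 _; rewrite ler_wpM2r// ltW.
have h4 : eps ^+ 2 * B < sg * a.
  apply: le_lt_trans h3; rewrite mulrDr (_ : C * (eps * _) = eps ^+ 2 * B); last by rewrite /B; ring.
  rewrite lerDl; apply: mulr_ge0; first exact: ltW.
  by rewrite mulrA -expr2 mulr_ge0 ?sqr_ge0 ?dot_ge0.
have h5 : B < K * a by move: h4; rewrite /sg -mulrA ltr_pM2l// exprn_gt0.
have h6 : B * m < (`|c| + 2 * eta) * a.
  by rewrite -Km -mulrA (mulrC m a) mulrA ltr_pM2r.
by move: h6; rewrite /m; clear -etaE; lra.
Qed.

End HessianBound.

(** * Strictly convex local equations *)

Section LocalEquation.
Context {R : realType} {d : nat}.
Implicit Types (u v w p q z n : 'rV[R]_d) (F G : 'rV[R]_d -> R) (g : 'rV[R]_d -> 'rV[R]_d)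
  (X : R -> 'rV[R]_d) (S : set 'rV[R]_d) (t : R).

Local Opaque derive.

Lemma hess_definite_sign (U : set 'rV[R]_d) F p n C : open U -> Ck_on 2 U F -> U p ->
  0 < C -> (forall z, dot n z = 0 -> C * dot z z <= `|hess F p z z|) ->
  exists2 s : R, s ^+ 2 = 1 & forall z, dot n z = 0 -> C * dot z z <= s * hess F p z z.
Proof.
move=> oU CF Up C0 bd.
have hessZ k z : hess F p (k *: z) (k *: z) = k ^+ 2 * hess F p z z.
  by rewrite !(hess_mxE oU CF)// -scalemxAl !dotE; ring.
have [pos|/existsNP[z0 /not_implyP[nz0 /negP]]] :=
  pselect (forall z, dot n z = 0 -> C * dot z z <= hess F p z z).
  by exists 1; rewrite ?expr1n// => z /pos; rewrite mul1r.
rewrite -ltNge => lt0; exists (-1); first by rewrite sqrrN expr1n.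
move=> z1 nz1; rewrite mulN1r leNgt; apply/negP => lt1.
have h0 : hess F p z0 z0 <= - (C * dot z0 z0).
  by have := bd _ nz0; rewrite ler_normr => /orP[]; [rewrite leNgt lt0|rewrite lerNr].
have h1 : C * dot z1 z1 <= hess F p z1 z1.
  by have := bd _ nz1; rewrite ler_normr => /orP[//|]; rewrite leNgt lt1.
have zz0 := dot_ge0 z0; have zz1 := dot_ge0 z1.
have h0' : hess F p z0 z0 < 0 by clear -h0 lt0 zz0 C0; nra.
have h1' : 0 < hess F p z1 z1 by clear -h1 lt1 zz1 C0; nra.
pose P := hess F p (z1 - z0) (z1 - z0) *: 'X^2 + (2 * hess F p z0 (z1 - z0)) *: 'X +
  (hess F p z0 z0)%:P.
have PE t : P.[t] = hess F p (z0 + t *: (z1 - z0)) (z0 + t *: (z1 - z0)).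
  by rewrite (hess_quadD oU CF)// /P !(hornerD, hornerZ, hornerXn, hornerX, hornerC) ; ring.
have [||||t tI] := @ivt_zero _ (horner P) 0 1.
- exact: ler01.
- by move=> x _; exact: continuous_horner.
- by rewrite PE scale0r addr0 ltW.
- by rewrite PE scale1r addrC subrK ltW.
have nzt : dot n (z0 + t *: (z1 - z0)) = 0 by rewrite !dotE nz0 nz1; ring.
rewrite PE => ht; have := bd _ nzt.
rewrite ht normr0 pmulr_rle0// => zt.
have {}zt : z0 + t *: (z1 - z0) = 0.
  by apply/eqP; rewrite -dot_eq0 eq_le zt dot_ge0.
have E : (1 - t) *: z0 = (- t) *: z1.
  apply/eqP; rewrite -subr_eq0 -zt; apply/eqP/rowP => i; rewrite !mxE; ring.
have := congr1 (fun z => hess F p z z) E; rewrite !hessZ => {}E.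
have [t1|t1] := eqVneq t 1.
  move: E; rewrite t1 subrr expr0n mul0r sqrrN expr1n mul1r => E.
  by rewrite -E ltxx in h1'.
have : (1 - t) ^+ 2 * hess F p z0 z0 < 0.
  by rewrite pmulr_rlt0// lt_def sqrf_eq0 subr_eq0 eq_sym t1 sqr_ge0.
by rewrite E ltNge mulr_ge0 ?sqr_ge0// ltW.
Qed.

Lemma local_strict (U : set 'rV[R]_d) F p C s : open U -> Ck_on 2 U F -> U p ->
  grad F p != 0 -> 0 < C -> s ^+ 2 = 1 ->
  (forall z, dot (grad F p) z = 0 -> C * dot z z <= s * hess F p z z) ->
  exists r : R, [/\ 0 < r, ball p r `<=` U &
    forall q q', ball p r q -> ball p r q' -> q' != q -> F q = 0 -> s * F q' <= 0 ->
      s * dot (grad F q) (q' - q) < 0].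
Proof.
move=> oU CF Up n0 C0 s2 bd.
have dF q : U q -> differentiable F q by case: CF => + _; apply.
have dDF v q : U q -> differentiable (fun x => 'D_v F x) q.
  by case: CF => _ /(_ v)[+ _]; apply.
pose n := grad F p; pose nn := dot n n; pose mv := n *m hess_mx F p.
have nn0 : 0 < nn by rewrite dot_gt0.
pose h := `|hess F p n n|; have h0 : 0 <= h by exact: normr_ge0.
pose M := dot mv mv; have M0 : 0 <= M by exact: dot_ge0.
pose K := C * nn / 2 + 2 * M / C + h.
have K0 : 0 < K.
  by rewrite /K ltr_pwDl// ltr_pwDl// ?divr_gt0// ?mulr_gt0// divr_ge0// ?mulr_ge0// ltW.
have d'0 : 0 < C * nn ^+ 2 / (8 * K) by rewrite divr_gt0// mulr_gt0// exprn_gt0.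
have d0 : 0 < C / 8 by rewrite divr_gt0.
have N1 : nbhs p U by exact: open_nbhs_nbhs.
have [r /= r0 rB] := (nbhs_ballP _ _).1
  (filterI N1 (filterI (hess_near oU CF Up d0) (grad_near CF Up d'0))).
have s0 : s != 0 by rewrite -sqrf_eq0 s2 oner_eq0.
exists r; split => // [x /rB[]//|q q' Bq Bq' qq' Fq Fq'].
rewrite ltNge; apply/negP; set e := q' - q => ge0.
have qe : q + e = q' by rewrite /e addrC subrK.
have eN0 : e != 0 by rewrite subr_eq0.
have Be t : 0 <= t <= 1 -> ball p r (q + t *: e) by move=> tI; exact: ball_convex.
clearbody e.
have [||t1 t1I] := @mvt_line _ _ F q e 1.
- exact: ltr01.
- by move=> t tI; apply: dF; have [] := rB _ (Be t tI).
rewrite scale1r qe Fq subr0 mulr1 => E1.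
have /andP[t10 t11] := t1I.
have tI t : 0 <= t <= t1 -> 0 <= t <= 1.
  by move=> /andP[tl tr]; rewrite tl (le_trans tr)// ltW.
have Dq x : U x -> 'D_e F x = dot (grad F x) e by move=> Ux; apply: derive_grad; exact: dF.
have Uq : U q by have [] := rB _ Bq.
have [||t2 t2I] := @mvt_line _ _ (fun x => 'D_e F x) q e t1.
- exact: t10.
- by move=> t /tI tt; apply: dDF; have [] := rB _ (Be t tt).
rewrite -E1 (_ : 'D_e (fun x => 'D_e F x) _ = hess F (q + t2 *: e) e e); last by rewrite unlock.
rewrite Dq// => E2.
have hle : s * hess F (q + t2 *: e) e e <= 0.
  rewrite -(pmulr_lle0 _ t10) -mulrA -E2 mulrBr subr_le0; exact: le_trans Fq' ge0.
have [||||t3 t3I] := @ivt_zero _ (fun t => - s * 'D_e F (q + t *: e)) 0 t1.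
- exact: ltW.
- move=> x; rewrite in_itv/= => /tI xI; have [Ux _] := rB _ (Be x xI).
  have cD := is_derive_continuous (is_derive_on_line (dDF e _ Ux)).
  exact: (cvgM (cvg_cst _) cD).
- by rewrite scale0r addr0 Dq// mulNr oppr_le0.
- by rewrite -E1 mulNr oppr_ge0.
have [U3 [_ g3]] := rB _ (Be t3 (tI _ t3I)).
rewrite Dq// => /eqP; rewrite mulf_eq0 oppr_eq0 (negbTE s0)/= => /eqP E3.
set g := grad F _ in g3 E3.
have t2I' : 0 <= t2 <= 1 by apply: tI; have /andP[/ltW-> /ltW->] := t2I.
have [_ [/(_ e) h2 _]] := rB _ (Be t2 t2I').
have ee0 : 0 < dot e e by rewrite dot_gt0.
have ne : dot n e ^+ 2 <= C * nn ^+ 2 / (8 * K) * dot e e.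
  rewrite (_ : dot n e = - dot (g - n) e); last by rewrite !dotE E3; ring.
  rewrite sqrrN (le_trans (cauchy_schwarz _ _))// ler_wpM2r ?dot_ge0// ltW//.
pose c := dot n e / nn; pose z := e - c *: n.
have zE : e = z + c *: n by rewrite subrK.
have nz : dot n z = 0 by rewrite /z !dotE -/nn /c divfK ?subrr// gt_eqF.
clearbody z.
have eeE : dot e e = dot z z + c ^+ 2 * nn.
  by rewrite zE !dotE (dotC z n) nz -/nn; ring.
have c2 : c ^+ 2 * K <= C / 8 * dot e e.
  rewrite /c expr_div_n mulrAC ler_pdivrMr ?exprn_gt0//.
  have -> : C / 8 * dot e e * nn ^+ 2 = C * nn ^+ 2 / (8 * K) * dot e e * K.
    by field; rewrite gt_eqF.
  by rewrite ler_wpM2r// ltW.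
have hE : hess F p e e = hess F p z z + 2 * c * dot z mv + c ^+ 2 * hess F p n n.
  rewrite {1 2}zE (hess_quadD oU CF)//; congr (_ + _ + _); congr (_ * _).
  by rewrite (hess_sym _ _ oU CF)// (hess_mxE oU CF)// dotC.
have hz := bd _ nz.
have cs := cauchy_schwarz z mv; rewrite -/M in cs.
have s1 : s = 1 \/ s = -1.
  by move/eqP: s2; rewrite sqrf_eq1 => /orP[/eqP->|/eqP->]; [left|right].
have zz := dot_ge0 z.
have cross : 2 * `|c * dot z mv| <= C / 2 * dot z z + 2 * M / C * c ^+ 2.
  have P0 : 0 <= C / 2 * dot z z by rewrite mulr_ge0// divr_ge0// ltW.
  have Q0 : 0 <= 2 * M / C * c ^+ 2 by rewrite mulr_ge0 ?sqr_ge0// divr_ge0 ?mulr_ge0// ltW.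
  rewrite -(@ler_pXn2r _ 2)// ?nnegrE ?addr_ge0// ?mulr_ge0//.
  rewrite exprMn real_normK ?num_real// exprMn.
  have PQ : C / 2 * dot z z * (2 * M / C * c ^+ 2) = c ^+ 2 * (dot z z * M).
    by field; rewrite gt_eqF.
  have : c ^+ 2 * dot z mv ^+ 2 <= c ^+ 2 * (dot z z * M) by rewrite ler_wpM2l// sqr_ge0.
  have := sqr_ge0 (C / 2 * dot z z - 2 * M / C * c ^+ 2).
  rewrite sqrrB sqrrD -PQ; clear; lra.
have sh : s * hess F p e e <= C / 8 * dot e e.
  have : s * (hess F (q + t2 *: e) e e - hess F p e e) >= - (C / 8 * dot e e).
    by move: h2; rewrite ler_norml => /andP[]; case: s1 => ->; clear; lra.
  move: hle; clear; lra.
have sh' : C * dot z z - 2 * `|c * dot z mv| - c ^+ 2 * h <= s * hess F p e e.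
  rewrite hE; have := ler_norm (c * dot z mv); have := ler_norm (- (c * dot z mv)).
  have : c ^+ 2 * hess F p n n <= c ^+ 2 * h by rewrite ler_wpM2l ?sqr_ge0// ler_norm.
  have : - (c ^+ 2 * h) <= c ^+ 2 * hess F p n n.
    by rewrite -mulrN ler_wpM2l ?sqr_ge0// lerNl /h -normrN ler_norm.
  rewrite normrN; move: hz; case: s1 => ->; clear; lra.
have cK : c ^+ 2 * K = C / 2 * (c ^+ 2 * nn) + 2 * M / C * c ^+ 2 + c ^+ 2 * h.
  by rewrite /K; field; rewrite gt_eqF.
have Ce0 : 0 < C * dot e e by rewrite mulr_gt0.
have CeE : C * dot e e = C * dot z z + C * (c ^+ 2 * nn) by rewrite eeE mulrDr.
by move: sh sh' cross c2 Ce0 CeE; rewrite cK; clear; lra.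
Qed.

(** A local equation [G = 0] of [S] near [p] that makes [S] strictly convex; [g] is the
    gradient of [G] and [A] its Hessian at [p]. *)
Record local_equation S p G g (A : 'M[R]_d) (r : R) : Prop := LocalEquation {
  le_radius : 0 < r;
  le_zero : forall q, ball p r q -> S q <-> G q = 0;
  le_deriv : forall X t u, ball p r (X t) -> is_derive t 1 X u ->
    is_derive t 1 (fun t => G (X t)) (dot (g (X t)) u);
  le_strict : forall q q', ball p r q -> ball p r q' -> q' != q -> G q = 0 -> G q' <= 0 ->
    dot (g q) (q' - q) < 0;
  le_dir : forall q, ball p r q -> 0 < dot (g q) (g p);
  le_continuous : forall q, ball p r q -> {for q, continuous G};
  le_cont : forall e, 0 < e -> \forall q \near p, dot (g q - g p) (g q - g p) < e;
  le_hess : forall X t u, X t = p -> is_derive t 1 X u ->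
    is_derive t 1 (fun t => g (X t)) (u *m A);
  le_sym : A^T = A;
  le_pos : forall z, dot (g p) z = 0 -> z != 0 -> 0 < dot (z *m A) z;
  le_normal : exists2 c, c != 0 & normal S p = c *: g p
}.

Lemma normalP S p : C2_hypersurface S -> S p -> normal_at S p (normal S p).
Proof. by move=> CS Sp; have [n nP] := CS p Sp; exact: (xgetI 0 nP). Qed.

Lemma local_equation_exists S p : C2_hypersurface S -> strictly_convex S -> S p ->
  exists G g A r, local_equation S p G g A r.
Proof.
move=> CS sS Sp; have [n0 [U [F [oU Up CF SU nF]]]] := normalP CS Sp.
have dF q : U q -> differentiable F q by case: CF => + _; apply.
have nE : normal S p = grad F p.
  by apply: dot_inj => v; rewrite -nF derive_grad//; exact: dF.
have Fp : F p = 0.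
  by have [] : (U `&` [set x | F x = 0]) p by rewrite -SU.
have gp0 : grad F p != 0 by rewrite -nE.
have [C C0 nearC] := sS _ Sp.
have C'0 : 0 < C * enorm (grad F p) by rewrite mulr_gt0// enorm_gt0.
have [s s2 hs] := hess_definite_sign oU CF Up C'0
  (hess_tangent_bound oU CF Up SU Fp nE gp0 C0 nearC).
have [r1 [r10 r1U r1s]] := local_strict oU CF Up gp0 C'0 s2 hs.
have s0 : s != 0 by rewrite -sqrf_eq0 s2 oner_eq0.
pose nn := dot (grad F p) (grad F p); have nn0 : 0 < nn by rewrite dot_gt0.
have [r2 /= r20 r2B] := (nbhs_ballP _ _).1 (grad_near CF Up nn0).
pose r := Num.min r1 r2.
have sub1 : ball p r `<=` ball p r1 by apply: le_ball; rewrite ge_min lexx.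
have sub2 : ball p r `<=` ball p r2 by apply: le_ball; rewrite ge_min lexx orbT.
have dotss u v : dot (s *: u) (s *: v) = dot u v.
  by rewrite !dotE mulrA -expr2 s2 mul1r.
exists (fun x => s * F x), (fun x => s *: grad F x), (s *: hess_mx F p), r; split.
- by rewrite lt_min r10.
- move=> q /sub1/r1U Uq; split=> [Sq|/eqP].
    have [_ ->] : (U `&` [set x | F x = 0]) q by rewrite -SU.
    by rewrite mulr0.
  rewrite mulf_eq0 (negbTE s0)/= => /eqP Fq.
  by have [] : (S `&` U) q by rewrite SU.
- move=> X t u /sub1/r1U Uq dX; have := is_derive_along (dF _ Uq) dX.
  rewrite derive_grad; last exact: dF.
  move=> dFX; have := is_derive_mul (is_derive_cst (s : R^o) t 1) dFX.
  by rewrite mul0r add0r dotZl.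
- move=> q q' /sub1 Bq /sub1 Bq' qq' /eqP; rewrite mulf_eq0 (negbTE s0)/= => /eqP Fq Fq'.
  by rewrite dotZl; exact: r1s.
- move=> q /sub2/r2B; rewrite dotss => small.
  have := cauchy_schwarz (grad F q - grad F p) (grad F p); rewrite -/nn.
  have -> : dot (grad F q) (grad F p) = dot (grad F q - grad F p) (grad F p) + nn.
    by rewrite !dotE -/nn; ring.
  rewrite -/nn in small; move: (dot (_ - _) (grad F p)) (dot (_ - _) (_ - _)) small => x y.
  by clear -nn0; nra.
- move=> q /sub1/r1U Uq; have cF := differentiable_continuous (dF _ Uq).
  exact: (cvgM (cvg_cst _) cF).
- move=> e e0; apply: filterS (grad_near CF Up e0) => q.
  by rewrite -scalerBr dotss.
- move=> X t u Xp dX.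
  have UX : U (X t) by rewrite Xp.
  have := is_derive_scale (is_derive_cst (s : R^o) t 1) (is_derive_grad oU CF UX dX).
  by rewrite scale0r add0r Xp scalemxAr.
- by rewrite linearZ/= (hess_mx_sym oU CF).
- move=> z; rewrite dotZl => /eqP; rewrite mulf_eq0 (negbTE s0)/= => /eqP nz z0.
  rewrite -scalemxAr dotZl -(hess_mxE oU CF)//.
  by apply: lt_le_trans (hs _ nz); rewrite mulr_gt0// dot_gt0.
- by exists s => //; rewrite scalerA -expr2 s2 scale1r.
Qed.

End LocalEquation.

(** * Convexity of the domain *)

Section Convexity.
Context {R : realType} {d : nat}.
Implicit Types (u v w p q z n : 'rV[R]_d) (t : R).

Lemma ball_shift p q v (r s : R) : ball p r q -> `|v| <= s -> ball p (r + s) (q + v).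
Proof.
rewrite !ball_rowE => h hv; rewrite opprD addrA (le_lt_trans (ler_normB _ _))//.
by rewrite ltr_leD.
Qed.

Lemma small_scale v (e : R) : 0 < e -> exists2 t : R, 0 < t & t * `|v| < e.
Proof.
move=> e0; have D0 : 0 < `|v| + 1 by rewrite ltr_wpDl.
exists (e / (`|v| + 1)); first by rewrite divr_gt0.
rewrite mulrAC ltr_pdivrMr// ltr_pM2l//; lra.
Qed.

Lemma line_continuous u v : continuous (fun t : R => u + t *: v).
Proof. by move=> t; apply: cvgD; [exact: cvg_cst|exact: scalel_continuous]. Qed.

Lemma combination_near x y t (e : R) x' y' : 0 <= t <= 1 -> ball x e x' -> ball y e y' ->
  ball (x + t *: (y - x)) e (x' + t *: (y' - x') : 'rV[R]_d).
Proof.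
rewrite !ball_rowE => /andP[t0 t1] hx hy.
rewrite (_ : _ - _ = (1 - t) *: (x - x') + t *: (y - y')); last first.
  by apply/rowP => i; rewrite !mxE; ring.
have t1' : 0 <= 1 - t by rewrite subr_ge0.
rewrite (le_lt_trans (ler_normD _ _))// !normrZ (ger0_norm t0) (ger0_norm t1').
have [->|tN0] := eqVneq t 0; first by clear -hx; lra.
have : 0 < t * (e - `|y - y'|) by rewrite mulr_gt0 ?subr_gt0// lt_def tN0.
have : 0 <= (1 - t) * (e - `|x - x'|) by rewrite mulr_ge0// subr_ge0 ltW.
by clear; lra.
Qed.

Lemma addBl u v : u + v - u = v.
Proof. by rewrite addrAC subrr add0r. Qed.

Lemma gt0_of_near (a x : R) : `|a - x| < a -> 0 < x.
Proof. by rewrite ltr_norml; lra. Qed.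

Section Body.
Variables (Om : set 'rV[R]_d).
Hypothesis hd : (3 <= d)%N.
Hypothesis hOm : strictly_convex_closed_boundary Om.

Let S := boundary Om.

Let oOm : open Om. Proof. by case: hOm => -[]. Qed.

Lemma boundaryE q : S q <-> closure Om q /\ ~ Om q.
Proof. by rewrite /S /boundary /setD/= (iffLR (interior_id _) oOm). Qed.

Lemma segment_propagate u v : (forall t, 0 <= t <= 1 -> ~ S (u + t *: (v - u))) ->
  Om u -> Om v.
Proof.
move=> notS Ou; suff H : forall t, `[0, 1]%classic t -> Om (u + t *: (v - u)).
  have := H 1; rewrite scale1r addrC subrK; apply.
  by rewrite /= in_itv/= ler01 lexx.
apply: (connected_propagate (P := fun t => Om (u + t *: (v - u)))
  (@segment_connected R 0 1)).
- exists 0; first by rewrite /= in_itv/= ler01 lexx.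
  by rewrite scale0r addr0.
- move=> s _ Os; have nO : nbhs (u + s *: (v - u)) Om by exact: open_nbhs_nbhs.
  have nt : nbhs s [set t | Om (u + t *: (v - u))] := @line_continuous u (v - u) s _ nO.
  by apply: filterS nt.
- move=> s sI lim; have := notS s; rewrite boundaryE => H.
  apply: contrapT => nO; apply: H => //; split => // V /line_continuous/lim[t' [_ Vt Ot]].
  by exists (u + t' *: (v - u)).
Qed.

Lemma equation_increasing p G g A r q v (s : R) : local_equation S p G g A r -> 0 < s ->
  (forall t, 0 <= t <= s -> ball p r (q + t *: v) /\ 0 < dot (g (q + t *: v)) v) ->
  G q < G (q + s *: v).
Proof.
move=> L s0 H; have [||t tI E] := @mvt _ (fun t => G (q + t *: v))
  (fun t => dot (g (q + t *: v)) v) 0 s.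
- exact: s0.
- move=> t; rewrite in_itv/= => /H[Bt _].
  exact: (le_deriv L Bt (is_derive_line _ _ _)).
move: E; rewrite scale0r addr0 subr0 => E; rewrite -subr_gt0 E mulr_gt0//.
by apply: (H t _).2; move: tI; rewrite in_itv/= => /andP[/ltW-> /ltW->].
Qed.

Lemma same_side p G g A r (s : R) : S p -> local_equation S p G g A r -> s ^+ 2 = 1 ->
  exists r', [/\ 0 < r', r' <= r & forall q1 q2, ball p r' q1 -> ball p r' q2 ->
    0 < s * G q1 -> 0 < s * G q2 -> Om q1 -> Om q2].
Proof.
move=> Sp L s2; have r0 := le_radius L; set n := g p.
have r20 : 0 < r / 2 by rewrite divr_gt0.
have s1 : `|s| = 1 by apply/eqP; rewrite -sqr_norm_eq1 s2.
have [h h0 hn] := small_scale n r20.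
have inB q t : ball p (r / 2) q -> 0 <= t <= h -> ball p r (q + t *: (s *: n)).
  move=> Bq /andP[t0 th]; rewrite [r]splitr; apply: ball_shift => //.
  rewrite !normrZ s1 mul1r (ger0_norm t0) (le_trans _ (ltW hn))//.
  by rewrite ler_wpM2r.
have up q t : ball p (r / 2) q -> 0 < t <= h -> s * G q < s * G (q + t *: (s *: n)).
  move=> Bq /andP[t0 th].
  have [s_1|s_1] : s = 1 \/ s = -1.
    by move/eqP: s2; rewrite sqrf_eq1 => /orP[/eqP->|/eqP->]; [left|right].
  - rewrite s_1 !mul1r scale1r; apply: (equation_increasing L t0) => t' /andP[t'0 t't].
    have Bt : ball p r (q + t' *: n).
      by have := inB q t' Bq; rewrite s_1 scale1r; apply; rewrite t'0 (le_trans t't).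
    by split => //; exact: le_dir L _ Bt.
  - rewrite s_1 !mulN1r ltrN2 scaleN1r.
    rewrite -[X in G X < G q]addr0 -[X in _ < G X](_ : q + t *: - n + t *: n = _); last first.
      by rewrite scalerN subrK.
    rewrite addr0; apply: (equation_increasing L t0) => t' /andP[t'0 t't].
    have Bt : ball p r (q + t *: - n + t' *: n).
      have := inB q (t - t') Bq; rewrite s_1 scaleN1r -addrA => H.
      rewrite (_ : t *: - n + t' *: n = (t - t') *: - n); last first.
        by rewrite scalerBl !scalerN opprK.
      by apply: H; rewrite subr_ge0 t't/= lerBlDr (le_trans th)// lerDl.
    by split => //; exact: le_dir L _ Bt.
have Bp : ball p (r / 2) p by exact: ballxx.
have Gp : G p = 0 by apply/(le_zero L) => //; exact: ballxx.
pose c := p + h *: (s *: n).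
have Gc : 0 < s * G c by have := up p h Bp; rewrite h0 lexx Gp mulr0; apply.
have Bc : ball p r c by apply: inB => //; rewrite ltW// lexx.
have cG : {for c, continuous (fun x => s * G x)}.
  exact: (cvgM (cvg_cst _) (le_continuous L Bc)).
have [r1 /= r10 r1B] : exists2 r1 : R, 0 < r1 & forall x, ball c r1 x -> 0 < s * G x.
  have /cvgrPdist_lt/(_ _ Gc) := cG.
  move=> /nbhs_ballP[r1 /= r10 H]; exists r1 => // x /H/=.
  exact: gt0_of_near.
exists (Num.min (r / 2) r1); split.
- by rewrite lt_min r20.
- by rewrite ge_min ler_pdivrMr// ler_peMr ?ler1n// ltW.
move=> q1 q2 B1 B2 G1 G2.
have min1 : ball p (Num.min (r / 2) r1) `<=` ball p (r / 2).
  by apply: le_ball; rewrite ge_min lexx.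
have min2 : ball p (Num.min (r / 2) r1) `<=` ball p r1.
  by apply: le_ball; rewrite ge_min lexx orbT.
have notS q : ball p r q -> 0 < s * G q -> ~ S q.
  by move=> Bq Gq /(le_zero L Bq) E; move: Gq; rewrite E mulr0 ltxx.
have upE q t : ball p (r / 2) q -> 0 <= t <= h -> 0 < s * G q ->
    0 < s * G (q + t *: (s *: n)).
  move=> Bq /andP[t0 th] Gq; have [->|tN0] := eqVneq t 0; first by rewrite scale0r addr0.
  by apply: lt_trans Gq _; apply: up => //; rewrite lt_def tN0 t0.
have tI t : 0 <= t <= 1 -> 0 <= t * h <= h.
  move=> /andP[t0 t1]; rewrite mulr_ge0 ?(ltW h0)//=.
  by rewrite ler_piMl// ltW.
have step1 q : ball p (r / 2) q -> 0 < s * G q -> Om q -> Om (q + h *: (s *: n)).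
  move=> Bq Gq; apply: segment_propagate => t /tI t01.
  rewrite addrAC subrr add0r scalerA.
  by apply: notS; [exact: inB|exact: upE].
have step3 q : ball p (r / 2) q -> 0 < s * G q -> Om (q + h *: (s *: n)) -> Om q.
  move=> Bq Gq; apply: segment_propagate => t /andP[t0 t1].
  rewrite (_ : _ + _ = q + (h + (- t) * h) *: (s *: n)); last first.
    by apply/rowP => i; rewrite !mxE; ring.
  have t01 : 0 <= h + (- t) * h <= h.
    have := tI (1 - t); rewrite mulrBl mul1r mulNr; apply.
    by rewrite subr_ge0 t1/= lerBlDr lerDl.
  by apply: notS; [exact: inB|exact: upE].
move=> O1; apply: step3 G2 _; first exact: min1.
apply: segment_propagate (step1 _ (min1 _ B1) G1 O1) => t t01.
have Bt : ball p (Num.min (r / 2) r1) (q1 + t *: (q2 - q1)) by exact: ball_convex.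
have E : q1 + h *: (s *: n) + t *: (q2 + h *: (s *: n) - (q1 + h *: (s *: n))) =
    q1 + t *: (q2 - q1) + h *: (s *: n).
  by apply/rowP => i; rewrite !mxE; ring.
rewrite E; apply: notS; first by apply: inB; [exact: min1|rewrite ltW//= lexx].
apply: r1B; have := min2 _ Bt; rewrite !ball_rowE.
congr (`|_| < _); apply/rowP => i; rewrite !mxE; ring.
Qed.

Definition extremal_near p := exists2 r : R, 0 < r & forall q e, S q -> e != 0 ->
  ball p r q -> ball p r (q + e) -> ball p r (q - e) ->
  closure Om (q + e) -> closure Om (q - e) -> False.

Lemma side_dichotomy p G g A r : S p -> local_equation S p G g A r ->
  exists r', [/\ 0 < r', r' <= r &
    (forall q, ball p r' q -> closure Om q -> G q <= 0) \/
    (forall q, ball p r' q -> 0 < G q -> Om q)].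
Proof.
move=> Sp L; have [|r' [r'0 r'r side]] := @same_side p G g A r 1 Sp L.
  by rewrite expr1n.
exists r'; split => //.
have [[q1 [B1 G1 O1]]|no] := pselect (exists q1, [/\ ball p r' q1, 0 < G q1 & Om q1]).
  by right => q Bq Gq; apply: (side q1 q) => //; rewrite mul1r.
left => q Bq cq; rewrite leNgt; apply/negP => Gq; apply: no.
have Bq' : ball p r q by apply: le_ball Bq.
have H1 : \forall x \near q, 0 < G x.
  have /cvgrPdist_lt/(_ _ Gq) := le_continuous L Bq'.
  by apply: filterS => x; exact: gt0_of_near.
have H2 : nbhs q (ball p r') by apply: open_nbhs_nbhs; split => //; exact: ball_open.
by have [x [Ox [Gx Bx]]] := cq _ (filterI H1 H2); exists x.
Qed.

Lemma extremal_of_inner p G g A r r' : local_equation S p G g A r -> 0 < r' -> r' <= r ->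
  (forall q, ball p r' q -> closure Om q -> G q <= 0) -> extremal_near p.
Proof.
move=> L r'0 r'r inner; exists r' => // q e Sq e0 Bq B1 B2 c1 c2.
have sub : ball p r' `<=` ball p r by exact: le_ball.
have Gq : G q = 0 by apply/(le_zero L) => //; exact: sub.
have e1 : q + e != q by rewrite -subr_eq0 addBl.
have e2 : q - e != q by rewrite -subr_eq0 addBl oppr_eq0.
have := le_strict L (sub _ Bq) (sub _ B1) e1 Gq (inner _ B1 c1).
have := le_strict L (sub _ Bq) (sub _ B2) e2 Gq (inner _ B2 c2).
rewrite !addBl dotNr oppr_lt0 => h1 h2.
by have := lt_trans h1 h2; rewrite ltxx.
Qed.

Lemma midpoint_of_outer p G g A r r' q (e : R) : local_equation S p G g A r ->
  0 < r' -> r' <= r -> (forall q, ball p r' q -> 0 < G q -> Om q) ->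
  S q -> ball p r' q -> 0 < e ->
  exists w, [/\ w != 0, `|w| < e, Om (q + w) & Om (q - w)].
Proof.
move=> L r'0 r'r outer Sq Bq e0.
have sub : ball p r' `<=` ball p r by exact: le_ball.
have Bq' := sub _ Bq.
have Gq : G q = 0 by apply/(le_zero L).
have [z z0 [gz _]] := exists_orthogonal (g q) 0 hd.
have : nbhs q (ball p r') by apply: open_nbhs_nbhs; split => //; exact: ball_open.
move=> /nbhs_ballP[r1 /= r10 r1B].
have m0 : 0 < Num.min e r1 by rewrite lt_min e0.
have [t t0 tz] := small_scale z m0.
have w0 : t *: z != 0 by rewrite scaler_eq0 negb_or gt_eqF.
have nw : `|t *: z| < Num.min e r1 by rewrite normrZ gtr0_norm.
have out w : w != 0 -> `|w| < r1 -> dot (g q) w = 0 -> Om (q + w).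
  move=> wN0 hw gw; have Bw : ball p r' (q + w).
    by apply: r1B; rewrite ball_rowE opprD addrA subrr add0r normrN.
  apply: outer => //; rewrite ltNge; apply/negP => Gw.
  have : q + w != q by rewrite -subr_eq0 addBl.
  move=> /(le_strict L Bq' (sub _ Bw))/(_ Gq Gw).
  by rewrite addBl gw ltxx.
move: nw; rewrite lt_min => /andP[we wr].
exists (t *: z); split => //; apply: out; rewrite ?oppr_eq0 ?normrN//.
  by rewrite dotZr gz mulr0.
by rewrite dotNr dotZr gz mulr0 oppr0.
Qed.

Let CS : C2_hypersurface S. Proof. by case: hOm. Qed.
Let sS : strictly_convex S. Proof. by case: hOm. Qed.

Lemma closure_compact : compact (closure Om).
Proof.
apply: bounded_closed_compact; last exact: closed_closure.
case: hOm => -[_ _ _ [M [Mr bM]]] _ _ _; exists M; split => // M' /bM bM' x cx.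
apply/ler_addgt0Pr => e e0; have [y [Oy By]] := cx _ (nbhsx_ballx x e e0).
rewrite ball_rowE in By; rewrite -(subrK y x) addrC.
by rewrite (le_trans (ler_normD _ _))// lerD ?bM'// ltW.
Qed.

Lemma extremal_everywhere p : S p -> extremal_near p.
Proof.
apply: (@connected_propagate _ S extremal_near).
- by case: hOm.
- have [[_ _ [y0 Oy0] _] _ _ _] := hOm.
  have K0 : closure Om !=set0 by exists y0; exact: subset_closure.
  have [|c] := @EVT_max_rV R d (fun v => dot v v) (closure Om) K0 closure_compact.
    by apply: continuous_subspaceT; exact: dot_self_continuous.
  rewrite inE => cK cmax.
  have nomid w : w != 0 -> closure Om (c + w) -> closure Om (c - w) -> False.
    move=> w0 h1 h2; have := cmax (c + w); rewrite inE => /(_ h1).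
    have := cmax (c - w); rewrite inE => /(_ h2); rewrite !dotE.
    have : 0 < dot w w by rewrite dot_gt0.
    by rewrite (dotC w c); lra.
  have Sc : S c.
    apply/boundaryE; split => // Oc.
    have /nbhs_ballP[r /= r0 rB] : nbhs c Om by exact: open_nbhs_nbhs.
    have [z z0 _] := exists_orthogonal (0 : 'rV[R]_d) 0 hd.
    have [t t0 tz] := small_scale z r0.
    have w0 : t *: z != 0 by rewrite scaler_eq0 negb_or gt_eqF.
    apply: (nomid (t *: z)) => //; apply: subset_closure; apply: rB; rewrite ball_rowE.
      by rewrite opprD addrA subrr add0r normrN normrZ gtr0_norm.
    by rewrite opprB addrC subrK normrZ gtr0_norm.
  exists c => //; have [G [g [A [r L]]]] := local_equation_exists CS sS Sc.
  have [r' [r'0 r'r [inner|outer]]] := side_dichotomy Sc L.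
    exact: extremal_of_inner L r'0 r'r inner.
  have [|w [w0 _ h1 h2]] := midpoint_of_outer L r'0 r'r outer Sc _ ltr01.
    exact: ballxx.
  by case: (nomid w) => //; exact: subset_closure.
- move=> x Sx [r r0 H]; have r20 : 0 < r / 2 by rewrite divr_gt0.
  apply: filterS (nbhsx_ballx x (r / 2) r20) => y By Sy; exists (r / 2) => //.
  by move=> q e Sq e0 B1 B2 B3; apply: H => //; apply: ball_splitl By _ => //; exact: ball_sym.
- move=> x Sx lim; have [G [g [A [r L]]]] := local_equation_exists CS sS Sx.
  have [r' [r'0 r'r [inner|outer]]] := side_dichotomy Sx L.
    exact: extremal_of_inner L r'0 r'r inner.
  have [y [Sy By [s s0 Hs]]] := lim (ball x r') (nbhsx_ballx x r' r'0).
  have [w [w0 ws h1 h2]] := midpoint_of_outer L r'0 r'r outer Sy By s0.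
  case: (Hs y w) => //; rewrite ?ball_rowE.
  + by rewrite subrr normr0.
  + by rewrite opprD addrA subrr add0r normrN.
  + by rewrite opprB addrC subrK.
  + exact: subset_closure.
  + exact: subset_closure.
Qed.

(* For fixed [x] the set of [y] whose segment to [x] stays inside is open and closed. *)
Lemma domain_convex x y t : Om x -> Om y -> 0 <= t <= 1 -> Om (x + t *: (y - x)).
Proof.
move=> Ox Oy; move: t; pattern y; move: y Oy.
have [[_ cO _ _] _ _ _] := hOm.
apply: (@connected_propagate _ Om _ cO).
- by exists x => // t _; rewrite subrr scaler0 addr0.
- move=> y Oy Py.
  have K : compact `[(0 : R), 1]%classic by exact: segment_compact.
  have tube : nbhs y [set z | `[0, 1]%classic `<=` (fun t => Om (x + t *: (z - x)))].
    apply: ((compact_near_coveringP _).1 K _ (nbhs y) (fun z t => Om (x + t *: (z - x))) _).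
    move=> t tI; have Ot : Om (x + t *: (y - x)) by apply: Py; move: tI; rewrite /= in_itv.
    pose f := fun zt : R * 'rV[R]_d => x + zt.1 *: (zt.2 - x).
    have cf : {for (t, y), continuous f}.
      apply: cvgD; first exact: cvg_cst.
      apply: cvgZ; first exact: cvg_fst.
      by apply: cvgB; [exact: cvg_snd|exact: cvg_cst].
    exact: (cf _ (open_nbhs_nbhs (conj oOm Ot))).
  by apply: filterS tube => z Hz _ t tI; apply: Hz; rewrite /= in_itv.
- move=> y Oy lim t tI.
  have cl s : 0 <= s <= 1 -> closure Om (x + s *: (y - x)).
    move=> sI V /nbhs_ballP[e /= e0 eB].
    have [y' [Oy' By' Py']] := lim (ball y e) (nbhsx_ballx y e e0).
    exists (x + s *: (y' - x)); split; first exact: Py'.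
    by apply: eB; apply: combination_near => //; exact: ballxx.
  apply: contrapT => nO.
  have Sp : S (x + t *: (y - x)) by apply/boundaryE; split => //; exact: cl.
  have [r r0 ext] := extremal_everywhere Sp.
  have tN0 : t != 0 by apply: contra_notN nO => /eqP->; rewrite scale0r addr0.
  have tN1 : t != 1 by apply: contra_notN nO => /eqP->; rewrite scale1r addrC subrK.
  have yx : y - x != 0.
    by apply: contra_notN nO => /eqP->; rewrite scaler0 addr0.
  have /andP[t0 t1] := tI.
  have [e e0 ey] := small_scale (y - x) r0.
  pose m := Num.min e (Num.min t (1 - t)).
  have m0 : 0 < m.
    by rewrite !lt_min e0 subr_gt0 !lt_def tN0 t0 eq_sym tN1 t1.
  have [me [mt m1]] : m <= e /\ (m <= t /\ m <= 1 - t).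
    by split; [rewrite ge_min lexx|split; rewrite !ge_min lexx ?orbT].
  have nm : `|m *: (y - x)| < r.
    rewrite normrZ gtr0_norm// (le_lt_trans _ ey)// ler_wpM2r//.
  apply: (ext (x + t *: (y - x)) (m *: (y - x))) => //.
  + by rewrite scaler_eq0 negb_or gt_eqF.
  + exact: ballxx.
  + by rewrite ball_rowE opprD addrA subrr add0r normrN.
  + by rewrite ball_rowE opprB addrC subrK.
  + by rewrite -addrA -scalerDl; apply: cl; rewrite addr_ge0 ?(ltW m0)//= -lerBrDl.
  + by rewrite -addrA -scalerBl; apply: cl; rewrite subr_ge0 mt/= (le_trans _ t1)// gerBl ltW.
Qed.

Lemma closure_convex x y t : closure Om x -> closure Om y -> 0 <= t <= 1 ->
  closure Om (x + t *: (y - x)).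
Proof.
move=> cx cy tI V /nbhs_ballP[e /= e0 eB].
have [x' [Ox Bx]] := cx _ (nbhsx_ballx x e e0).
have [y' [Oy By]] := cy _ (nbhsx_ballx y e e0).
exists (x' + t *: (y' - x')); split; first exact: domain_convex.
by apply: eB; exact: combination_near.
Qed.

Lemma local_equation_shrink p G g A r r' : S p -> local_equation S p G g A r ->
  0 < r' -> r' <= r -> local_equation S p G g A r'.
Proof.
move=> Sp [h1 h2 h3 h4 h5 h6 h7 h8 h9 h10 h11] r'0 r'r.
have sub : ball p r' `<=` ball p r by exact: le_ball.
split => //.
- by move=> q /sub; exact: h2.
- by move=> X t u /sub; exact: h3.
- by move=> q q' /sub B /sub; exact: h4.
- by move=> q /sub; exact: h5.
- by move=> q /sub; exact: h6.
Qed.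

Lemma convex_chart p : S p -> exists G g A r,
  [/\ local_equation S p G g A r,
      forall q, ball p r q -> Om q <-> G q < 0 &
      forall q q', ball p r q -> S q -> closure Om q' -> q' != q ->
        dot (g q) (q' - q) < 0].
Proof.
move=> Sp; have [G [g [A [r L]]]] := local_equation_exists CS sS Sp.
exists G, g, A.
have [r1 [r10 r1r inner]] : exists r', [/\ 0 < r', r' <= r &
    forall q, ball p r' q -> closure Om q -> G q <= 0].
  have [r' [r'0 r'r [inner|outer]]] := side_dichotomy Sp L; first by exists r'.
  have [s s0 ext] := extremal_everywhere Sp.
  have [|w [w0 ws h1 h2]] := midpoint_of_outer L r'0 r'r outer Sp _ s0.
    exact: ballxx.
  case: (ext p w) => //.
  - exact: ballxx.
  - by rewrite ball_rowE opprD addrA subrr add0r normrN.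
  - by rewrite ball_rowE opprB addrC subrK.
  - exact: subset_closure.
  - exact: subset_closure.
have {L} L := local_equation_shrink Sp L r10 r1r.
have [|r2 [r20 r2r side]] := @same_side p G g A r1 (-1) Sp L.
  by rewrite sqrrN expr1n.
exists r2; have sub : ball p r2 `<=` ball p r1 by exact: le_ball.
have notS q : Om q -> ~ S q by move=> Oq /boundaryE[].
have neg q : ball p r2 q -> Om q -> G q < 0.
  move=> Bq Oq; rewrite lt_def inner//; last first.
  - exact: subset_closure.
  - exact: sub.
  rewrite andbT eq_sym; apply: contra_notN (notS _ Oq) => /eqP Gq.
  by apply/(le_zero L) => //; exact: sub.
split.
- exact: local_equation_shrink L _ _.
- move=> q Bq; split; first exact: neg.
  move=> Gq; have /boundaryE[cp _] := Sp.
  have [q1 [Oq1 B1]] := cp _ (nbhsx_ballx p r2 r20).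
  apply: (side q1 q) => //; rewrite mulN1r oppr_gt0//; exact: neg.
- move=> q q' Bq Sq cq' qq'.
  have cq : closure Om q by have /boundaryE[] := Sq.
  have : nbhs q (ball p r2) by apply: open_nbhs_nbhs; split => //; exact: ball_open.
  move=> /nbhs_ballP[e /= e0 eB].
  have [t t0 te] := small_scale (q' - q) e0.
  pose m := Num.min t 1.
  have m0 : 0 < m by rewrite lt_min t0 ltr01.
  have mI : 0 <= m <= 1 by rewrite (ltW m0) ge_min lexx orbT.
  have mt : m <= t by rewrite ge_min lexx.
  have B' : ball p r2 (q + m *: (q' - q)).
    apply: eB; rewrite ball_rowE opprD addrA subrr add0r normrN normrZ gtr0_norm//.
    by rewrite (le_lt_trans _ te)// ler_wpM2r.
  have c' : closure Om (q + m *: (q' - q)) by exact: closure_convex.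
  have := le_strict L (sub _ Bq) (sub _ B').
  rewrite -subr_eq0 addBl scaler_eq0 negb_or (gt_eqF m0) subr_eq0 qq' => /(_ isT).
  have Gq : G q = 0 by apply/(le_zero L) => //; exact: sub.
  move=> /(_ Gq (inner _ (sub _ B') c')).
  by rewrite dotZr pmulr_rlt0.
Qed.

End Body.

End Convexity.

(** * Supporting normals and the billiard map *)

Section DerivativeApprox.
Context {R : realType}.

Lemma is_derive_approx (f : R -> R) (t a e : R) : is_derive t 1 f a -> 0 < e ->
  exists2 r : R, 0 < r & forall h, `|h| < r -> `|f (t + h) - f t - a * h| <= e * `|h|.
Proof.
move=> df e0; have dft : derivable f t 1 by exact: ex_derive.
have cf : h^-1 *: (f (h *: 1 + t) - f t) @[h --> 0^'] --> a.
  by have := dft; rewrite /derivable -[a](@derive_val _ _ _ _ _ _ _ df).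
have /cvgrPdist_le/(_ _ e0)[r /= r0 H] := cf.
exists r => // h hr; have [->|h0] := eqVneq h 0.
  by rewrite addr0 subrr mulr0 subr0 normr0 mulr0.
have := H h; rewrite /ball_/= sub0r normrN => /(_ hr h0).
rewrite [h *: 1]mulr1 (addrC h t) => Hh.
have -> : f (t + h) - f t - a * h = (h^-1 *: (f (t + h) - f t) - a) * h.
  by rewrite /GRing.scale/=; field.
by rewrite normrM distrC ler_wpM2r.
Qed.

Lemma is_derive_of_approx (f : R -> R) (t a : R) :
  (forall e, 0 < e -> exists2 r : R, 0 < r &
     forall h, `|h| < r -> `|f (t + h) - f t - a * h| <= e * `|h|) ->
  is_derive t 1 f a.
Proof.
move=> H.
have cf : h^-1 *: (f (h *: 1 + t) - f t) @[h --> 0^'] --> a.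
  apply/cvgrPdist_le => e e0; have [r r0 Hr] := H e e0.
  exists r => //= h; rewrite /ball_/= sub0r normrN => hr h0.
  rewrite [h *: 1]mulr1 (addrC h t).
  rewrite -(@ler_pM2r _ `|h|) ?normr_gt0// distrC -normrM.
  rewrite (_ : _ * _ = f (t + h) - f t - a * h); first exact: Hr.
  by rewrite /GRing.scale/=; field.
apply: DeriveDef; last exact: cvg_lim cf.
by apply/cvg_ex; exists a.
Qed.

End DerivativeApprox.

Section Support.
Context {R : realType} {d : nat}.
Implicit Types (u v w p q z n x y : 'rV[R]_d) (t : R).

Definition supports (Om : set 'rV[R]_d) p n : Prop :=
  forall q, closure Om q -> q != p -> dot n (q - p) < 0.

Section Body.
Variables (Om : set 'rV[R]_d).
Hypothesis hd : (3 <= d)%N.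
Hypothesis hOm : strictly_convex_closed_boundary Om.

Let S := boundary Om.

Lemma boundary_closure q : S q -> closure Om q.
Proof. by move=> /(boundaryE hOm)[]. Qed.

Lemma boundary_notin q : S q -> ~ Om q.
Proof. by move=> /(boundaryE hOm)[]. Qed.

Lemma closure_boundary q : closure Om q -> ~ Om q -> S q.
Proof. by move=> cq nq; apply/(boundaryE hOm). Qed.

Lemma support_neq0 p n : S p -> supports Om p n -> n != 0.
Proof.
move=> Sp sn; have [[_ _ [y Oy] _] _ _ _] := hOm.
have yp : y != p by apply: contra_notN (boundary_notin Sp) => /eqP <-.
have := sn y (subset_closure Oy) yp.
by apply: contraTneq => ->; rewrite dot0l ltxx.
Qed.

Lemma support_interior p n q : S p -> supports Om p n -> Om q -> dot n (q - p) < 0.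
Proof.
move=> Sp sn Oq; apply: sn; first exact: subset_closure.
by apply: contra_notN (boundary_notin Sp) => /eqP <-.
Qed.

Lemma chart_interior p G g A r z : S p -> local_equation S p G g A r ->
  (forall q, ball p r q -> Om q <-> G q < 0) -> dot (g p) z < 0 ->
  exists2 t0 : R, 0 < t0 & forall t, 0 < t < t0 -> Om (p + t *: z).
Proof.
move=> Sp L OG gz; have Bp : ball p r p by apply: ballxx; exact: le_radius L.
have dG : is_derive (0 : R) 1 (fun t => G (p + t *: z)) (dot (g p) z).
  have := le_deriv L (X := fun t => p + t *: z) (t := 0) (u := z).
  by rewrite /= scale0r addr0 => /(_ Bp); apply; exact: is_derive_line.
have e0 : 0 < - dot (g p) z / 2 by rewrite divr_gt0// oppr_gt0.
have [r1 r10 H] := is_derive_approx dG e0.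
have [t1 t10 t1z] := small_scale z (le_radius L).
exists (Num.min r1 t1); first by rewrite lt_min r10.
move=> t /andP[t0]; rewrite lt_min => /andP[tr1 tt1].
apply/OG.
  rewrite ball_rowE opprD addrA subrr add0r normrN normrZ gtr0_norm//.
  by rewrite (le_lt_trans _ t1z)// ler_wpM2r// ltW.
have Gp : G p = 0 by apply/(le_zero L).
have := H t; rewrite gtr0_norm// => /(_ tr1).
rewrite add0r scale0r addr0 Gp subr0 ler_norml => /andP[_].
have : dot (g p) z * t < 0 by rewrite pmulr_llt0.
by lra.
Qed.

Lemma support_unique p G g A r n : S p -> local_equation S p G g A r ->
  (forall q, ball p r q -> Om q <-> G q < 0) -> supports Om p n ->
  exists2 c, 0 < c & n = c *: g p.
Proof.
move=> Sp L OG sn; have Bp : ball p r p by apply: ballxx; exact: le_radius L.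
apply: half_space_normal.
- by rewrite -dot_gt0; exact: le_dir L _ Bp.
- exact: support_neq0 sn.
- move=> z gz; have [t0 t00 H] := chart_interior Sp L OG gz.
  have t2 : 0 < t0 / 2 < t0 by rewrite divr_gt0//= ltr_pdivrMr// ltr_pMr// ltr1n.
  have := support_interior Sp sn (H _ t2).
  rewrite addBl dotZr pmulr_rlt0; first exact: ltW.
  by case/andP: t2.
Qed.

Lemma support_normal p : S p -> exists2 c, c != 0 & supports Om p (c *: normal S p).
Proof.
move=> Sp; have [G [g [A [r [L OG sup]]]]] := convex_chart hd hOm Sp.
have [c c0 nE] := le_normal L; exists c^-1; first by rewrite invr_eq0.
move=> q cq qp; rewrite nE scalerA mulVf// scale1r; apply: sup => //.
by apply: ballxx; exact: le_radius L.
Qed.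

Lemma support_proportional p n n' : S p -> supports Om p n -> supports Om p n' ->
  exists2 c, 0 < c & n' = c *: n.
Proof.
move=> Sp sn sn'; have [G [g [A [r [L OG _]]]]] := convex_chart hd hOm Sp.
have [c c0 ->] := support_unique Sp L OG sn.
have [c' c'0 ->] := support_unique Sp L OG sn'.
exists (c' / c); first by rewrite divr_gt0.
by rewrite scalerA divfK// gt_eqF.
Qed.

Lemma normal_neq0 p : S p -> normal S p != 0.
Proof.
move=> Sp; have [c c0 sc] := support_normal Sp; have := support_neq0 Sp sc.
by rewrite scaler_eq0 negb_or => /andP[].
Qed.

Lemma reflect_dir_scale (c : R) n v : c != 0 -> reflect_dir (c *: n) v = reflect_dir n v.
Proof.
move=> c0; have [->|n0] := eqVneq n 0; first by rewrite scaler0.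
have nn : dot n n != 0 by rewrite dot_eq0.
rewrite /reflect_dir !dotE scalerA; congr (_ - _ *: _).
by field; rewrite nn c0.
Qed.

Lemma oline_eq (l l' : oline R d) : carrier l = carrier l' -> dir l = dir l' -> l = l'.
Proof.
case: l l' => [c v h1 h2] [c' v' h1' h2'] /= E1 E2; subst c' v'.
by congr OLine; exact: Prop_irrelevance.
Qed.

Lemma dir_dot (l : oline R d) : dot (dir l) (dir l) = 1.
Proof. by rewrite -enorm_sqr dir_unit expr1n. Qed.

Lemma carrierP (l : oline R d) x y : carrier l x ->
  carrier l y <-> exists t, y = x + t *: dir l.
Proof.
have [p ->] := carrier_line l => -[s _ <-]; split=> [[t _ <-]|[t ->]].
  by exists (t - s); rewrite -addrA -scalerDl (addrC s) subrK.
by exists (s + t) => //; rewrite scalerDl addrA.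
Qed.

Lemma last_intersection_unique (l : oline R d) x y :
  last_intersection S l x -> last_intersection S l y -> x = y.
Proof.
move=> [Sx lx Hx] [Sy ly Hy]; have [t yE] := (carrierP y lx).1 ly.
have := Hx y Sy ly; have := Hy x Sx lx.
rewrite -opprB yE addBl !dotE dir_dot mulr1 oppr_le0 => t0 t1.
have -> : t = 0 by apply/eqP; rewrite eq_le t0 t1.
by rewrite scale0r addr0.
Qed.

Lemma billiard_last (l : oline R d) x : last_intersection S l x ->
  billiard S l = reflect_oline (normal S x) x l.
Proof.
move=> lx; rewrite /billiard; case: pselect => [h|]; last by case; exists x.
case: (cid h) => y ly /=.
by rewrite (last_intersection_unique ly lx).
Qed.

Lemma ray_exit p v : Om p -> v != 0 ->
  exists2 s : R, 0 < s & S (p + s *: v) /\ forall t, closure Om (p + t *: v) -> t <= s.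
Proof.
move=> Op v0.
pose T := [set t : R | closure Om (p + t *: v)].
have T0 : T 0 by rewrite /T/= scale0r addr0; exact: subset_closure.
have cT : closed T.
  apply: (closed_comp (f := fun t : R => p + t *: v)); last exact: closed_closure.
  by move=> t _; exact: line_continuous.
have [M M0 HM] : exists2 M : R, 0 < M & forall q, closure Om q -> `|q| <= M.
  have [M [Mr HM]] := compact_bounded (closure_compact hOm).
  exists (`|M| + 1); first by rewrite ltr_wpDl.
  by move=> q cq; apply: HM => //; rewrite ltr_pwDr// ler_norm.
have ubT : ubound T ((M + `|p|) / `|v|).
  move=> t /HM h; rewrite ler_pdivlMr ?normr_gt0//.
  rewrite (le_trans (ler_wpM2r (normr_ge0 v) (ler_norm t)))// -normrZ.
  rewrite -[t *: v](addBl p) (le_trans (ler_normB _ _))//.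
  by rewrite lerD2r.
have hsT : has_sup T by split; [exists 0|exists ((M + `|p|) / `|v|)].
pose s := sup T.
have Ts : T s by apply: cT; exact: (closure_sup hsT.1 hsT.2).
have sT t : T t -> t <= s by exact: (ub_le_sup hsT.2).
have Ss : S (p + s *: v).
  apply: closure_boundary => // Os.
  have oO : nbhs (p + s *: v) Om.
    by apply: open_nbhs_nbhs; split => //; case: hOm => -[].
  have nt : nbhs s [set t | Om (p + t *: v)] := @line_continuous _ _ p v s _ oO.
  have [e /= e0 eB] := (nbhs_ballP _ _).1 nt.
  have Oe : Om (p + (s + e / 2) *: v).
    apply: eB; rewrite /ball/= opprD addrA subrr add0r normrN gtr0_norm ?divr_gt0//.
    by rewrite ltr_pdivrMr// ltr_pMr// ltr1n.
  have := sT _ (subset_closure Oe).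
  by rewrite gerDl leNgt divr_gt0.
exists s; last by split.
rewrite lt_def (sT 0 T0) andbT.
by apply: contra_notN (boundary_notin Ss) => /eqP->; rewrite scale0r addr0.
Qed.

Lemma last_intersection_exists (l : oline R d) p : Om p -> carrier l p ->
  exists x, last_intersection S l x.
Proof.
move=> Op lp; have v0 : dir l != 0 by rewrite -dot_gt0 dir_dot ltr01.
have [s s0 [Ss sT]] := ray_exit Op v0.
exists (p + s *: dir l); split => //; first by apply/(carrierP _ lp); exists s.
move=> y Sy ly; have [t yE] := (carrierP y lp).1 ly.
rewrite yE opprD addrACA subrr add0r -scalerBl dotZl dir_dot mulr1 subr_le0.
by apply: sT; rewrite -yE; exact: boundary_closure.
Qed.

Lemma segment_interior p v (s t : R) : Om p -> closure Om (p + s *: v) -> 0 <= t < s ->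
  Om (p + t *: v).
Proof.
move=> Op cs /andP[t0 ts]; apply: contrapT => nO.
have tN0 : 0 < t.
  rewrite lt_def t0 andbT; apply: contra_notN nO => /eqP->.
  by rewrite scale0r addr0.
have s0 : 0 < s by exact: lt_trans ts.
have ct : closure Om (p + t *: v).
  rewrite (_ : p + t *: v = p + (t / s) *: (p + s *: v - p)); last first.
    by rewrite addBl scalerA divfK// gt_eqF.
  apply: (closure_convex hd hOm) => //; first exact: subset_closure.
  by rewrite divr_ge0 ?(ltW s0)//= ler_pdivrMr// mul1r ltW.
have St := closure_boundary ct nO.
have [c c0 sc] := support_normal St.
have := support_interior St sc Op.
rewrite -opprB addBl dotNr oppr_lt0 dotZr pmulr_rgt0// => nv.
have st : p + s *: v != p + t *: v.
  rewrite -subr_eq0 opprD addrACA subrr add0r -scalerBl scaler_eq0 subr_eq0 gt_eqF//=.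
  by apply: contraTneq nv => ->; rewrite dot0r ltxx.
have := sc _ cs st.
rewrite opprD addrACA subrr add0r -scalerBl dotZr ltNge pmulr_lge0// subr_ge0.
by rewrite ltW.
Qed.

Lemma billiard_fixed (l : oline R d) :
  billiard S l = l <-> (forall q, carrier l q -> ~ Om q).
Proof.
split=> [fl q lq Oq|miss].
  have [x lx] := last_intersection_exists Oq lq.
  have [Sx cx _] := lx.
  have := congr1 (@dir R d) fl; rewrite (billiard_last lx)/= /reflect_dir => /eqP.
  rewrite -subr_eq0 addBl oppr_eq0 scaler_eq0 (negbTE (normal_neq0 Sx)) orbF.
  rewrite mulf_eq0 invr_eq0 dot_eq0 (negbTE (normal_neq0 Sx)) orbF.
  rewrite mulf_eq0 pnatr_eq0/= => /eqP nv.
  have [c c0 sc] := support_normal Sx.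
  have [t qE] := (carrierP q cx).1 lq.
  have := support_interior Sx sc Oq.
  by rewrite qE addBl !dotE dotC nv !mulr0 ltxx.
have [[x lx]|no] := pselect (exists x, last_intersection S l x); last first.
  by rewrite /billiard; case: pselect.
rewrite (billiard_last lx); have [Sx cx _] := lx.
have [G [g [A [r [L OG _]]]]] := convex_chart hd hOm Sx.
have [c c0 nE] := le_normal L.
have gv0 : dot (g x) (dir l) = 0.
  apply/eqP; rewrite eq_le; apply/andP; split; rewrite leNgt; apply/negP => gv.
    have : dot (g x) (- dir l) < 0 by rewrite dotNr oppr_lt0.
    move=> /(chart_interior Sx L OG)[t0 t00 H].
    apply: (miss (x + (t0 / 2) *: - dir l)).
      by apply/(carrierP _ cx); exists (- (t0 / 2)); rewrite scalerN scaleNr.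
    by apply: H; rewrite divr_gt0//= ltr_pdivrMr// ltr_pMr// ltr1n.
  have [t0 t00 H] := chart_interior Sx L OG gv.
  apply: (miss (x + (t0 / 2) *: dir l)).
    by apply/(carrierP _ cx); exists (t0 / 2).
  by apply: H; rewrite divr_gt0//= ltr_pdivrMr// ltr_pMr// ltr1n.
have dE : reflect_dir (normal S x) (dir l) = dir l.
  by rewrite /reflect_dir nE !dotE dotC gv0 !mulr0 mul0r scale0r subr0.
apply: oline_eq => //=; rewrite dE; apply/seteqP; split=> y.
  by move=> [t _ <-]; apply/(carrierP _ cx); exists t.
by move=> /(carrierP y cx)[t ->]; exists t.
Qed.

End Body.

Lemma reflect_dirN n v : reflect_dir n (- v) = - reflect_dir n v.
Proof.
rewrite /reflect_dir !dotE; apply/rowP => i; rewrite !mxE; ring.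
Qed.

Lemma reflect_dirZ n (c : R) v : reflect_dir n (c *: v) = c *: reflect_dir n v.
Proof.
rewrite /reflect_dir !dotE; apply/rowP => i; rewrite !mxE; ring.
Qed.

Section Pair.
Variables (Oma Omb : set 'rV[R]_d).
Hypothesis hd : (3 <= d)%N.
Hypothesis ha : strictly_convex_closed_boundary Oma.
Hypothesis hb : strictly_convex_closed_boundary Omb.
Hypothesis hcomm : billiard (boundary Oma) \o billiard (boundary Omb) =
  billiard (boundary Omb) \o billiard (boundary Oma).

(* The lines fixed by the inner billiard map are those missing the inner domain, and a map
   commuting with it preserves them. *)
Lemma reflection_misses x v : boundary Omb x -> (forall t, ~ Oma (x + t *: v)) ->
  forall t, ~ Oma (x + t *: reflect_dir (normal (boundary Omb) x) v).
Proof.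
move=> Sx; have [c c0] := support_normal hd hb Sx.
set n := normal _ x.
have [nu nuE] : exists nu, nu = c *: n by exists (c *: n).
rewrite -/n -nuE => sc.
have key w : enorm w = 1 -> 0 < dot nu w -> (forall t, ~ Oma (x + t *: w)) ->
    forall t, ~ Oma (x + t *: reflect_dir n w).
  move=> w1 nw miss t Ot.
  have lx : last_intersection (boundary Omb) (oline_through x w1) x.
    split => //; first by exists 0 => //; rewrite scale0r addr0.
    move=> y Sy [s _ yE]; have [->|yx] := eqVneq y x; first by rewrite subrr dot0l.
    have := sc y (boundary_closure hb Sy) yx.
    rewrite -yE addBl dotZr dotZl /= -enorm_sqr w1 expr1n mulr1 pmulr_llt0//.
    exact: ltW.
  have fl : billiard (boundary Oma) (oline_through x w1) = oline_through x w1.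
    by apply/(billiard_fixed hd ha) => q [s _ <-]; exact: miss.
  have := congr1 (fun f => f (oline_through x w1)) hcomm; rewrite /= fl.
  move/(billiard_fixed hd ha)/(_ (x + t *: reflect_dir n w)); apply => //.
  by rewrite (billiard_last lx)/=; exists t.
move=> miss t.
have [v0|v0] := eqVneq v 0.
  rewrite v0 in miss *; rewrite /reflect_dir dot0l mulr0 mul0r scale0r subr0; exact: miss.
have e0 : 0 < enorm v by rewrite enorm_gt0.
pose w := (enorm v)^-1 *: v.
have w1 : enorm w = 1.
  by rewrite enormZ gtr0_norm ?invr_gt0// mulVf// gt_eqF.
have vE : v = enorm v *: w by rewrite scalerA divff ?scale1r// gt_eqF.
have missw s : ~ Oma (x + s *: w) by rewrite scalerA; exact: miss.
have missNw s : ~ Oma (x + s *: - w) by rewrite scalerN -scaleNr; exact: missw.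
rewrite vE reflect_dirZ scalerA; move: (t * _) => {}t.
have [nw|nw|nw] := ltgtP (dot nu w) 0.
- have nNw : 0 < dot nu (- w) by rewrite dotNr oppr_gt0.
  have Nw1 : enorm (- w) = 1 by rewrite -scaleN1r enormZ normrN1 mul1r.
  have := key _ Nw1 nNw missNw (- t).
  by rewrite reflect_dirN scalerN scaleNr opprK.
- exact: key.
- move: nw; rewrite nuE dotZl => /eqP; rewrite mulf_eq0 (negbTE c0)/= => /eqP nw.
  by rewrite /reflect_dir dotC nw mulr0 mul0r scale0r subr0; exact: missw.
Qed.

End Pair.

End Support.

(** * Reflection of tangent lines *)

Section Reflection.
Context {R : realType} {d : nat}.
Implicit Types (u v w n N : 'rV[R]_d).

Lemma reflect_dirK n v : n != 0 -> reflect_dir n (reflect_dir n v) = v.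
Proof.
move=> n0; have nn : dot n n != 0 by rewrite dot_eq0.
rewrite /reflect_dir !dotE; apply/rowP => i; rewrite !mxE; by field.
Qed.

Lemma dot_reflect n u v : n != 0 -> dot (reflect_dir n u) v = dot u (reflect_dir n v).
Proof.
move=> n0; have nn : dot n n != 0 by rewrite dot_eq0.
by rewrite /reflect_dir !dotE (dotC n v) (dotC v n); field.
Qed.

Lemma reflect_isometry u v n : n != 0 ->
  dot (reflect_dir n u) (reflect_dir n v) = dot u v.
Proof. by move=> n0; rewrite dot_reflect// reflect_dirK. Qed.

Lemma reflect_self n : n != 0 -> reflect_dir n n = - n.
Proof.
move=> n0; have nn : dot n n != 0 by rewrite dot_eq0.
rewrite /reflect_dir; apply/rowP => i; rewrite !mxE; by field.
Qed.

Lemma cauchy_schwarz_eq u v : v != 0 -> dot u u * dot v v <= dot u v ^+ 2 ->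
  u = (dot u v / dot v v) *: v.
Proof.
move=> v0 h; have vv : 0 < dot v v by rewrite dot_gt0.
have E : dot (u - (dot u v / dot v v) *: v) (u - (dot u v / dot v v) *: v) * dot v v =
    dot u u * dot v v - dot u v ^+ 2.
  by rewrite !dotE (dotC v u); field; rewrite gt_eqF.
apply/eqP; rewrite -subr_eq0 -dot_eq0 eq_le dot_ge0 andbT.
by rewrite -(pmulr_lle0 _ vv) E subr_le0.
Qed.

Lemma is_derive_div (f g : R -> R) (t a b : R) : g t != 0 -> is_derive t 1 f a ->
  is_derive t 1 g b -> is_derive t 1 (fun s => f s / g s) ((a * g t - f t * b) / g t ^+ 2).
Proof.
move=> g0 df dg.
have dgV : is_derive t 1 (fun s => (g s)^-1) (- (g t) ^- 2 *: b).
  apply: DeriveDef; first by apply: derivableV => //; exact: ex_derive.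
  by rewrite deriveV// derive_val.
rewrite (_ : _ / _ = a * (g t)^-1 + f t * (- (g t) ^- 2 *: b)).
  exact: is_derive_mul.
by rewrite /GRing.scale/=; field.
Qed.

Lemma first_order_reflection (s : R) u v w n N : n != 0 -> s != 0 ->
  dot n u = 0 -> dot N u = 0 ->
  dot (- reflect_dir n N) (u + s *: (u - (2 * (((dot u n + dot v w) * dot n n -
    dot v n * (dot w n + dot n w)) / dot n n ^+ 2) *: n + 2 * (dot v n / dot n n) *: w))) = 0 ->
  dot v n * dot N w = dot N n * dot v w.
Proof.
move=> n0 s0 nu Nu; have nn0 : dot n n != 0 by rewrite dot_eq0.
rewrite /reflect_dir !dotE Nu nu (dotC u n) nu (dotC w n) => E.
apply/eqP; rewrite -subr_eq0; apply/eqP.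
have : s * 2 / dot n n * (dot v n * dot N w - dot N n * dot v w) = 0.
  by rewrite -[RHS]E; field.
move/eqP; rewrite mulf_eq0 => /orP[|/eqP//].
by rewrite !mulf_eq0 invr_eq0 (negbTE nn0) (negbTE s0) pnatr_eq0.
Qed.

Lemma derive_at_local_min (f : R -> R) (t a : R) : is_derive t 1 f a -> f t = 0 ->
  (\forall s \near t, 0 <= f s) -> a = 0.
Proof.
move=> df ft pos; apply/eqP; apply: contraT => a0.
have e0 : 0 < `|a| / 2 by rewrite divr_gt0// normr_gt0.
have [r r0 Hr] := is_derive_approx df e0.
have [r' /= r'0 Hr'] := (nbhs_ballP _ _).1 pos.
pose m := Num.min r r' / 2.
have m0 : 0 < m by rewrite divr_gt0// lt_min r0.
have [mr mr'] : m < r /\ m < r'.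
  have : Num.min r r' <= r /\ Num.min r r' <= r' by rewrite !ge_min !lexx orbT.
  by rewrite /m; move: m0; rewrite /m; lra.
have key h : `|h| = m -> a * h = - (`|a| * m) -> False.
  move=> hm ah; have := Hr h; rewrite hm => /(_ mr).
  have : 0 <= f (t + h).
    by apply: Hr'; rewrite /ball/= opprD addrA subrr add0r normrN hm.
  rewrite ft subr0 ah ler_norml => h1 /andP[_ h2].
  have : 0 < `|a| * m by rewrite mulr_gt0// normr_gt0.
  by lra.
have [ap|an|a00] := ltgtP a 0.
- by exfalso; apply: (key m); [rewrite gtr0_norm|rewrite ltr0_norm// mulNr opprK].
- by exfalso; apply: (key (- m)); [rewrite normrN gtr0_norm|rewrite gtr0_norm// mulrN].
- by rewrite a00 eqxx in a0.
Qed.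

End Reflection.

Section Caustic.
Context {R : realType} {d : nat}.
Implicit Types (u v w p q z n x y N : 'rV[R]_d) (t : R) (X : R -> 'rV[R]_d).
Variables (Oma Omb : set 'rV[R]_d).
Hypothesis hd : (3 <= d)%N.
Hypothesis ha : strictly_convex_closed_boundary Oma.
Hypothesis hb : strictly_convex_closed_boundary Omb.
Hypothesis nested : closure Oma `<=` Omb.

Let Sa := boundary Oma.
Let Sb := boundary Omb.
Let K := closure Oma.

Hypothesis caustic : forall x v, Sb x -> (forall t, ~ Oma (x + t *: v)) ->
  forall t, ~ Oma (x + t *: reflect_dir (normal Sb x) v).

Lemma reflect_support x n v : Sb x -> supports Omb x n ->
  reflect_dir (normal Sb x) v = reflect_dir n v.
Proof.
move=> Sx sn; have [c c0 sc] := support_normal hd hb Sx.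
have [c' c'0 ->] := support_proportional hd hb Sx sc sn.
by rewrite !reflect_dir_scale// gt_eqF.
Qed.

Lemma miss_reflect x n v : Sb x -> supports Omb x n -> (forall t, ~ Oma (x + t *: v)) ->
  forall t, ~ Oma (x + t *: reflect_dir n v).
Proof. by move=> Sx sn; rewrite -(reflect_support _ Sx sn); exact: caustic. Qed.

Lemma outer_boundary_far x : Sb x -> ~ K x.
Proof. by move=> Sx /nested; exact: (boundary_notin hb Sx). Qed.

Lemma support_inner x n q : Sb x -> supports Omb x n -> K q -> dot n (q - x) < 0.
Proof. by move=> Sx sn /nested; exact: (support_interior hb Sx sn). Qed.

Lemma meet_reflect x n w : Sb x -> supports Omb x n -> Oma w ->
  exists2 s : R, 0 < s & Oma (x - s *: reflect_dir n (w - x)).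
Proof.
move=> Sx sn Ow; have n0 := support_neq0 hb Sx sn.
have [[t Ot]|no] := pselect (exists t, Oma (x + t *: reflect_dir n (w - x))); last first.
  have := @miss_reflect x n (reflect_dir n (w - x)) Sx sn _ 1.
  rewrite reflect_dirK// scale1r subrKC => H; case: H => // t Ot.
  by apply: no; exists t.
exists (- t); last by rewrite scaleNr opprK.
have h1 := support_inner Sx sn (subset_closure Ow).
have := support_inner Sx sn (subset_closure Ot).
rewrite addBl dotZr -dot_reflect// reflect_self// dotNl oppr_gt0.
by rewrite pmulr_llt0// oppr_gt0.
Qed.

Lemma axis_point x n : Sb x -> supports Omb x n -> exists2 c : R, c < 0 & Oma (x + c *: n).
Proof.
move=> Sx sn; have n0 := support_neq0 hb Sx sn.
have [[_ _ [w Ow] _] _ _ _] := ha.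
have [s s0 Os] := meet_reflect Sx sn Ow.
have nv := support_inner Sx sn (subset_closure Ow).
have nn : 0 < dot n n by rewrite dot_gt0.
have s1 : 0 < 1 + s by rewrite addr_gt0.
exists (s / (1 + s) * (2 * dot (w - x) n / dot n n)).
  by rewrite pmulr_rlt0 ?divr_gt0// pmulr_llt0 ?invr_gt0// pmulr_rlt0// dotC.
have sI : 0 <= (1 + s)^-1 <= 1.
  by rewrite invr_ge0 (ltW s1)/= invf_le1// lerDl ltW.
have := domain_convex hd ha Ow Os sI; congr (Oma _).
rewrite /reflect_dir; apply/rowP => i; rewrite !mxE.
move: (dot (w - x) n) => k; field.
by rewrite !gt_eqF.
Qed.

Lemma flag_pos x n y N : Sb x -> supports Omb x n -> Sa y -> supports Oma y N ->
  dot N (x - y) = 0 -> 0 < dot N n.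
Proof.
move=> Sx sn Sy sN Nxy; have [c c0 Oc] := axis_point Sx sn.
have := support_interior ha Sy sN Oc.
rewrite (_ : x + c *: n - y = (x - y) + c *: n); last by rewrite addrAC.
by rewrite dotDr Nxy add0r dotZr nmulr_rlt0.
Qed.

Lemma tangent_misses y N x w : Sa y -> supports Oma y N -> dot N (x - y) = 0 ->
  dot N w = 0 -> forall t, ~ Oma (x + t *: w).
Proof.
move=> Sy sN Nxy Nw t Ot; have := support_interior ha Sy sN Ot.
rewrite (_ : x + t *: w - y = (x - y) + t *: w); last by rewrite addrAC.
by rewrite dotDr Nxy dotZr Nw mulr0 addr0 ltxx.
Qed.

Lemma reflected_side x n y N q : Sb x -> supports Omb x n -> Sa y -> supports Oma y N ->
  dot N (x - y) = 0 -> Oma q -> 0 < dot (reflect_dir n N) (q - x).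
Proof.
move=> Sx sn Sy sN Nxy Oq; have n0 := support_neq0 hb Sx sn.
have nz q' : Oma q' -> dot (reflect_dir n N) (q' - x) != 0.
  move=> Oq'; apply/eqP; rewrite dot_reflect// => E.
  apply: (miss_reflect Sx sn (tangent_misses Sy sN Nxy E) (t := 1)).
  by rewrite reflect_dirK// scale1r subrKC.
have [c c0 Oc] := axis_point Sx sn.
have hc : 0 < dot (reflect_dir n N) (x + c *: n - x).
  rewrite addBl dot_reflect// reflect_dirZ reflect_self// dotZr dotNr mulrN oppr_gt0.
  by rewrite nmulr_rlt0//; exact: flag_pos Nxy.
rewrite lt_def nz//= leNgt; apply/negP => hq.
set a := dot _ (x + _ - _) in hc; set b := dot _ (q - x) in hq.
have D0 : 0 < a - b by rewrite subr_gt0 (lt_trans hq).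
have tI : 0 <= a / (a - b) <= 1.
  rewrite divr_ge0 ?(ltW hc) ?(ltW D0)//= ler_pdivrMr// mul1r lerDl oppr_ge0.
  exact: ltW.
have := nz _ (domain_convex hd ha Oc Oq tI); rewrite -/a.
rewrite (_ : _ - x = (x + c *: n - x) + (a / (a - b)) *: ((q - x) - (x + c *: n - x))).
  have lin (M P Q : 'rV[R]_d) (t : R) :
    dot M (P + t *: (Q - P)) = dot M P + t * (dot M Q - dot M P) by rewrite !dotE.
  rewrite lin -/a -/b (_ : _ + _ = 0) ?eqxx//.
  by field; rewrite gt_eqF.
by apply/rowP => i; rewrite !mxE; ring.
Qed.

Lemma reflected_contact x n y : Sb x -> supports Omb x n -> Sa y ->
  exists2 s : R, 0 < s & K (x - s *: reflect_dir n (y - x)).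
Proof.
move=> Sx sn Sy; have n0 := support_neq0 hb Sx sn.
have xy : y - x != 0.
  rewrite subr_eq0; apply: contra_notN (outer_boundary_far Sx) => /eqP <-.
  exact: (boundary_closure ha).
pose v := y - x; pose u := - reflect_dir n v.
have uu : dot u u = dot v v.
  by rewrite /u dotNl dotNr opprK dot_reflect// reflect_dirK.
have u0 : u != 0 by rewrite -dot_eq0 uu dot_eq0.
pose chi (a q : 'rV[R]_d) := dot (q - x) a ^+ 2 / dot (q - x) (q - x).
have cchi a q : q != x -> {for q, continuous (chi a)}.
  move=> qx; have cs : {for q, continuous (fun q : 'rV[R]_d => q - x)}.
    exact: (cvgB cvg_id (cvg_cst x)).
  have c1 : {for q, continuous (fun q => dot (q - x) a)}.
    have E : (fun q => dot (q - x) a) = dot a \o (fun q => q - x).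
      by apply/funext => q'; rewrite /= dotC.
    by rewrite E; exact: (continuous_comp cs (@dot_continuous _ _ a _)).
  have c2 : {for q, continuous (fun q => dot (q - x) (q - x))}.
    exact: (continuous_comp cs (@dot_self_continuous _ _ _)).
  have qx0 : dot (q - x) (q - x) != 0 by rewrite dot_eq0 subr_eq0.
  exact: (cvgM (cvgM c1 c1) (cvgV qx0 c2)).
have [[_ _ [w Ow] _] _ _ _] := ha.
have K0 : K !=set0 by exists w; exact: subset_closure.
have Kx q : K q -> q != x.
  by move=> Kq; apply: contra_notN (outer_boundary_far Sx) => /eqP <-.
have [|q] := @EVT_max_rV R d (chi u) K K0 (closure_compact ha).
  by apply: continuous_in_subspaceT => q; rewrite inE => /Kx; exact: cchi.
rewrite inE => Kq qmax.
have chiE q' : Oma q' -> chi v q' <= chi u q.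
  move=> Oq'; have [s s0 Os] := meet_reflect Sx sn Oq'.
  have := qmax _ (mem_set (subset_closure Os)); congr (_ <= _).
  have q'0 : dot (q' - x) (q' - x) != 0.
    by rewrite dot_eq0 subr_eq0; apply: Kx; exact: subset_closure.
  rewrite /chi /u addBl -/v.
  have := reflect_isometry (q' - x) (q' - x) n0; have := reflect_isometry (q' - x) v n0.
  move: (q' - x) (reflect_dir n (q' - x)) (reflect_dir n v) q'0 => a b c a0 E1 E2.
  by rewrite !(dotNl, dotNr, dotZl, dotZr) E1 E2; field; rewrite a0 gt_eqF.
have chiv : dot v v <= chi u q.
  have -> : dot v v = chi v y.
    by rewrite /chi -/v expr2 mulfK// dot_eq0.
  rewrite leNgt; apply/negP => lt.
  have yx : y != x by rewrite -subr_eq0.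
  have e0 : 0 < chi v y - chi u q by rewrite subr_gt0.
  have /cvgrPdist_lt/(_ _ e0) ny := cchi v y yx.
  have [q1 [Oq1 /=]] := boundary_closure ha Sy ny.
  rewrite ltr_norml => /andP[_ h]; have := chiE _ Oq1; lra.
have qx0 : dot (q - x) (q - x) != 0 by rewrite dot_eq0 subr_eq0; exact: Kx.
have par : dot (q - x) (q - x) * dot u u <= dot (q - x) u ^+ 2.
  rewrite uu; have qq : 0 < dot (q - x) (q - x) by rewrite lt_def qx0 dot_ge0.
  by rewrite -(ler_pdivlMl _ _ qq) mulrC; exact: chiv.
have qE := cauchy_schwarz_eq u0 par.
set s := _ / _ in qE.
have qE' : q = x - s *: reflect_dir n (y - x).
  by rewrite -(subrK x q) qE /u scalerN addrC.
exists s; last by rewrite -qE'.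
have := support_inner Sx sn Kq; rewrite qE dotZr /u dotNr.
rewrite -dot_reflect// reflect_self// dotNl opprK nmulr_llt0//.
by apply: support_inner Sx sn _; exact: (boundary_closure ha).
Qed.

Lemma reflected_flag x n y N : Sb x -> supports Omb x n -> Sa y -> supports Oma y N ->
  dot N (x - y) = 0 -> exists2 s : R, 0 < s &
    Sa (x - s *: reflect_dir n (y - x)) /\
    dot (reflect_dir n N) (- (s *: reflect_dir n (y - x))) = 0.
Proof.
move=> Sx sn Sy sN Nxy; have [s s0 Kq] := reflected_contact Sx sn Sy.
have n0 := support_neq0 hb Sx sn.
have E0 : dot (reflect_dir n N) (- (s *: reflect_dir n (y - x))) = 0.
  rewrite dotNr dotZr dot_reflect// reflect_dirK//.
  by rewrite -opprB dotNr Nxy oppr0 mulr0 oppr0.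
exists s => //; split => //; apply: (closure_boundary ha) => // Oq.
have := reflected_side Sx sn Sy sN Nxy Oq.
by rewrite addBl E0 ltxx.
Qed.

(* Reflecting the tangent lines from the points of the curve [X] to the contact point [y]
   gives lines that miss the inner domain, and at time [t] the reflected line touches it;
   the resulting first-order condition is this identity. *)
Lemma berger_identity X t u y N G g A r : Sa y -> supports Oma y N ->
  (forall s, Sb (X s) /\ dot N (X s - y) = 0) -> is_derive t 1 X u ->
  local_equation Sb (X t) G g A r ->
  (forall q q', ball (X t) r q -> Sb q -> closure Omb q' -> q' != q ->
     dot (g q) (q' - q) < 0) ->
  [/\ dot (g (X t)) u = 0, dot N u = 0 &
    dot (X t - y) (g (X t)) * dot N (u *m A) =
    dot N (g (X t)) * dot (X t - y) (u *m A)].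
Proof.
move=> Sy sN XP dX L sup.
have r0 := le_radius L; have Bx : ball (X t) r (X t) by exact: ballxx.
have Xdiff : differentiable X t by apply/derivable1_diffP; exact: ex_derive.
have cX : {for t, continuous X} by exact: differentiable_continuous.
have nearX : \forall s \near t, ball (X t) r (X s).
  by apply: cX; exact: nbhsx_ballx.
have GX0 s : ball (X t) r (X s) -> G (X s) = 0.
  by move=> Bs; exact: (le_zero L Bs).1 (XP s).1.
have nu : dot (g (X t)) u = 0.
  have dG := le_deriv L Bx dX.
  have d0 : is_derive t 1 (fun s => G (X s)) 0.
    apply: near_eq_is_derive (is_derive_cst (0 : R) t 1).
    by apply: filterS nearX => s Bs; rewrite GX0.
  by rewrite -(@derive_val _ _ _ _ _ _ _ dG) (@derive_val _ _ _ _ _ _ _ d0).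
have Nu : dot N u = 0.
  have dN : is_derive t 1 (fun s => dot N (X s - y)) (dot 0 (X t - y) + dot N (u - 0)).
    exact: is_derive_dot.
  have d0 : is_derive t 1 (fun s => dot N (X s - y)) 0.
    apply: near_eq_is_derive (is_derive_cst (0 : R) t 1).
    by apply: (@filterE _ (nbhs t)) => s; rewrite (XP s).2.
  have := @derive_val _ _ _ _ _ _ _ dN; rewrite (@derive_val _ _ _ _ _ _ _ d0).
  by rewrite dot0l add0r subr0.
split => //.
set x := X t in L sup Bx nearX GX0 nu *; set n := g x in nu *; set v := x - y.
have Sx : Sb x by exact: (XP t).1.
have sn : supports Omb x n by move=> q cq qx; exact: sup.
have Nxy : dot N v = 0 by exact: (XP t).2.
have n0 := support_neq0 hb Sx sn.
have nn0 : dot n n != 0 by rewrite dot_eq0.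
have [s s0 [Sy' E0]] := reflected_flag Sx sn Sy sN Nxy.
pose c t' := 2 * (dot (X t' - y) (g (X t')) / dot (g (X t')) (g (X t'))).
pose Y t' := X t' + s *: (X t' - y - c t' *: g (X t')).
have YE t' : Y t' = X t' + s *: reflect_dir (g (X t')) (X t' - y).
  by rewrite /Y /reflect_dir /c mulrA.
have Yt : Y t = x - s *: reflect_dir n (y - x).
  have yx : y - x = - v by rewrite opprB.
  by rewrite YE -/x -/n -/v yx reflect_dirN scalerN opprK.
have dg : is_derive t 1 (fun t' => g (X t')) (u *m A) by exact: (le_hess L erefl dX).
have dXy : is_derive t 1 (fun t' => X t' - y) u.
  by rewrite -[u]subr0; exact: is_deriveB.
pose w := u *m A.
pose c' := 2 * (((dot u n + dot v w) * dot n n - dot v n * (dot w n + dot n w))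
   / dot n n ^+ 2).
have dc : is_derive t 1 c c'.
  rewrite /c' -[X in is_derive _ _ _ X]add0r -[X in X + _](mul0r (dot v n / dot n n)).
  apply: (is_derive_mul (is_derive_cst (2 : R) t 1)).
  by apply: is_derive_div => //; exact: is_derive_dot.
have dY : is_derive t 1 Y (u + s *: (u - (c' *: n + c t *: w))).
  apply: is_deriveD; rewrite -[X in is_derive _ _ _ X]add0r -[X in X + _](scale0r (v - c t *: n)).
  apply: (is_derive_scale (is_derive_cst (s : R) t 1)).
  by apply: is_deriveB; exact: is_derive_scale.
set Y' := u + _ in dY.
have [Ga [ga [Aa [ra [La OGa _]]]]] := convex_chart hd ha Sy'.
rewrite -Yt in La OGa Sy'.
have Bya : ball (Y t) ra (Y t) by apply: ballxx; exact: le_radius La.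
have Ydiff : differentiable Y t by apply/derivable1_diffP; exact: ex_derive.
have cY : {for t, continuous Y} by exact: differentiable_continuous.
have nearY : \forall t' \near t, ball (Y t) ra (Y t').
  by apply: cY; apply: nbhsx_ballx; exact: le_radius La.
have dGa := le_deriv La Bya dY.
have GaY : \forall t' \near t, 0 <= Ga (Y t').
  apply: filterS (filterI nearX nearY) => t' [Bt' Bt''].
  rewrite leNgt; apply/negP => /OGa H; move: (H Bt''); rewrite YE.
  have [Sx' Nx'] := XP t'.
  have sn' : supports Omb (X t') (g (X t')) by move=> q cq qx; exact: sup.
  exact: (miss_reflect Sx' sn' (tangent_misses Sy sN Nx' Nx')).
have Ga0 : Ga (Y t) = 0 by apply/(le_zero La).
have gaY' : dot (ga (Y t)) Y' = 0.
  exact: derive_at_local_min dGa Ga0 GaY.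
have Nga : exists2 k, 0 < k & - reflect_dir n N = k *: ga (Y t).
  apply: half_space_normal.
  - by rewrite -dot_gt0; exact: le_dir La _ Bya.
  - rewrite oppr_eq0; apply/eqP => N'0; have [[_ _ [w0 Ow] _] _ _ _] := ha.
    have := reflected_side Sx sn Sy sN Nxy Ow.
    by rewrite N'0 dot0l ltxx.
  - move=> z gz; have [t0 t00 Ht] := chart_interior Sy' La OGa gz.
    have t2 : 0 < t0 / 2 < t0 by rewrite divr_gt0//= ltr_pdivrMr// ltr_pMr// ltr1n.
    have := reflected_side Sx sn Sy sN Nxy (Ht _ t2).
    rewrite (_ : Y t + _ - x = - (s *: reflect_dir n (y - x)) + (t0 / 2) *: z); last first.
      by rewrite Yt; move: (s *: _) (_ *: z) => b1 b2; apply/rowP => i; rewrite !mxE; ring.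
    rewrite dotDr E0 add0r dotZr pmulr_rgt0; last by case/andP: t2.
    by rewrite dotNl oppr_le0 => /ltW.
have [k k0 NE] := Nga.
have : dot (- reflect_dir n N) Y' = 0 by rewrite NE dotZl gaY' mulr0.
by move=> E; exact: first_order_reflection (lt0r_neq0 s0) nu Nu E.
Qed.

End Caustic.

(** * Plane sections of the outer hypersurface *)

Section Radial.
Context {R : realType} {d : nat}.
Implicit Types (u v w p q z n x y : 'rV[R]_d) (t : R).
Variables (Om : set 'rV[R]_d).
Hypothesis hd : (3 <= d)%N.
Hypothesis hOm : strictly_convex_closed_boundary Om.
Let S := boundary Om.

Lemma sandwich (s s0 a e h : R) : s0 + (a - e) * h <= s -> s <= s0 + (a + e) * h ->
  - (e * h) <= s - s0 - a * h <= e * h.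
Proof. by lra. Qed.

Lemma ray_unique p v (s t : R) : Om p -> 0 < s -> 0 < t -> S (p + s *: v) ->
  S (p + t *: v) -> s = t.
Proof.
move=> Op s0 t0 Ss St; apply/eqP; rewrite eq_le; apply/andP.
have key a b : 0 < a -> S (p + a *: v) -> S (p + b *: v) -> b <= a.
  move=> a0 Sa' Sb'; rewrite leNgt; apply/negP => ab.
  apply: (boundary_notin hOm Sa').
  apply: (segment_interior hd hOm Op (boundary_closure hOm Sb')).
  by rewrite (ltW a0).
by split; [exact: (key t s t0 St Ss)|exact: (key s t s0 Ss St)].
Qed.

Lemma radial_curve p v w : Om p -> (forall t, v + t *: w != 0) ->
  exists rad : R -> R, [/\ forall t, 0 < rad t, forall t, S (p + rad t *: (v + t *: w)) &
    forall t n, supports Om (p + rad t *: (v + t *: w)) n ->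
      is_derive t 1 (fun s => p + rad s *: (v + s *: w))
        ((- (rad t * dot n w) / dot n (v + t *: w)) *: (v + t *: w) + rad t *: w)].
Proof.
move=> Op vw0.
have ex t : exists s : R, [/\ 0 < s, S (p + s *: (v + t *: w)) &
    forall s', closure Om (p + s' *: (v + t *: w)) -> s' <= s].
  by have [s s0 [Ss sT]] := ray_exit hOm Op (vw0 t); exists s.
pose rad t := projT1 (cid (ex t)).
have radP t : [/\ 0 < rad t, S (p + rad t *: (v + t *: w)) &
    forall s', closure Om (p + s' *: (v + t *: w)) -> s' <= rad t].
  exact: projT2 (cid (ex t)).
have rad0 t : 0 < rad t by case: (radP t).
have radS t : S (p + rad t *: (v + t *: w)) by case: (radP t).
have rad_ge t s : closure Om (p + s *: (v + t *: w)) -> s <= rad t.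
  by case: (radP t) => _ _; apply.
have rad_le t s : 0 < s -> ~ closure Om (p + s *: (v + t *: w)) -> rad t <= s.
  move=> s0 nc; rewrite leNgt; apply/negP => sr; apply: nc; apply: subset_closure.
  apply: (segment_interior hd hOm Op (boundary_closure hOm (radS t))).
  by rewrite (ltW s0).
exists rad; split => // t n sn.
set x := p + _ in sn; set th := v + t *: w.
have [G [g [A [r [L OG _]]]]] := convex_chart hd hOm (radS t).
have r0 := le_radius L; have Bx : ball x r x by exact: ballxx.
have [c c0 nE] := support_unique hOm (radS t) L OG sn.
have kn : 0 < dot n th.
  have := support_interior hOm (radS t) sn Op.
  by rewrite -opprB dotNr oppr_lt0 /x addBl dotZr pmulr_rgt0.
have k0 : 0 < dot (g x) th by move: kn; rewrite nE dotZl pmulr_rgt0.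
pose a := - (rad t * dot n w) / dot n th.
have aE : a * dot (g x) th = - (rad t * dot (g x) w).
  by rewrite /a nE !dotZl -/x; field; rewrite !gt_eqF.
have drad : is_derive t 1 rad a.
  apply: is_derive_of_approx => e e0.
  pose Z b h := p + (rad t + b * h) *: (th + h *: w).
  have ZE b h : Z b h = p + (rad t + b * h) *: (v + (t + h) *: w).
    by rewrite /Z /th (scalerDl w) addrA.
  have Z0 b : Z b 0 = x by rewrite /Z mulr0 addr0 scale0r addr0.
  have dZ b : is_derive (0 : R) 1 (Z b) (b *: th + rad t *: w).
    have d1 : is_derive (0 : R) 1 (fun h => rad t + b * h) b.
      have := is_derive_mul (is_derive_cst (b : R) (0 : R) (1 : R)) (is_derive_id (0 : R) (1 : R)).
      rewrite mul0r add0r mulr1 => db.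
      by rewrite -[b in X in is_derive _ _ _ X]add0r; exact: is_deriveD.
    have d2 := is_derive_line th w 0.
    have := is_derive_scale d1 d2; rewrite scale0r addr0 mulr0 addr0 => d3.
    by rewrite -[X in is_derive _ _ _ X]add0r; exact: is_deriveD.
  have key b : b != 0 -> exists2 m : R, 0 < m & forall h, h != 0 -> `|h| < m ->
      ball x r (Z (a + b) h) /\ 0 < (b * h) * G (Z (a + b) h).
    move=> b0.
    have Bx0 : ball x r (Z (a + b) 0) by rewrite Z0.
    have := le_deriv L Bx0 (dZ (a + b)).
    rewrite Z0 dotDr !dotZr mulrDl aE addrAC addNr add0r => dG.
    have e'0 : 0 < `|b| * dot (g x) th / 2.
      by rewrite divr_gt0// mulr_gt0// normr_gt0.
    have [m1 m10 H1] := is_derive_approx dG e'0.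
    have cZ : {for (0 : R), continuous (Z (a + b))}.
      apply: differentiable_continuous; apply/derivable1_diffP.
      by have := dZ (a + b) => ?; exact: ex_derive.
    have nB : \forall h \near (0 : R), ball x r (Z (a + b) h).
      by apply: cZ; rewrite Z0; exact: nbhsx_ballx.
    have [m2 /= m20 H2] := (nbhs_ballP _ _).1 nB.
    exists (Num.min m1 m2); first by rewrite lt_min m10.
    move=> h h0; rewrite lt_min => /andP[hm1 hm2]; split.
      by apply: H2; rewrite /ball/= sub0r normrN.
    have := H1 _ hm1; rewrite add0r Z0.
    have -> : G x = 0 by apply/(le_zero L Bx); exact: radS.
    rewrite subr0 => H.
    have bh0 : 0 < `|b * h| by rewrite normr_gt0 mulf_neq0.
    have : `|(b * h) * G (Z (a + b) h) - `|b * h| ^+ 2 * dot (g x) th| <=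
        `|b * h| ^+ 2 * dot (g x) th / 2.
      rewrite real_normK ?num_real//.
      have -> : b * h * G (Z (a + b) h) - (b * h) ^+ 2 * dot (g x) th =
         (b * h) * (G (Z (a + b) h) - b * dot (g x) th * h) by ring.
      rewrite normrM (le_trans (ler_wpM2l (ltW bh0) H))// -(@real_normK _ (b * h)) ?num_real//.
      by rewrite [X in _ <= X ^+ 2 * _ / _]normrM normrM; lra.
    have : 0 < `|b * h| ^+ 2 * dot (g x) th by rewrite mulr_gt0// exprn_gt0.
    by rewrite ler_norml; lra.
  have [m1 m10 H1] := key e (lt0r_neq0 e0).
  have [|m2 m20 H2] := key (- e); first by rewrite oppr_eq0 lt0r_neq0.
  pose D := `|a| + e.
  have D0 : 0 < D by rewrite ltr_wpDl.
  pose m := Num.min (Num.min m1 m2) (rad t / D).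
  have m0 : 0 < m by rewrite !lt_min m10 m20 divr_gt0.
  exists m => // h; rewrite !lt_min ltr_pdivlMr// => /andP[/andP[hm1 hm2] hD].
  have [->|h0] := eqVneq h 0; first by rewrite addr0 subrr mulr0 subr0 normr0 mulr0.
  have [B1 G1] := H1 h h0 hm1; have [B2 G2] := H2 h h0 hm2.
  have pos b : `|b| <= e -> 0 < rad t + (a + b) * h.
    move=> be; have : `|(a + b) * h| < rad t.
      rewrite normrM mulrC (le_lt_trans _ hD)// ler_wpM2l//.
      by rewrite (le_trans (ler_normD _ _))// lerD2l.
    by rewrite ltr_norml; lra.
  have P1 : 0 < rad t + (a + e) * h by apply: pos; rewrite gtr0_norm.
  have P2 : 0 < rad t + (a - e) * h by apply: pos; rewrite normrN gtr0_norm.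
  have inside b : ball x r (Z b h) -> G (Z b h) < 0 -> rad t + b * h <= rad (t + h).
    move=> Bz Gz; apply: rad_ge; rewrite -ZE; apply: subset_closure.
    by apply/OG.
  have outside b : ball x r (Z b h) -> 0 < G (Z b h) -> 0 < rad t + b * h ->
      rad (t + h) <= rad t + b * h.
    move=> Bz Gz bp; apply: rad_le => //; rewrite -ZE => cz.
    have [Oz|nOz] := pselect (Om (Z b h)).
      by move/(OG _ Bz): Oz; rewrite ltNge ltW.
    by move: (closure_boundary hOm cz nOz) => /(le_zero L Bz) E; rewrite E ltxx in Gz.
  have [hn|hp|/eqP] := ltgtP h 0; last by rewrite (negbTE h0).
  - have Gz1 : G (Z (a + e) h) < 0.
      by move: G1; rewrite nmulr_rgt0// nmulr_llt0.
    have Gz2 : 0 < G (Z (a - e) h).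
      by move: G2; rewrite pmulr_rgt0// mulNr oppr_gt0 pmulr_rlt0.
    rewrite (ltr0_norm hn) mulrN -mulNr ler_norml.
    by apply: sandwich; rewrite ?opprK; [exact: inside|exact: outside].
  - have Gz1 : 0 < G (Z (a + e) h).
      by move: G1; rewrite pmulr_rgt0// mulr_gt0.
    have Gz2 : G (Z (a - e) h) < 0.
      by move: G2; rewrite nmulr_rgt0// mulNr oppr_lt0 mulr_gt0.
    rewrite (gtr0_norm hp) ler_norml.
    by apply: sandwich; [exact: inside|exact: outside].
rewrite -[X in is_derive _ _ _ X]add0r; apply: is_deriveD.
exact: is_derive_scale drad (is_derive_line v w t).
Qed.

End Radial.

Section Kappa.
Context {R : realType} {d : nat}.
Implicit Types (u v w p q z n x y N : 'rV[R]_d) (t : R) (X : R -> 'rV[R]_d).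
Variables (Oma Omb : set 'rV[R]_d).
Hypothesis hd : (3 <= d)%N.
Hypothesis ha : strictly_convex_closed_boundary Oma.
Hypothesis hb : strictly_convex_closed_boundary Omb.
Hypothesis nested : closure Oma `<=` Omb.

Let Sa := boundary Oma.
Let Sb := boundary Omb.

Hypothesis caustic : forall x v, Sb x -> (forall t, ~ Oma (x + t *: v)) ->
  forall t, ~ Oma (x + t *: reflect_dir (normal Sb x) v).

(* The point [y + kappa N y x *: N] is where the normal line of the inner hypersurface at [y]
   meets the tangent hyperplane of the outer one at [x]. *)
Definition kappa N y x : R := dot (normal Sb x) (x - y) / dot (normal Sb x) N.

Lemma kappaE N y x n : Sb x -> supports Omb x n -> kappa N y x = dot n (x - y) / dot n N.
Proof.
move=> Sx sn; have [c c0 sc] := support_normal hd hb Sx.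
have [c' c'0 ->] := support_proportional hd hb Sx sc sn.
have c'c : c' * c != 0 by rewrite mulf_neq0// gt_eqF.
by rewrite /kappa scalerA !dotZl -mulf_div divff// mul1r.
Qed.

Lemma kappa_radial N y v w : Sa y -> supports Oma y N -> dot N v = 0 -> dot N w = 0 ->
  (forall t, v + t *: w != 0) -> Sb (y + v) -> Sb (y + (v + w)) ->
  kappa N y (y + v) = kappa N y (y + (v + w)).
Proof.
move=> Sy sN Nv Nw vw0 S0 S1.
have Oy : Omb y by apply: nested; exact: (boundary_closure ha).
have [rad [rad0 radS radD]] := radial_curve hd hb Oy vw0.
pose X t := y + rad t *: (v + t *: w).
have NX t : dot N (X t - y) = 0 by rewrite /X addBl dotZr dotDr dotZr Nv Nw mulr0 addr0 mulr0.
have X0 : X 0 = y + v.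
  have := ray_unique (v := v) hd hb Oy (rad0 0) ltr01.
  move: (radS 0); rewrite /X scale0r addr0 scale1r => h /(_ h S0) ->.
  by rewrite scale1r.
have X1 : X 1 = y + (v + w).
  have := ray_unique (v := v + w) hd hb Oy (rad0 1) ltr01.
  move: (radS 1); rewrite /X !scale1r => h /(_ h S1) ->.
  by rewrite scale1r.
rewrite -X0 -X1; apply: (is_derive_0_is_cst (f := fun t => kappa N y (X t))) => t.
have [G [g [A [r [L OG sup]]]]] := convex_chart hd hb (radS t).
have Bx : ball (X t) r (X t) by apply: ballxx; exact: le_radius L.
have sn : supports Omb (X t) (g (X t)).
  by move=> q cq qx; exact: (sup _ _ Bx (radS t) cq qx).
have dX := radD t _ sn; set u := _ + _ in dX.
have [nu Nu E] := berger_identity hd ha hb nested caustic Sy sN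
  (fun s => conj (radS s) (NX s)) dX L sup.
have Nn : 0 < dot N (g (X t)) := flag_pos hd ha hb nested caustic (radS t) sn Sy sN (NX t).
have cX : {for t, continuous X}.
  by apply: differentiable_continuous; apply/derivable1_diffP; exact: ex_derive.
have nearX : \forall s \near t, ball (X t) r (X s).
  by apply: cX; apply: nbhsx_ballx; exact: le_radius L.
have dg : is_derive t 1 (fun s => g (X s)) (u *m A) := le_hess L erefl dX.
have dXy : is_derive t 1 (fun s => X s - y) u.
  by rewrite -[u]subr0; exact: is_deriveB.
have d1 := is_derive_dot dg dXy.
have d2 := is_derive_dot dg (is_derive_cst N t 1).
have Nn0 : dot (g (X t)) N != 0 by rewrite dotC gt_eqF.
have := is_derive_div Nn0 d1 d2.
rewrite (_ : (_ - _) / _ = 0); last first.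
  move: E; rewrite nu dot0r !addr0 (dotC (u *m A)) (dotC (u *m A)) (dotC _ (X t - y)).
  rewrite (dotC _ N) => E.
  by rewrite [X in X / _](_ : _ = 0) ?mul0r//; move: E; rewrite mulrC => ->; rewrite mulrC subrr.
apply: near_eq_is_derive; apply: filterS nearX => s Bs.
have sns : supports Omb (X s) (g (X s)).
  by move=> q cq qx; exact: (sup _ _ Bs (radS s) cq qx).
by rewrite (kappaE _ _ (radS s) sns).
Qed.

Lemma kappa_const N y x x' : Sa y -> supports Oma y N -> Sb x -> Sb x' ->
  dot N (x - y) = 0 -> dot N (x' - y) = 0 -> kappa N y x = kappa N y x'.
Proof.
move=> Sy sN Sx Sx' Nx Nx'.
have Oy : Omb y by apply: nested; exact: (boundary_closure ha).
have far z : Sb z -> z - y != 0.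
  by move=> Sz; rewrite subr_eq0; apply: contra_notN (boundary_notin hb Sz) => /eqP->.
have E z : z = y + (z - y) by rewrite subrKC.
have step z z' : Sb z -> Sb z' -> dot N (z - y) = 0 -> dot N (z' - y) = 0 ->
    (forall t, (z - y) + t *: (z' - z) != 0) -> kappa N y z = kappa N y z'.
  move=> Sz Sz' Nz Nz' ne.
  have zz : z - y + (z' - z) = z' - y by rewrite addrC subrKA.
  have Nzz : dot N (z' - z) = 0.
    have -> : z' - z = (z' - y) - (z - y) by apply/rowP => i; rewrite !mxE; ring.
    by rewrite dotDr dotNr Nz Nz' subr0.
  by have := kappa_radial Sy sN Nz Nzz ne; rewrite zz !subrKC; apply.
have [ne|/existsNP[t0 /negP]] := pselect (forall t, (x - y) + t *: (x' - x) != 0).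
  exact: step.
rewrite negbK => /eqP dep.
have [w w0 [Nw xw]] := exists_orthogonal N (x - y) hd.
have [s s0 [Ss _]] := ray_exit hb Oy w0.
have lin (P Q v : 'rV[R]_d) (t : R) :
  dot (P + t *: (Q - P)) v = dot P v + t * (dot Q v - dot P v) by rewrite !dotE.
have x'w : dot (x' - y) w = 0.
  have t0N0 : t0 != 0.
    by apply: contraTneq (far _ Sx) => t00; rewrite t00 scale0r addr0 in dep; rewrite dep eqxx.
  have : dot ((x - y) + t0 *: (x' - x)) w = 0 by rewrite dep dot0l.
  have -> : x' - x = (x' - y) - (x - y) by apply/rowP => i; rewrite !mxE; ring.
  rewrite lin xw add0r subr0 => /eqP.
  by rewrite mulf_eq0 (negbTE t0N0) => /eqP.
have ort z : Sb z -> dot (z - y) w = 0 -> dot N (z - y) = 0 ->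
    kappa N y z = kappa N y (y + s *: w).
  move=> Sz zw Nz; apply: step => //.
    by rewrite addBl dotZr Nw mulr0.
  move=> t; apply/eqP => E0.
  have zE : y + s *: w - z = s *: w - (z - y) by apply/rowP => i; rewrite !mxE; ring.
  have := congr1 (fun v => dot v (z - y)) E0; have := congr1 (fun v => dot v w) E0.
  rewrite zE !lin !dotZl zw (dotC w (z - y)) zw dot0l add0r subr0 !mulr0 add0r => /eqP.
  rewrite !mulf_eq0 (gt_eqF s0) dot_eq0 (negbTE w0) !orbF => /eqP ->.
  by rewrite mul0r addr0 dot0l => /eqP; rewrite dot_eq0 (negbTE (far _ Sz)).
exact: etrans (ort x Sx xw Nx) (esym (ort x' Sx' x'w Nx')).
Qed.

End Kappa.

(** * Contact points seen from a fixed point *)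

Lemma dot_mx (R : realType) d (u v : 'rV[R]_d) : dot u v = (u *m v^T) 0 0.
Proof. by rewrite [RHS]mxE; apply: eq_bigr => i _; rewrite [v^T _ _]mxE. Qed.

Lemma dot_mulmxC (R : realType) d (A : 'M[R]_d) (u v : 'rV[R]_d) : A^T = A ->
  dot (u *m A) v = dot (v *m A) u.
Proof. by move=> AT; rewrite dotC !dot_mx trmx_mul AT mulmxA. Qed.

Lemma dot_sub_continuous (R : realType) d (u x : 'rV[R]_d) :
  continuous (fun q : 'rV[R]_d => dot u (q - x)).
Proof.
move=> q; have cs : {for q, continuous (fun q : 'rV[R]_d => q - x)}.
  exact: (cvgB cvg_id (cvg_cst x)).
exact: (continuous_comp cs (@dot_continuous _ _ u _)).
Qed.

Lemma dot_rsub_continuous (R : realType) d (u x : 'rV[R]_d) :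
  continuous (fun q : 'rV[R]_d => dot u (x - q)).
Proof.
rewrite (_ : (fun _ => _) = (fun q : 'rV[R]_d => dot (- u) (q - x))).
  exact: dot_sub_continuous.
by apply/funext => z; rewrite -opprB dotNr dotNl.
Qed.

Lemma compact_contact (R : realType) d (C : set 'rV[R]_d) (x m w : 'rV[R]_d) :
  C !=set0 -> compact C -> (forall q, C q -> dot m (q - x) < 0) ->
  exists tau y, [/\ C y, dot (tau *: m + w) (y - x) = 0 &
    forall q, C q -> dot (tau *: m + w) (q - x) <= 0].
Proof.
move=> C0 cC sep.
pose phi q := dot w (q - x) / dot m (x - q).
have mq q : C q -> 0 < dot m (x - q).
  by move=> /sep; rewrite -opprB dotNr oppr_lt0.
have [|y] := @EVT_max_rV R d phi C C0 cC.
  apply: continuous_in_subspaceT => q; rewrite inE => Kq.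
  have c1 : {for q, continuous (fun q : 'rV[R]_d => dot w (q - x))} := @dot_sub_continuous _ _ w x q.
  have c2 : {for q, continuous (fun q : 'rV[R]_d => dot m (x - q))} := @dot_rsub_continuous _ _ m x q.
  exact: (cvgM c1 (cvgV (lt0r_neq0 (mq _ Kq)) c2)).
rewrite inE => Ky ymax; exists (phi y), y; split => //.
  rewrite dotDl dotZl /phi -(opprB x y) !dotNr.
  by field; rewrite gt_eqF// mq.
move=> q Kq; have := ymax q (mem_set Kq); rewrite {1}/phi ler_pdivrMr ?mq// => h.
by rewrite dotDl dotZl -(opprB x q) dotNr; move: h; rewrite -(opprB x q) dotNr; lra.
Qed.

Section Symmetry.
Context {R : realType} {d : nat}.
Implicit Types (u v w p q z n m e x y N : 'rV[R]_d) (t : R).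
Variables (Oma Omb : set 'rV[R]_d).
Hypothesis hd : (3 <= d)%N.
Hypothesis ha : strictly_convex_closed_boundary Oma.
Hypothesis hb : strictly_convex_closed_boundary Omb.
Hypothesis nested : closure Oma `<=` Omb.

Let Sa := boundary Oma.
Let Sb := boundary Omb.
Let K := closure Oma.

Hypothesis caustic : forall x v, Sb x -> (forall t, ~ Oma (x + t *: v)) ->
  forall t, ~ Oma (x + t *: reflect_dir (normal Sb x) v).

Definition flag N y x := [/\ Sa y, supports Oma y N & dot N (x - y) = 0].

Lemma contact_support N y : K y -> N != 0 -> (forall q, K q -> dot N (q - y) <= 0) ->
  Sa y /\ supports Oma y N.
Proof.
move=> Ky N0 max.
have notO z : K z -> (forall q, K q -> dot N (q - z) <= 0) -> Sa z.
  move=> Kz zmax; apply: (closure_boundary ha Kz) => Oz.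
  have [[oO _ _ _] _ _ _] := ha.
  have [e /= e0 eB] := (nbhs_ballP _ _).1 (open_nbhs_nbhs (conj oO Oz)).
  have [t t0 tN] := small_scale N e0.
  have := zmax (z + t *: N); rewrite addBl dotZr leNgt mulr_gt0 ?dot_gt0// => H.
  suff : false by []; apply: H; apply: subset_closure; apply: eB.
  by rewrite ball_rowE opprD addrA subrr add0r normrN normrZ gtr0_norm.
have Sy : Sa y by exact: notO.
split => // q Kq qy; rewrite lt_def max// andbT eq_sym; apply/eqP => Nq.
have hI : 0 <= (2^-1 : R) <= 1 by rewrite invr_ge0 ler0n/= invf_le1// ler1n.
pose z := y + 2^-1 *: (q - y).
have Kz : K z by exact: (closure_convex hd ha).
have Sz : Sa z.
  apply: notO => // q' Kq'.
  have -> : q' - z = (q' - y) - 2^-1 *: (q - y) by rewrite /z opprD addrA.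
  by rewrite dotDr dotNr dotZr Nq mulr0 subr0 max.
have [c c0 sc] := support_normal hd ha Sz.
have yz : y - z = - (2^-1 *: (q - y)) by rewrite /z opprD addrA subrr add0r.
have qz : q - z = 2^-1 *: (q - y).
  by rewrite /z; apply/rowP => i; rewrite !mxE; field.
have ne : 2^-1 *: (q - y) != 0.
  by rewrite scaler_eq0 invr_eq0 pnatr_eq0/= subr_eq0.
have := sc q Kq; rewrite -subr_eq0 qz ne => /(_ isT) h1.
have := sc y Ky; rewrite -subr_eq0 yz oppr_eq0 ne => /(_ isT).
by rewrite dotNr oppr_lt0 ltNge ltW.
Qed.

Lemma contact_exists x m w : (forall q, K q -> dot m (q - x) < 0) ->
  exists tau y, [/\ K y, dot (tau *: m + w) (y - x) = 0 &
    forall q, K q -> dot (tau *: m + w) (q - x) <= 0].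
Proof.
move=> sep; have [[_ _ [y0 Oy0] _] _ _ _] := ha.
have K0 : K !=set0 by exists y0; exact: subset_closure.
exact: (compact_contact w K0 (closure_compact ha) sep).
Qed.

Lemma contact_flag x N y : N != 0 -> K y -> dot N (y - x) = 0 ->
  (forall q, K q -> dot N (q - x) <= 0) -> flag N y x.
Proof.
move=> N0 Ky Nyx max; have [|Sy sN] := contact_support Ky N0.
  move=> q Kq; have -> : q - y = (q - x) - (y - x) by apply/rowP => i; rewrite !mxE; ring.
  by rewrite dotDr dotNr Nyx subr0 max.
by split => //; rewrite -opprB dotNr Nyx oppr0.
Qed.

Lemma flag_le N y x q : flag N y x -> K q -> dot N (q - x) <= 0.
Proof.
move=> [Sy sN Nxy] Kq; have [->|qy] := eqVneq q y.
  by rewrite -opprB dotNr Nxy oppr0.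
have := sN q Kq qy; have -> : q - y = (q - x) + (x - y) by rewrite subrKA.
by rewrite dotDr Nxy addr0 => /ltW.
Qed.

Lemma flag_neq0 N y x : flag N y x -> N != 0.
Proof. by move=> [Sy sN _]; exact: (support_neq0 ha Sy sN). Qed.

Lemma flag_unique N y y' x : flag N y x -> flag N y' x -> y = y'.
Proof.
move=> [Sy sN Nxy] [Sy' sN' Nxy']; apply/eqP; apply: contraT => yy'.
have := sN' y (boundary_closure ha Sy) yy'.
have -> : y - y' = (x - y') - (x - y) by apply/rowP => i; rewrite !mxE; ring.
by rewrite dotDr dotNr Nxy Nxy' subr0 ltxx.
Qed.

Section FixedPoint.
Variables (x : 'rV[R]_d) (G : 'rV[R]_d -> R) (g : 'rV[R]_d -> 'rV[R]_d) (A : 'M[R]_d) (r : R).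
Hypothesis Sx : Sb x.
Hypothesis L : local_equation Sb x G g A r.
Hypothesis sup : forall q q', ball x r q -> Sb q -> closure Omb q' -> q' != q ->
  dot (g q) (q' - q) < 0.

Let n := g x.

Let sn : supports Omb x n.
Proof. by move=> q cq qx; apply: sup => //; apply: ballxx; exact: le_radius L. Qed.

Let nK q : K q -> dot n (q - x) < 0.
Proof. by move=> Kq; apply: (support_inner hb nested Sx sn). Qed.

Let nKp q : K q -> 0 < dot n (x - q).
Proof. by move=> /nK; rewrite -opprB dotNr oppr_lt0. Qed.

Lemma hess_relation N y u : flag N y x -> dot n u = 0 -> dot N u = 0 ->
  dot (x - y) n * dot N (u *m A) = dot N n * dot (x - y) (u *m A).
Proof.
move=> [Sy sN Nxy] nu Nu.
have Ky := boundary_closure ha Sy; have Oy : Omb y by exact: nested.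
have vw0 t : (x - y) + t *: u != 0.
  apply/eqP => E; have := congr1 (dot n) E; rewrite dotDr dotZr nu mulr0 addr0 dot0r => h.
  by have := nKp Ky; rewrite h ltxx.
have [rad [rad0 radS radD]] := radial_curve hd hb Oy vw0.
have E0 : y + rad 0 *: ((x - y) + 0 *: u) = x.
  have := ray_unique (v := x - y) hd hb Oy (rad0 0) ltr01.
  move: (radS 0); rewrite scale0r addr0 scale1r subrKC => h /(_ h Sx) ->.
  by rewrite scale1r subrKC.
have := radD 0 n; rewrite E0 => /(_ sn) dX.
have XP s : Sb (y + rad s *: ((x - y) + s *: u)) /\
    dot N (y + rad s *: ((x - y) + s *: u) - y) = 0.
  by split; [exact: radS|]; rewrite addBl dotZr dotDr dotZr Nxy Nu mulr0 addr0 mulr0.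
have r1 : rad 0 = 1.
  apply: (ray_unique (v := x - y) hd hb Oy (rad0 0) ltr01).
    by have := radS 0; rewrite scale0r addr0.
  by rewrite scale1r subrKC.
move: dX; rewrite nu mulr0 oppr0 mul0r scale0r add0r r1 scale1r => dX.
have := berger_identity hd ha hb nested caustic Sy sN XP dX.
by rewrite E0 => /(_ _ _ _ _ L sup)[_ _].
Qed.

Definition conormal N y := N - (dot N n / dot n (x - y)) *: (x - y).

Lemma conormal_tangent N y : flag N y x -> dot n (conormal N y) = 0.
Proof.
move=> [Sy _ _]; have := nKp (boundary_closure ha Sy) => h.
by rewrite /conormal dotDr dotNr dotZr (dotC n N) divfK ?subrr// gt_eqF.
Qed.

Lemma dot_conormal N y N' : flag N y x ->
  dot N' (conormal N y) = dot N' N - (dot N n / dot n (x - y)) * dot N' (x - y).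
Proof. by move=> _; rewrite /conormal dotDr dotNr dotZr. Qed.

Lemma dot_conormal_self N y : flag N y x -> dot N (conormal N y) = dot N N.
Proof. by move=> F; rewrite dot_conormal//; case: F => _ _ ->; rewrite mulr0 subr0. Qed.

Definition curvature_ratio N y := dot (conormal N y *m A) (conormal N y) / dot N N.

Lemma conormal_hess N y w : flag N y x -> dot n w = 0 ->
  dot (conormal N y *m A) w = curvature_ratio N y * dot N w.
Proof.
move=> F nw; set z := conormal N y.
have nz : dot n z = 0 by exact: conormal_tangent.
have Nz : dot N z = dot N N by exact: dot_conormal_self.
have NN : dot N N != 0 by rewrite dot_eq0; exact: flag_neq0 F.
have nv : dot n (x - y) != 0.
  by case: F => Sy _ _; rewrite gt_eqF//; exact: nKp (boundary_closure ha Sy).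
pose u := w - (dot N w / dot N N) *: z.
have nu : dot n u = 0 by rewrite /u dotDr dotNr dotZr nw nz mulr0 subr0.
have Nu : dot N u = 0 by rewrite /u dotDr dotNr dotZr Nz divfK ?subrr.
have Az : dot (z *m A) u = 0.
  rewrite (dot_mulmxC _ _ (le_sym L)) dotC /z /conormal dotDl dotNl dotZl.
  have := hess_relation F nu Nu; rewrite (dotC (x - y) n).
  move: (dot n (x - y)) (dot N n) (dot N _) (dot (x - y) _) nv => a b c c' a0 E.
  by apply: (mulfI a0); rewrite mulr0 mulrBr E; field.
move: Az; rewrite /u dotDr dotNr dotZr => /eqP; rewrite subr_eq0 => /eqP ->.
by rewrite /curvature_ratio -/z; field.
Qed.

Lemma curvature_ratio_gt0 N y : flag N y x -> 0 < curvature_ratio N y.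
Proof.
move=> F; have N0 := flag_neq0 F.
rewrite divr_gt0 ?dot_gt0//; apply: (le_pos L); first exact: (conormal_tangent F).
apply: contraTneq (N0) => z0; have := dot_conormal_self F.
by rewrite z0 dot0r => /esym/eqP; rewrite dot_eq0 => ->.
Qed.

Lemma curvature_ratio_swap N y N' y' : flag N y x -> flag N' y' x ->
  curvature_ratio N y * dot N (conormal N' y') = curvature_ratio N' y' * dot N' (conormal N y).
Proof.
move=> F F'; rewrite -!conormal_hess//; last first.
- exact: conormal_tangent.
- exact: conormal_tangent.
exact: dot_mulmxC (le_sym L).
Qed.

End FixedPoint.

End Symmetry.

Lemma ratio_bound (R : realType) (rt rs D P Q cs ct S NN C : R) :
  (rt - rs) * D = rs * (cs * P - ct * Q) -> 0 <= P -> 0 <= Q -> P + Q <= S ->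
  0 < cs <= C -> 0 < ct <= C -> 0 < NN -> NN / 2 <= D -> 0 < rs ->
  `|rt - rs| <= rs * C * S * 2 / NN.
Proof.
move=> E P0 Q0 PQ /andP[cs0 csC] /andP[ct0 ctC] NN0 DN rs0.
have D0 : 0 < D by apply: lt_le_trans DN; rewrite divr_gt0.
have csP : 0 <= cs * P <= C * P by rewrite mulr_ge0 ?(ltW cs0)//= ler_wpM2r.
have ctQ : 0 <= ct * Q <= C * Q by rewrite mulr_ge0 ?(ltW ct0)//= ler_wpM2r.
have CS : C * P + C * Q <= C * S by rewrite -mulrDr ler_wpM2l// (le_trans (ltW cs0)).
have b : `|cs * P - ct * Q| <= C * S.
  by rewrite ler_norml; move: csP ctQ CS; clear; lra.
have E' : `|rt - rs| * D <= rs * (C * S).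
  by rewrite -{1}(gtr0_norm D0) -normrM E normrM (gtr0_norm rs0) ler_wpM2l// ltW.
rewrite ler_pdivlMr//.
have : `|rt - rs| * (NN / 2) <= rs * (C * S).
  by apply: le_trans E'; rewrite ler_wpM2l.
by clear; lra.
Qed.

Section ContactPath.
Context {R : realType} {d : nat}.
Implicit Types (u v w p q z n m e x N : 'rV[R]_d) (t : R).
Variables (Oma Omb : set 'rV[R]_d).
Hypothesis hd : (3 <= d)%N.
Hypothesis ha : strictly_convex_closed_boundary Oma.
Hypothesis hb : strictly_convex_closed_boundary Omb.
Hypothesis nested : closure Oma `<=` Omb.

Let Sb := boundary Omb.
Let K := closure Oma.

Hypothesis caustic : forall x v, Sb x -> (forall t, ~ Oma (x + t *: v)) ->
  forall t, ~ Oma (x + t *: reflect_dir (normal Sb x) v).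

Variables (x : 'rV[R]_d) (G : 'rV[R]_d -> R) (g : 'rV[R]_d -> 'rV[R]_d) (A : 'M[R]_d) (r : R).
Hypothesis Sx : Sb x.
Hypothesis L : local_equation Sb x G g A r.
Hypothesis sup : forall q q', ball x r q -> Sb q -> closure Omb q' -> q' != q ->
  dot (g q) (q' - q) < 0.

Let n := g x.

Let sn : supports Omb x n.
Proof. by move=> q cq qx; apply: sup => //; apply: ballxx; exact: le_radius L. Qed.

Let nK q : K q -> dot n (q - x) < 0.
Proof. by move=> Kq; apply: (support_inner hb nested Sx sn). Qed.

Let nKp q : K q -> 0 < dot n (x - q).
Proof. by move=> /nK; rewrite -opprB dotNr oppr_lt0. Qed.

Lemma slope_bound e : exists2 M, 0 < M &
  forall q, K q -> `|dot e (x - q) / dot n (x - q)| <= M.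
Proof.
have [t1 [_ [_ _ h1]]] := contact_exists ha e nK.
have [t2 [_ [_ _ h2]]] := contact_exists ha (- e) nK.
exists (1 + `|t1| + `|t2|) => [|q Kq]; first by rewrite -addrA ltr_pwDl// addr_ge0.
have nq := nKp Kq; rewrite normrM normfV (gtr0_norm nq) ler_pdivrMr//.
have := h1 q Kq; have := h2 q Kq; rewrite -(opprB x q) !dotNr !dotDl !dotZl dotNl.
move: (dot e _) (dot n _) nq => a b b0 H2 H1.
have B1 : t1 * b <= `|t1| * b by rewrite ler_wpM2r ?ler_norm// ltW.
have B2 : t2 * b <= `|t2| * b by rewrite ler_wpM2r ?ler_norm// ltW.
have B3 : 0 <= `|t1| * b by rewrite mulr_ge0// ltW.
have B4 : 0 <= `|t2| * b by rewrite mulr_ge0// ltW.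
by rewrite ler_norml; move: H1 H2 B1 B2 B3 B4 b0; rewrite !mulrDl; lra.
Qed.

Variables (w e : 'rV[R]_d) (tau : R -> R) (y : R -> 'rV[R]_d).
Hypothesis nw : dot n w = 0.
Hypothesis ne : dot n e = 0.
Let N t := tau t *: n + (w + t *: e).
Hypothesis F : forall t, flag Oma (N t) (y t) x.

Let E t := dot e (x - y t) / dot n (x - y t).

Let Ky t : K (y t). Proof. by have [Sy _ _] := F t; exact: (boundary_closure ha Sy). Qed.
Let ny t : 0 < dot n (x - y t). Proof. exact: (nKp (@Ky t)). Qed.

Let dotN t u : dot (N t) u = tau t * dot n u + (dot w u + t * dot e u).
Proof. by rewrite /N !dotDl !dotZl. Qed.

Let N0 t : tau t * dot n (x - y t) + (dot w (x - y t) + t * dot e (x - y t)) = 0.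
Proof. by rewrite -dotN; case: (F t). Qed.

Let Nge s t : 0 <= dot (N t) (x - y s).
Proof. by rewrite -opprB dotNr oppr_ge0; exact: (flag_le (F t) (@Ky s)). Qed.

Let gap s t : dot (N t) (x - y s) / dot n (x - y s) = tau t - tau s + (t - s) * E s.
Proof.
have := N0 s; rewrite dotN /E; move: (ny s) => /lt0r_neq0.
move: (dot n _) (dot w _) (dot e _) => a b c a0 H.
have -> : b = - (tau s * a + s * c) by move: H; lra.
by field.
Qed.

Let gap_ge0 s t : 0 <= tau t - tau s + (t - s) * E s.
Proof. by rewrite -gap divr_ge0// ?Nge// ltW. Qed.

Lemma contact_slope_cont s eta : 0 < eta -> exists2 del, 0 < del &
  forall t, `|t - s| < del -> `|E t - E s| <= eta.
Proof.
move=> eta0; have [M M0 HM] := slope_bound e.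
pose C := K `&` [set q | eta * dot n (x - q) <= `|dot e (x - q) - E s * dot n (x - q)|].
have [C0|nC] := pselect (C !=set0); last first.
  exists 1 => // t _; rewrite leNgt; apply/negP => h; apply: nC; exists (y t); split => //=.
  have nyt := ny t.
  have -> : dot e (x - y t) - E s * dot n (x - y t) = (E t - E s) * dot n (x - y t).
    by rewrite mulrBl /E divfK// gt_eqF.
  by rewrite normrM (gtr0_norm nyt) ler_wpM2r// ltW.
have dc (u : 'rV[R]_d) := @dot_rsub_continuous R d u x.
have cC : compact C.
  apply: compact_closedI; first exact: closure_compact ha.
  pose f q := `|dot e (x - q) - E s * dot n (x - q)| - eta * dot n (x - q).
  rewrite (_ : [set _ | _] = f @^-1` [set t | 0 <= t]); last first.
    by apply/seteqP; split => q /=; rewrite /f subr_ge0.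
  apply: preimage_closed; last exact: closed_ge.
  move=> q _.
  have c1 : {for q, continuous (fun q => dot e (x - q) - E s * dot n (x - q))}.
    exact: (cvgB (dc e q) (cvgM (cvg_cst (E s)) (dc n q))).
  exact: (cvgB (cvg_norm c1) (cvgM (cvg_cst eta) (dc n q))).
have [tt [y1 [[Ky1 Cy1] y10 ttC]]] := compact_contact (N s) C0 cC (fun q Cq => nK Cq.1).
have tt0 : 0 < - tt.
  have n1 := nKp Ky1; have Ns := flag_le (F s) Ky1.
  move: y10; rewrite dotDl dotZl => y10.
  have ttN : - tt * dot n (x - y1) = - dot (N s) (y1 - x).
    by move: y10; rewrite -(opprB y1 x) !dotNr; lra.
  rewrite -(pmulr_lgt0 _ n1) ttN oppr_gt0 lt_neqAle Ns andbT; apply/eqP => Ns0.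
  have F1 := contact_flag hd ha (flag_neq0 ha (F s)) Ky1 Ns0 (fun q => @flag_le _ _ _ _ _ _ q (F s)).
  have yy := flag_unique ha F1 (F s).
  move: Cy1; rewrite /= yy /E divfK; last by rewrite gt_eqF.
  by rewrite subrr normr0 leNgt mulr_gt0.
exists (- tt / (2 * M)) => [|t ht]; first by rewrite divr_gt0 ?mulr_gt0.
rewrite leNgt; apply/negP => h.
have Ct : C (y t).
  split => //=; have nyt := ny t.
  have -> : dot e (x - y t) - E s * dot n (x - y t) = (E t - E s) * dot n (x - y t).
    by rewrite mulrBl /E divfK// gt_eqF.
  by rewrite normrM (gtr0_norm nyt) ler_wpM2r// ltW.
have lo : - tt <= dot (N s) (x - y t) / dot n (x - y t).
  rewrite ler_pdivlMr//; have := ttC _ Ct; rewrite dotDl dotZl -(opprB x (y t)) !dotNr; lra.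
have := gap_ge0 s t; rewrite gap in lo => h2.
have h3 : - tt <= (t - s) * (E s - E t) by move: lo h2; lra.
have h4 : (t - s) * (E s - E t) <= `|t - s| * (2 * M).
  apply: le_trans (ler_norm _) _; rewrite normrM ler_wpM2l//.
  apply: le_trans (ler_normB _ _) _.
  by have := HM _ (@Ky s); have := HM _ (@Ky t); rewrite -/(E s) -/(E t); lra.
by move: ht; rewrite ltr_pdivlMr ?mulr_gt0//; move: h3 h4; lra.
Qed.

Let rho t := curvature_ratio x g A (N t) (y t).

(* By symmetry of the Hessian the increment of the ratio over [t - s] is controlled by
   [(t - s) * (E s - E t)], and the contact slope [E] is continuous. *)
Lemma ratio_derive0 s : is_derive s (1 : R) rho 0.
Proof.
apply: is_derive_of_approx => eps eps0.
have [M M0 HM] := slope_bound e.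
have rs0 : 0 < rho s := curvature_ratio_gt0 ha hb nested Sx L sup (F s).
have cpos t : 0 < dot (N t) n.
  by have [Sy sN Nxy] := F t; exact: (flag_pos hd ha hb nested caustic Sx sn Sy sN Nxy).
have cE t : dot (N t) n = tau t * dot n n.
  by rewrite dotN (dotC w) (dotC e) nw ne mulr0 !addr0.
have nn0 : 0 < dot n n by rewrite dot_gt0; exact: (support_neq0 hb Sx sn).
pose NN := dot (N s) (N s).
have NN0 : 0 < NN by rewrite dot_gt0; exact: (flag_neq0 ha (F s)).
pose zs := conormal x g (N s) (y s).
pose C := dot (N s) n + M * dot n n.
have C0 : 0 < C by rewrite addr_gt0// mulr_gt0.
pose eta := eps * NN / (rho s * C * 2).
have eta0 : 0 < eta := divr_gt0 (mulr_gt0 eps0 NN0) (mulr_gt0 (mulr_gt0 rs0 C0) (ltr0Sn R 1)).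
have [del del0 Hdel] := contact_slope_cont s eta0.
pose a := dot e zs.
pose b := NN / (2 * (`|a| + 1)).
have a1 : 0 < `|a| + 1 by apply: ltr_wpDl; rewrite ?normr_ge0 ?ltr01.
have b0 : 0 < b by apply: divr_gt0 => //; apply: mulr_gt0.
exists (Num.min 1 (Num.min del b)); first by rewrite !lt_min ltr01 del0.
move=> h; rewrite !lt_min => /and3P[h1 hdel hb'].
rewrite mul0r subr0; set t := s + h.
have ts : t - s = h by rewrite /t addrC addKr.
have HE : `|E t - E s| <= eta by apply: Hdel; rewrite ts.
pose P := dot (N t) (x - y s) / dot n (x - y s).
pose Q := dot (N s) (x - y t) / dot n (x - y t).
have nz : dot n zs = 0 by exact: (conormal_tangent ha hb nested Sx L sup (F s)).
have swap : (rho t - rho s) * dot (N t) zs = rho s * (dot (N s) n * P - dot (N t) n * Q).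
  have := curvature_ratio_swap hd ha hb nested caustic Sx L sup (F t) (F s).
  rewrite /zs !(dot_conormal _ _ (F _)) -/n -/(rho t) -/(rho s) (dotC (N s) (N t)) /P /Q.
  by rewrite mulrBl => ->; ring.
have := @ratio_bound R _ _ _ P Q _ _ (eta * `|h|) NN C swap.
have PQ : P + Q <= eta * `|h|.
  have -> : P + Q = h * (E s - E t) by rewrite /P /Q !gap -ts; ring.
  apply: le_trans (ler_norm _) _; rewrite normrM mulrC ler_wpM2r// distrC//.
have tauM : tau t - tau s <= M.
  have g1 := gap_ge0 t s; have hE : `|E t| <= M by exact: HM _ (@Ky t).
  have hE' : - (h * E t) <= M.
    apply: le_trans (ler_norm _) _; rewrite normrN normrM -(mul1r M) ler_pM//; exact: ltW.
  have e1 : (s - t) * E t = - (h * E t) by rewrite /t; ring.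
  by move: g1 hE'; rewrite e1; lra.
have DN : NN / 2 <= dot (N t) zs.
  have -> : dot (N t) zs = NN + h * a.
    rewrite /NN -(dot_conormal_self g (F s)) -/zs !dotN nz -ts /a; ring.
  have : `|h * a| <= NN / 2.
    rewrite normrM; move: hb'; rewrite /b -/NN ltr_pdivlMr ?mulr_gt0// => hb'.
    by have := normr_ge0 h; lra.
  by rewrite ler_norml; lra.
have P0 : 0 <= P by rewrite divr_ge0// ?Nge// ltW.
have Q0 : 0 <= Q by rewrite divr_ge0// ?Nge// ltW.
have cs : 0 < dot (N s) n <= C by rewrite cpos/= lerDl mulr_ge0// ltW.
have ct : 0 < dot (N t) n <= C.
  rewrite cpos/= /C !cE -mulrDl; apply: ler_wpM2r; first exact: ltW.
  by move: tauM; lra.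
move=> /(_ P0 Q0 PQ cs ct NN0 DN rs0) H; apply: (le_trans H).
rewrite le_eqVlt; apply/orP; left; apply/eqP; rewrite /eta.
by field; rewrite !gt_eqF.
Qed.

End ContactPath.

Section ContactSymmetry.
Context {R : realType} {d : nat}.
Implicit Types (u v w p q z n m e x y N : 'rV[R]_d) (t : R).
Variables (Oma Omb : set 'rV[R]_d).
Hypothesis hd : (3 <= d)%N.
Hypothesis ha : strictly_convex_closed_boundary Oma.
Hypothesis hb : strictly_convex_closed_boundary Omb.
Hypothesis nested : closure Oma `<=` Omb.

Let Sb := boundary Omb.
Let K := closure Oma.

Hypothesis caustic : forall x v, Sb x -> (forall t, ~ Oma (x + t *: v)) ->
  forall t, ~ Oma (x + t *: reflect_dir (normal Sb x) v).

Lemma separated_flag x m w : (forall q, K q -> dot m (q - x) < 0) -> dot m w = 0 -> w != 0 ->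
  exists tau y, flag Oma (tau *: m + w) y x.
Proof.
move=> sep mw w0; have [tau [y [Ky E le]]] := contact_exists ha w sep.
exists tau, y; apply: (contact_flag hd ha) => //.
by apply: contra_neq w0 => /(congr1 (dot w))/eqP; rewrite dotDr dotZr dotC mw mulr0 add0r dot0r dot_eq0 => /eqP.
Qed.

Lemma flag_tau_unique x m w tau tau' y y' : (forall q, K q -> dot m (q - x) < 0) ->
  flag Oma (tau *: m + w) y x -> flag Oma (tau' *: m + w) y' x -> tau = tau'.
Proof.
move=> sep; wlog: tau tau' y y' / tau < tau' => [W F F'|lt F F'].
  case: (ltgtP tau tau') => // h; [exact: (W _ _ _ _ h F F')|exact/esym/(W _ _ _ _ h F' F)].
have Ky : K y' by have [Sy _ _] := F'; exact: (boundary_closure ha Sy).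
have := flag_le F Ky; have [_ _] := F'; have := sep y' Ky.
rewrite -(opprB y' x) !dotDl !dotZl !dotNr; move: (dot m _) (dot w _) => a b a0 E E'.
have : 0 < (tau - tau') * a by rewrite nmulr_lgt0// subr_lt0.
by move: E E'; rewrite !mulrN mulrBl; lra.
Qed.

Section FixedPoint.
Variables (x : 'rV[R]_d) (G : 'rV[R]_d -> R) (g : 'rV[R]_d -> 'rV[R]_d) (A : 'M[R]_d) (r : R).
Hypothesis Sx : Sb x.
Hypothesis L : local_equation Sb x G g A r.
Hypothesis sup : forall q q', ball x r q -> Sb q -> closure Omb q' -> q' != q ->
  dot (g q) (q' - q) < 0.

Let n := g x.

Let sn : supports Omb x n.
Proof. by move=> q cq qx; apply: sup => //; apply: ballxx; exact: le_radius L. Qed.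

Let nK q : K q -> dot n (q - x) < 0.
Proof. by move=> Kq; apply: (support_inner hb nested Sx sn). Qed.

Lemma ratio_segment w w' tau y tau' y' : dot n w = 0 -> dot n w' = 0 ->
  (forall t, w + t *: (w' - w) != 0) ->
  flag Oma (tau *: n + w) y x -> flag Oma (tau' *: n + w') y' x ->
  curvature_ratio x g A (tau *: n + w) y = curvature_ratio x g A (tau' *: n + w') y'.
Proof.
move=> nw nw' nz F F'.
have ne : dot n (w' - w) = 0 by rewrite dotDr dotNr nw nw' subr0.
have /choice[f Ff] : forall t, exists p : R * 'rV[R]_d,
    flag Oma (p.1 *: n + (w + t *: (w' - w))) p.2 x.
  move=> t; have [|s [q Fq]] := separated_flag nK _ (nz t).
    by rewrite dotDr dotZr nw ne mulr0 addr0.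
  by exists (s, q).
have E w1 t s q q' : w + t *: (w' - w) = w1 -> flag Oma (s *: n + w1) q x ->
    flag Oma ((f t).1 *: n + w1) q' x -> (f t).1 = s /\ q' = q.
  move=> _ F1 F2; have e := flag_tau_unique nK F2 F1; split => //.
  by rewrite e in F2; exact: (flag_unique ha F2 F1).
have c := is_derive_0_is_cst 0 1 (ratio_derive0 hd ha hb nested caustic Sx L sup nw ne Ff).
have w0 : w + 0 *: (w' - w) = w by rewrite scale0r addr0.
have w1 : w + 1 *: (w' - w) = w' by rewrite scale1r subrKC.
have := Ff 0; have := Ff 1; rewrite w0 w1 => F1 F0.
have [t0 y0] := E _ _ _ _ _ w0 F F0; have [t1 y1] := E _ _ _ _ _ w1 F' F1.
by move: c; rewrite /= w0 w1 t0 t1 y0 y1.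
Qed.

Lemma ratio_const N y N' y' : flag Oma N y x -> flag Oma N' y' x ->
  curvature_ratio x g A N y = curvature_ratio x g A N' y'.
Proof.
have nn : dot n n != 0 by rewrite dot_eq0; exact: (support_neq0 hb Sx sn).
have dec M z : flag Oma M z x -> exists s w, [/\ M = s *: n + w, dot n w = 0 & w != 0].
  move=> F; exists (dot n M / dot n n), (M - (dot n M / dot n n) *: n); split.
  - by rewrite subrKC.
  - by rewrite dotDr dotNr dotZr divfK ?subrr.
  - rewrite subr_eq0; apply/eqP => E; have [Sz sM Mxz] := F.
    have Kz := boundary_closure ha Sz; have := nK Kz.
    have := flag_neq0 ha F.
    rewrite E scaler_eq0 negb_or => /andP[s0 _].
    by move: Mxz; rewrite E dotZl -opprB dotNr => /eqP; rewrite mulf_eq0 (negbTE s0) oppr_eq0 => /eqP ->; rewrite ltxx.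
move=> F F'; have [s [w [EN nw w0]]] := dec _ _ F; have [s' [w' [EN' nw' w'0]]] := dec _ _ F'.
subst N N'.
have path u v : u != 0 -> (forall c, v != c *: u) -> forall t, u + t *: (v - u) != 0.
  move=> u0 h t; have [->|t0] := eqVneq t 0; first by rewrite scale0r addr0.
  apply: contraTneq (h (- (1 - t) / t)) => E; rewrite negbK; apply/eqP.
  have : t *: v = - (1 - t) *: u.
    apply/eqP; rewrite -subr_eq0 -E; apply/eqP/rowP => i; rewrite !mxE; ring.
  by move/(congr1 (fun z => t^-1 *: z)); rewrite !scalerA mulVf// scale1r mulrC.
have [[c Ec]|ind] := pselect (exists c, w' = c *: w); last first.
  apply: ratio_segment => //; apply: path => // c; apply/eqP => E; apply: ind; by exists c.
have [w2 w20 [nw2 ww2]] := exists_orthogonal n w hd.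
have [s2 [y2 F2]] := separated_flag nK nw2 w20.
have perp u v : u != 0 -> v != 0 -> dot u v = 0 -> forall c, v != c *: u.
  move=> u0 v0 uv c'; apply: contraTneq v0 => E; rewrite negbK.
  move: uv; rewrite E dotZr => /eqP; rewrite mulf_eq0 dot_eq0 (negbTE u0) orbF => /eqP ->.
  by rewrite scale0r.
rewrite (ratio_segment nw nw2 (path _ _ w0 (perp _ _ w0 w20 ww2)) F F2).
apply: ratio_segment => //; apply: path => //; apply: perp => //.
by rewrite Ec dotZr dotC ww2 mulr0.
Qed.

End FixedPoint.

Lemma contact_symmetry x N y N' y' : Sb x -> flag Oma N y x -> flag Oma N' y' x ->
  (kappa Omb N y x)^-1 * dot N' (x - y) = (kappa Omb N' y' x)^-1 * dot N (x - y').
Proof.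
move=> Sx F F'; have [G [g [A [r [L _ sup]]]]] := convex_chart hd hb Sx.
have sn : supports Omb x (g x).
  by move=> q cq qx; apply: sup => //; apply: ballxx; exact: le_radius L.
have := curvature_ratio_swap hd ha hb nested caustic Sx L sup F F'.
rewrite (ratio_const Sx L sup F' F) => /(mulfI _).
rewrite gt_eqF ?(curvature_ratio_gt0 ha hb nested Sx L sup F)// => /(_ isT).
rewrite (dot_conormal _ _ F) (dot_conormal _ _ F') (dotC N' N) => /(addrI _)/oppr_inj E.
by rewrite !(kappaE hd hb _ _ Sx sn) !invf_div !(dotC (g x)) in E *; rewrite -E.
Qed.

End ContactSymmetry.

(** * The quadratic form of a point of the outer hypersurface *)

Section SymmetricForm.
Context {R : realType} {d : nat}.
Implicit Types (u v w N z : 'rV[R]_d).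

Lemma spanning_basis (Z : set 'rV[R]_d) : (forall w, (forall N, Z N -> dot w N = 0) -> w = 0) ->
  exists P : 'M[R]_d, P \in unitmx /\ forall i, Z (row i P).
Proof.
move=> span.
suff H k : (k <= d)%N -> exists P : 'M[R]_(k, d), row_free P /\ forall i, Z (row i P).
  by have [P [fP ZP]] := H d (leqnn d); exists P; rewrite -row_free_unit.
elim: k => [_|k IH kd].
  by exists 0; split; [rewrite /row_free mxrank0|case].
have [P [fP ZP]] := IH (ltnW kd).
have : kermx P^T != 0.
  by rewrite kermx_eq0 /row_free mxrank_tr (eqP fP) neq_ltn kd.
move=> /rowV0Pn[v /sub_kermxP vP v0].
have [N ZN vN] : exists2 N, Z N & dot v N != 0.
  apply: contrapT => h; move/eqP: v0; apply; apply: span => N ZN.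
  by apply: contrapT => /eqP vN; apply: h; exists N.
suff [fM ZM] : row_free (col_mx N P) /\ forall i, Z (row i (col_mx N P)).
  by exists (col_mx N P).
split; last first.
  move=> i; case: (split_ordP i) => j ->; first by rewrite rowKu row_id.
  by rewrite rowKd.
apply: inj_row_free => u; rewrite -[u]hsubmxK mul_row_col => E.
have a0 : lsubmx u = 0.
  have := congr1 (fun w => (w *m v^T) 0 0) E; rewrite mulmxDl -!mulmxA.
  have -> : P *m v^T = 0 by rewrite -[LHS]trmxK trmx_mul trmxK vP trmx0.
  rewrite mulmx0 addr0 mul0mx [in RHS]mxE mxE big_ord1 -dot_mx dotC => /eqP.
  by rewrite mulf_eq0 (negbTE vN) orbF => /eqP a0; apply/rowP => i; rewrite (ord1 i) a0 mxE.
move: E; rewrite a0 mul0mx add0r => /eqP; rewrite mulmx_free_eq0// => /eqP ->.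
exact: row_mx0.
Qed.

Lemma symmetric_form (T : 'rV[R]_d -> 'rV[R]_d -> Prop) :
  (forall w, (forall N z, T N z -> dot w N = 0) -> w = 0) ->
  (forall N z N' z', T N z -> T N' z' -> dot z N' = dot z' N) ->
  exists B : 'M[R]_d, B^T = B /\ forall N z, T N z -> N *m B = z.
Proof.
move=> span sym.
have [|P [uP ZP]] := @spanning_basis [set N | exists z, T N z].
  by move=> w h; apply: span => N z TN; apply: h; exists z.
have [f Tf] := choice ZP.
pose W := \matrix_i f i; pose B := invmx P *m W.
have PB : P *m B = W by rewrite mulKVmx.
have PBr i : row i P *m B = f i by rewrite -row_mul PB rowK.
clearbody B.
have WP : (W *m P^T)^T = W *m P^T.
  have e i j : (W *m P^T) i j = dot (f i) (row j P).
    by rewrite mxE; apply: eq_bigr => l _; rewrite !mxE.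
  by apply/matrixP => i j; rewrite mxE !e; apply: sym.
have uPT : P^T \in unitmx by rewrite unitmx_tr.
have BT : B^T = B.
  apply: (can_inj (mulKmx uP)); apply: (can_inj (mulmxK uPT)).
  by rewrite PB -WP trmx_mul trmxK -PB trmx_mul mulmxA.
exists B; split => // N z TN.
apply: (can_inj (mulmxK uPT)); apply/rowP => j.
have e w : (w *m P^T) 0 j = dot w (row j P) by rewrite mxE; apply: eq_bigr => l _; rewrite !mxE.
by rewrite !e (dot_mulmxC _ _ BT) PBr dotC (sym _ _ _ _ TN (Tf j)) dotC.
Qed.

End SymmetricForm.

Section FlagForm.
Context {R : realType} {d : nat}.
Implicit Types (u v w p q z n m e x y N : 'rV[R]_d) (t : R).
Variables (Oma Omb : set 'rV[R]_d).
Hypothesis hd : (3 <= d)%N.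
Hypothesis ha : strictly_convex_closed_boundary Oma.
Hypothesis hb : strictly_convex_closed_boundary Omb.
Hypothesis nested : closure Oma `<=` Omb.

Let Sb := boundary Omb.
Let K := closure Oma.

Hypothesis caustic : forall x v, Sb x -> (forall t, ~ Oma (x + t *: v)) ->
  forall t, ~ Oma (x + t *: reflect_dir (normal Sb x) v).

Lemma flag_interior N y x q : flag Oma N y x -> Oma q -> dot N (q - x) < 0.
Proof.
move=> [Sy sN Nxy] Oq; have := support_interior ha Sy sN Oq.
have -> : q - y = (q - x) + (x - y) by rewrite subrKA.
by rewrite dotDr Nxy addr0.
Qed.

Lemma flags_span x m e w : (forall q, K q -> dot m (q - x) < 0) -> dot m e = 0 -> dot w e = 0 ->
  (forall N y, flag Oma N y x -> dot N e = 0 -> dot w N = 0) -> w = 0.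
Proof.
move=> sep me we H; apply: contrapT => /eqP w0.
have [[_ _ [q Oq] _] _ _ _] := ha.
have [u u0 [mu eu]] := exists_orthogonal m e hd.
have [t1 [y1 F1]] := separated_flag hd ha sep mu u0.
have [t2 [y2 F2]] : exists tau y, flag Oma (tau *: m - u) y x.
  by apply: (separated_flag hd ha sep); rewrite ?dotNr ?mu ?oppr0// oppr_eq0.
have E1 := H _ _ F1; have E2 := H _ _ F2.
have := flag_interior F1 Oq; have := flag_interior F2 Oq.
move: E1 E2; rewrite !dotDl !dotDr !dotNl !dotNr !dotZl !dotZr me (dotC u e) eu !mulr0 oppr0 !addr0.
move=> /(_ erefl) E1 /(_ erefl) E2 i1 i2.
have mw : dot m w = 0.
  have : (t1 + t2) * dot w m = 0 by move: E1 E2; lra.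
  move=> /eqP; rewrite mulf_eq0 dotC => /orP[/eqP t12|/eqP//].
  have t2E : t2 = - t1 by move: t12; lra.
  by move: i1 i2; rewrite t2E; lra.
have [t3 [y3 F3]] := separated_flag hd ha sep mw w0.
have := H _ _ F3; rewrite dotDl dotZl me mulr0 we addr0 dotDr dotZr (dotC w m) mw mulr0 add0r.
by move=> /(_ erefl)/eqP; rewrite dot_eq0 (negbTE w0).
Qed.

Lemma kappa_gt0 x N y : Sb x -> flag Oma N y x -> 0 < kappa Omb N y x.
Proof.
move=> Sx [Sy sN Nxy]; have [c c0 sn] := support_normal hd hb Sx.
rewrite (kappaE hd hb _ _ Sx sn) divr_gt0//.
  rewrite -opprB dotNr oppr_gt0; apply: (support_inner hb nested Sx sn).
  exact: (boundary_closure ha Sy).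
by rewrite dotC; exact: (flag_pos hd ha hb nested caustic Sx sn Sy sN Nxy).
Qed.

Definition flag_form x (B : 'M[R]_d) := B^T = B /\
  forall N y, flag Oma N y x -> N *m B = (kappa Omb N y x)^-1 *: (y - x).

Lemma flag_form_exists x : Sb x -> exists B, flag_form x B.
Proof.
move=> Sx; have [c c0 sn] := support_normal hd hb Sx.
have sep q : K q -> dot (c *: normal Sb x) (q - x) < 0.
  by move=> Kq; apply: (support_inner hb nested Sx sn).
have [||B [BT BE]] := @symmetric_form R d
    (fun N z => exists2 y, flag Oma N y x & z = (kappa Omb N y x)^-1 *: (y - x)).
- move=> w H; apply: (@flags_span x _ 0 _ sep); rewrite ?dot0r// => N y F _.
  by apply: H; exists y.
- move=> N z N' z' [y F ->] [y' F' ->].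
  have := contact_symmetry hd ha hb nested caustic Sx F F'.
  by rewrite -(opprB y) -(opprB y') !dotNr !mulrN !dotZl (dotC (y - x)) (dotC (y' - x)) => /oppr_inj.
by exists B; split => // N y F; apply: BE; exists y.
Qed.

Lemma flag_form_normal x n B : Sb x -> supports Omb x n -> flag_form x B -> n *m B = - n.
Proof.
move=> Sx sn [BT BE].
have sep q : K q -> dot n (q - x) < 0.
  by move=> Kq; apply: (support_inner hb nested Sx sn).
apply/eqP; rewrite -subr_eq0 opprK; apply/eqP.
apply: (@flags_span x _ 0 _ sep); rewrite ?dot0r// => N y F _.
rewrite dotDl (dot_mulmxC _ _ BT) (BE _ _ F) dotZl (kappaE hd hb _ _ Sx sn) invf_div.
have [Sy _ _] := F; have := sep _ (boundary_closure ha Sy).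
rewrite -(opprB x y) dotNl dotNr (dotC _ n) oppr_lt0 => h.
by rewrite mulrN divfK ?gt_eqF// addNr.
Qed.

End FlagForm.

Section SymmetricProduct.
Context {R : realType} {d : nat}.
Implicit Types (a b u v w p q s t z r : 'rV[R]_d) (A B C : 'M[R]_d).

Definition sym2 u v : 'M[R]_d := u^T *m v + v^T *m u.

Lemma mul_outer w u v : w *m (u^T *m v) = dot w u *: v.
Proof. by rewrite mulmxA (mx11_scalar (w *m u^T)) -dot_mx mul_scalar_mx. Qed.

Lemma mul_sym2 w u v : w *m sym2 u v = dot w u *: v + dot w v *: u.
Proof. by rewrite mulmxDr !mul_outer. Qed.

Lemma mx_row_ext A B : (forall w, w *m A = w *m B) -> A = B.
Proof. by move=> h; apply/row_matrixP => i; rewrite !rowE. Qed.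

Lemma dual_vector a b : (forall c : R, a != c *: b) -> exists w, dot w a = 1 /\ dot w b = 0.
Proof.
move=> ab; pose w := a - (dot a b / dot b b) *: b.
have w0 : w != 0 by rewrite subr_eq0.
have wb : dot w b = 0.
  rewrite dotDl dotNl dotZl; have [->|b0] := eqVneq b 0; first by rewrite !dot0r mulr0 subrr.
  by rewrite divfK ?subrr// dot_eq0.
have wa : dot w a = dot w w.
  by rewrite {3}/w dotDr dotNr dotZr wb mulr0 subr0.
exists ((dot w w)^-1 *: w); rewrite !dotZl wb mulr0 wa mulVf// dot_eq0//.
Qed.

Lemma sym2_indep a b p q : (forall c : R, a != c *: b) -> (forall c : R, b != c *: a) ->
  sym2 a p + sym2 b q = 0 -> exists c : R, p = c *: b.
Proof.
move=> ab ba E; have [f [fa fb]] := dual_vector ab; have [g [ga gb]] := dual_vector ba.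
have P w : dot w a *: p + dot w p *: a + (dot w b *: q + dot w q *: b) = 0.
  by rewrite -!mul_sym2 -mulmxDr E mulmx0.
have := P f; rewrite fa fb scale1r scale0r add0r => Ep.
have fp : dot f p = 0.
  have := congr1 (dot f) Ep; rewrite !dotDr !dotZr fa fb dot0r; lra.
exists (- dot f q); apply/eqP; rewrite scaleNr -addr_eq0 -Ep fp scale0r addr0; exact/eqP.
Qed.

Lemma sym2_eq0 e s : e != 0 -> sym2 e s = 0 -> s = 0.
Proof.
move=> e0 E; have := mul_sym2 e e s; rewrite E mulmx0 => /esym H.
have ee : dot e e != 0 by rewrite dot_eq0.
have es : dot e s = 0.
  have := congr1 (dot e) H; rewrite dotDr !dotZr dot0r => h.
  by apply: (mulfI ee); rewrite mulr0; move: h; lra.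
by move: H => /eqP; rewrite es scale0r addr0 scaler_eq0 (negbTE ee) => /eqP.
Qed.

Lemma sym2_of_kernel e A : e != 0 -> A^T = A ->
  (forall w, dot w e = 0 -> exists c : R, w *m A = c *: e) -> exists s, A = sym2 e s.
Proof.
move=> e0 AT H; have ee : dot e e != 0 by rewrite dot_eq0.
pose s := (dot e e)^-1 *: (e *m A) - (dot (e *m A) e / (2 * dot e e ^+ 2)) *: e.
exists s; apply: mx_row_ext => u.
pose c := dot u e / dot e e; pose w := u - c *: e.
have uE : u = c *: e + w by rewrite /w subrKC.
have we : dot w e = 0 by rewrite /w dotDl dotNl dotZl /c divfK ?subrr.
have eA : e *m sym2 e s = e *m A.
  rewrite mul_sym2 {2}/s dotDr dotNr !dotZr (dotC e (e *m A)) /s.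
  move: (dot e e) (dot (e *m A) e) ee (e *m A) => E D E0 f.
  by apply/rowP => i; rewrite !mxE; field.
have wA : w *m sym2 e s = w *m A.
  have [k wk] := H _ we; rewrite mul_sym2 we scale0r add0r wk /s dotDr dotNr !dotZr we mulr0 subr0.
  by rewrite dotC (dot_mulmxC _ _ AT) wk dotZl mulrC mulfK.
clearbody w; by rewrite uE !mulmxDl -!scalemxAl eA wA.
Qed.

Definition quad A r (al : R) z : 'M[R]_d := A + sym2 r z + al *: (z^T *m z).

Lemma mul_quad w A r al z :
  w *m quad A r al z = w *m A + dot w r *: z + dot w z *: r + (al * dot w z) *: z.
Proof.
by rewrite /quad (mulmxDr w (A + _)) (mulmxDr w A) mul_sym2 -scalemxAr mul_outer scalerA addrA.
Qed.

Lemma quad_unique A r al A' r' al' z1 z2 z3 : z1 != z2 -> z1 != z3 -> z2 != z3 ->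
  (forall z, z \in [:: z1; z2; z3] -> quad A r al z = quad A' r' al' z) ->
  [/\ A = A', r = r' & al = al'].
Proof.
move=> n12 n13 n23 H.
have D y z : y \in [:: z1; z2; z3] -> z \in [:: z1; z2; z3] -> y != z ->
    r - r' + ((al - al') / 2) *: (y + z) = 0.
  move=> Hy Hz yz; apply: (@sym2_eq0 (y - z)); first by rewrite subr_eq0.
  apply: mx_row_ext => w; rewrite mulmx0 mul_sym2.
  have := congr1 (mulmx w) (H y Hy); have := congr1 (mulmx w) (H z Hz); rewrite !mul_quad.
  rewrite !(dotDr, dotNr, dotZr).
  move: (w *m A) (w *m A') (dot w _) (dot w _) (dot w _) (dot w _) => f f' a b c e Ez Ey.
  apply/rowP => i; have := congr1 (fun M : 'rV[R]_d => M 0 i) Ez.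
  have := congr1 (fun M : 'rV[R]_d => M 0 i) Ey; rewrite !mxE; lra.
have i1 : z1 \in [:: z1; z2; z3] by rewrite !inE eqxx.
have i2 : z2 \in [:: z1; z2; z3] by rewrite !inE eqxx orbT.
have i3 : z3 \in [:: z1; z2; z3] by rewrite !inE eqxx !orbT.
have E1 := D _ _ i1 i2 n12; have E2 := D _ _ i1 i3 n13.
have al0 : al = al'.
  have : ((al - al') / 2) *: (z2 - z3) = 0.
    rewrite -[RHS](subrr (0 : 'rV[R]_d)) -{1}E1 -E2; apply/rowP => i; rewrite !mxE; ring.
  move=> /eqP; rewrite scaler_eq0 !subr_eq0 (negbTE n23) orbF mulf_eq0 subr_eq0 invr_eq0.
  by rewrite pnatr_eq0 orbF => /eqP.
have r0 : r = r'.
  by apply/eqP; rewrite -subr_eq0 -E1 al0 subrr mul0r scale0r addr0.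
split => //; have := H _ i1; rewrite /quad al0 r0 -!addrA => /addIr//.
Qed.

End SymmetricProduct.

Section Patch.
Context {R : realType} {d : nat}.
Implicit Types (p z : 'rV[R]_d).
Variables (P : set 'rV[R]_d) (B : 'rV[R]_d -> 'M[R]_d).
Hypothesis noncollinear : forall x y z, P x -> P y -> P z -> x != y -> y != z -> x != z ->
  forall c : R, x - y != c *: (y - z).
Hypothesis pair : forall x x', P x -> P x' -> x != x' -> exists s, B x - B x' = sym2 (x - x') s.

(* With [p1] fixed, three pairwise relations force [s z - s z'] to be a multiple of [z - z'],
   and noncollinearity makes the factor constant. *)
Lemma patch_quad : exists A r al, forall z, P z -> B z = quad A r al z.
Proof.
have [[p1 Pp1]|nP] := pselect (P !=set0); last first.
  by exists 0, 0, 0 => z Pz; case: nP; exists z.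
have /choice[s Hs] : forall z, exists s, P z -> z != p1 -> B p1 - B z = sym2 (p1 - z) s.
  move=> z; have [[Pz zp]|h] := pselect (P z /\ z != p1); last first.
    by exists 0 => Pz zp; case: h.
  by have [|s] := pair Pp1 Pz; [rewrite eq_sym|exists s].
have step z z' : P z -> P z' -> z != p1 -> z' != p1 -> z != z' ->
    exists c : R, s z - s z' = c *: (z - z').
  move=> Pz Pz' zp zp' zz'; have [t Ht] := pair Pz Pz' zz'.
  apply: (@sym2_indep _ _ (p1 - z) (z - z') (s z - s z') (t - s z')).
  - by apply: noncollinear => //; rewrite eq_sym.
  - move=> c; have := noncollinear Pz' Pz Pp1; rewrite eq_sym => /(_ zz' zp zp' c).
    by apply: contra_neq => E; rewrite -(opprB z z') E -scalerN opprB.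
  - have := Hs z Pz zp; have := Hs z' Pz' zp' => E' E.
    have : B p1 - B z + (B z - B z') - (B p1 - B z') = 0.
      by rewrite addrA subrK subrr.
    rewrite E E' Ht => <-; apply: mx_row_ext => w.
    rewrite !(mul_sym2, mulmxDr, mulmxN) !(dotDr, dotNr).
    by apply/rowP => i; rewrite !mxE; ring.
suff [lam [rho Hl]] : exists (lam : R) rho, forall z, P z -> z != p1 -> s z = rho + lam *: z.
  exists (B p1 - sym2 p1 rho), (rho - lam *: p1), (2 * lam) => z Pz.
  have [->|zp] := eqVneq z p1; apply: mx_row_ext => w.
    rewrite mul_quad !(mul_sym2, mulmxDr, mulmxN) !(dotDr, dotNr, dotZr).
    move: (w *m B p1) => f.
    by apply/rowP => i; rewrite !mxE; ring.
  have -> : B z = B p1 - (B p1 - B z) by rewrite opprB subrKC.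
  rewrite (Hs z Pz zp) (Hl z Pz zp) mul_quad !(mul_sym2, mulmxDr, mulmxN) !(dotDr, dotNr, dotZr).
  move: (w *m B p1) => f.
  by apply/rowP => i; rewrite !mxE; ring.
have [[p2 [Pp2 p21]]|h] := pselect (exists p2, P p2 /\ p2 != p1); last first.
  by exists 0, 0 => z Pz zp; case: h; exists z.
have [[p3 [Pp3 p31 p32]]|h] := pselect (exists p3, [/\ P p3, p3 != p1 & p3 != p2]); last first.
  exists 0, (s p2) => z Pz zp; rewrite scale0r addr0.
  by have [->//|zp2] := eqVneq z p2; case: h; exists z.
have [lam Hl] := step _ _ Pp3 Pp2 p31 p21 p32.
exists lam, (s p2 - lam *: p2) => z Pz zp1.
suff E : s z - s p2 = lam *: (z - p2).
  by rewrite -[LHS](subrK (s p2)) E scalerBr; apply/rowP => i; rewrite !mxE; ring.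
have [->|zp2] := eqVneq z p2; first by rewrite !subrr scaler0.
have [->//|zp3] := eqVneq z p3.
have [mu Hmu] := step _ _ Pz Pp2 zp1 p21 zp2.
have [nu Hnu] := step _ _ Pz Pp3 zp1 p31 zp3.
have E0 : (mu - nu) *: (z - p2) = (lam - nu) *: (p3 - p2).
  have : s z - s p3 = (s z - s p2) - (s p3 - s p2) by apply/rowP => i; rewrite !mxE; ring.
  rewrite Hmu Hnu Hl => E; apply/rowP => i; have := congr1 (fun v : 'rV[R]_d => v 0 i) E.
  by rewrite !mxE; lra.
have [munu|munu] := eqVneq mu nu.
  move: E0; rewrite munu subrr scale0r => /esym/eqP; rewrite scaler_eq0 !subr_eq0 (negbTE p32) orbF.
  by rewrite Hmu munu => /eqP ->.
have := noncollinear Pz Pp2 Pp3 zp2; rewrite eq_sym => /(_ p32 zp3 (- (lam - nu) / (mu - nu))).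
move=> /eqP; case.
have := congr1 (fun v => (mu - nu)^-1 *: v) E0; rewrite !scalerA mulVf ?subr_eq0// scale1r => ->.
by rewrite -(opprB p3 p2) scalerN -scaleNr; congr (_ *: _); field; rewrite subr_eq0.
Qed.

End Patch.

Section Boundary.
Context {R : realType} {d : nat}.
Implicit Types (u v w p q z n m e x y N : 'rV[R]_d) (t : R).
Variable Om : set 'rV[R]_d.
Hypothesis hd : (3 <= d)%N.
Hypothesis hOm : strictly_convex_closed_boundary Om.
Let S := boundary Om.

Lemma boundary_noncollinear x y z : S x -> S y -> S z -> x != y -> y != z -> x != z ->
  forall c : R, x - y != c *: (y - z).
Proof.
move=> Sx Sy Sz xy yz xz c; apply/eqP => E.
have sup p : S p -> exists n, forall q, S q -> q != p -> dot n (q - p) < 0.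
  move=> Sp; have [k k0 sn] := support_normal hd hOm Sp.
  by exists (k *: normal S p) => q Sq; apply: sn; exact: (boundary_closure hOm Sq).
have [c0|c0] := ltP 0 c.
  have [n sn] := sup y Sy; have := sn x Sx xy; have := sn z Sz; rewrite eq_sym => /(_ yz).
  rewrite E dotZr -(opprB y z) dotNr oppr_lt0 pmulr_rlt0// => h1 h2.
  by have := lt_trans h1 h2; rewrite ltxx.
have xzE : x - z = (1 + c) *: (y - z).
  by rewrite scalerDl scale1r -E [RHS]addrC subrKA.
have [c1|c1] := ltP (-1) c.
  have [n sn] := sup x Sx; have := sn y Sy; rewrite eq_sym => /(_ xy).
  have := sn z Sz; rewrite eq_sym => /(_ xz).
  rewrite -(opprB x z) -(opprB x y) xzE E !dotNr !dotZr !oppr_lt0.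
  rewrite pmulr_rgt0 => [h|]; last by move: c1; lra.
  by rewrite pmulr_lgt0// ltNge c0.
have [n sn] := sup z Sz; have := sn y Sy yz; have := sn x Sx xz.
rewrite xzE dotZr => h1 h2; move: h1; rewrite nmulr_llt0// ltNge.
by move: c1; lra.
Qed.

Lemma boundary_not_isolated x (e : R) : S x -> 0 < e ->
  exists z1 z2, [/\ S z1 /\ ball x e z1, S z2 /\ ball x e z2, z1 != x, z2 != x & z1 != z2].
Proof.
move=> Sx e0; have [[_ _ [y Oy] _] _ _ _] := hOm.
have [v vE] : exists v, v = x - y by exists (x - y).
have v0 : v != 0.
  by rewrite vE subr_eq0; apply: contra_notN (boundary_notin hOm Sx) => /eqP->.
have [w w0 [vw _]] := exists_orthogonal v v hd.
have vv : dot v v != 0 by rewrite dot_eq0.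
have ww : dot w w != 0 by rewrite dot_eq0.
have nz t : v + t *: w != 0.
  apply: contra_neq vv => /(congr1 (dot v)).
  by rewrite dotDr dotZr vw mulr0 addr0 dot0r.
have [rad [rad0 radS radD]] := radial_curve hd hOm Oy nz.
pose X t := y + rad t *: (v + t *: w).
have r1 : rad 0 = 1.
  apply: (ray_unique (v := v) hd hOm Oy (rad0 0) ltr01).
    by have := radS 0; rewrite scale0r addr0.
  by rewrite scale1r vE subrKC.
have X0 : X 0 = x by rewrite /X r1 scale0r addr0 scale1r vE subrKC.
have inj s t : s != t -> X s != X t.
  apply: contra_neq => /addrI E.
  have E1 : rad s = rad t.
    have := congr1 (dot v) E; rewrite !dotZr !dotDr !dotZr vw !mulr0 !addr0.
    exact: (mulIf vv).
  have := congr1 (dot w) E; rewrite E1 !dotZr !dotDr !dotZr => /(mulfI (lt0r_neq0 (rad0 t))).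
  by move=> /addrI/(mulIf ww).
have [k k0 sn] := support_normal hd hOm Sx.
have := radD 0 (k *: normal S x); rewrite -/(X 0) X0 => /(_ sn) dX.
have cX : {for (0 : R), continuous X}.
  by apply: differentiable_continuous; apply/derivable1_diffP; exact: ex_derive.
have [del /= del0 Hdel] : \forall t \near (0 : R), ball x e (X t).
  by apply: cX; rewrite X0; exact: nbhsx_ballx.
have B t : 0 < t -> t < del -> ball x e (X t).
  by move=> t0 td; apply: Hdel; rewrite /= sub0r normrN gtr0_norm.
exists (X (del / 2)), (X (del / 4)); split.
- by split; [exact: radS|apply: B; lra].
- by split; [exact: radS|apply: B; lra].
- by rewrite -X0; apply: inj; rewrite gt_eqF//; lra.
- by rewrite -X0; apply: inj; rewrite gt_eqF//; lra.
- by apply: inj; rewrite gt_eqF//; lra.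
Qed.

End Boundary.

Section Patches.
Context {R : realType} {d : nat}.
Implicit Types (u v w p q z n m e x y N : 'rV[R]_d) (t : R).

Lemma dot_le_of_sqr u v (a b : R) : 0 <= a -> 0 <= b -> dot u u <= a ^+ 2 -> dot v v <= b ^+ 2 ->
  `|dot u v| <= a * b.
Proof.
move=> a0 b0 ua vb; rewrite -(@ler_pXn2r _ 2)// ?nnegrE ?mulr_ge0//.
rewrite real_normK ?num_real// exprMn; apply: le_trans (cauchy_schwarz u v) _.
by apply: ler_pM => //; exact: dot_ge0.
Qed.

Lemma dot_sqrD_le u v (a : R) : dot u u <= a -> dot v v <= a -> dot (u - v) (u - v) <= 4 * a.
Proof.
move=> ua vb; have := dot_ge0 (u + v).
by rewrite !dotDl !dotDr !dotNl !dotNr (dotC v u); lra.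
Qed.

Variables (Oma Omb : set 'rV[R]_d).
Hypothesis hd : (3 <= d)%N.
Hypothesis ha : strictly_convex_closed_boundary Oma.
Hypothesis hb : strictly_convex_closed_boundary Omb.
Hypothesis nested : closure Oma `<=` Omb.

Let Sb := boundary Omb.
Let K := closure Oma.

Lemma local_separation x0 : Sb x0 -> exists2 eps : R, 0 < eps &
  forall x x', Sb x -> Sb x' -> ball x0 eps x -> ball x0 eps x' -> x != x' ->
  exists m, dot m (x - x') = 0 /\ forall q, K q -> dot m (q - x) < 0.
Proof.
move=> Sx0; have [G [g [A [r [L _ sup]]]]] := convex_chart hd hb Sx0.
have [[_ _ [y0 Oy0] _] _ _ _] := ha.
have K0 : K !=set0 by exists y0; exact: subset_closure.
have sn : supports Omb x0 (g x0).
  by move=> q cq qx; apply: sup => //; apply: ballxx; exact: le_radius L.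
have cK : compact K := closure_compact ha.
have [mu mu0 Hmu] : exists2 mu : R, 0 < mu & forall q, K q -> dot (g x0) (q - x0) <= - mu.
  have [|c cin cmax] := @EVT_max_rV R d (fun q => dot (g x0) (q - x0)) K K0 cK.
    exact: continuous_subspaceT (@dot_sub_continuous _ _ _ _).
  exists (- dot (g x0) (c - x0)); last by move=> q Kq; rewrite opprK; apply: cmax; rewrite inE.
  by rewrite oppr_gt0; apply: (support_inner hb nested Sx0 sn); move: cin; rewrite inE.
have [D D1 HD] : exists2 D : R, 1 <= D & forall q, K q -> dot (q - x0) (q - x0) <= D ^+ 2.
  have [|c cin cmax] := @EVT_max_rV R d (fun q => dot (q - x0) (q - x0)) K K0 cK.
    apply: continuous_subspaceT => q.
    have cs : {for q, continuous (fun q : 'rV[R]_d => q - x0)} by exact: (cvgB cvg_id (cvg_cst x0)).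
    exact: (continuous_comp cs (@dot_self_continuous _ _ _)).
  exists (1 + dot (c - x0) (c - x0)); first by rewrite lerDl dot_ge0.
  move=> q Kq; apply: le_trans (cmax q _) _; first by rewrite inE.
  have := dot_ge0 (c - x0); move: (dot _ _) => k k0.
  have : 0 <= k * k by rewrite mulr_ge0.
  by lra.
have D0 : 0 < D by lra.
pose eta := mu / (6 * D).
have eta0 : 0 < eta by rewrite divr_gt0 ?mulr_gt0.
have near : \forall q \near x0, dot (g q - g x0) (g q - g x0) < eta ^+ 2.
  by apply: (le_cont L); rewrite exprn_gt0.
have near2 : \forall q \near x0, ball x0 r q by apply: nbhsx_ballx; exact: (le_radius L).
have near3 : \forall q \near x0, dot (q - x0) (q - x0) <= D ^+ 2.
  have cs : {for x0, continuous (fun q : 'rV[R]_d => q - x0)} by exact: (cvgB cvg_id (cvg_cst x0)).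
  have cc := continuous_comp cs (@dot_self_continuous _ _ _).
  have : 0 < D ^+ 2 by rewrite exprn_gt0.
  move=> D2; have := cvgr_lt _ cc (D ^+ 2).
  by rewrite /= subrr dot0l => /(_ _ D2); apply: filterS => q /ltW.
have [eps /= eps0 Heps] := (nbhs_ballP _ _).1 (filterI near (filterI near2 near3)).
exists eps => // x x' Sx Sx' /Heps[gx [bx xD]] /Heps[gx' [bx' xD']] xx'.
set e := x - x'.
have e0 : e != 0 by rewrite subr_eq0.
have ee : 0 < dot e e by rewrite dot_gt0.
pose p := dot (g x) e.
have p0 : 0 < p.
  have := sup x x' bx Sx (boundary_closure hb Sx'); rewrite eq_sym => /(_ xx').
  by rewrite -opprB dotNr oppr_lt0.
have p1 : p <= dot (g x - g x') e.
  have := sup x' x bx' Sx' (boundary_closure hb Sx) xx'.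
  by rewrite dotDl dotNl /p -/e; lra.
have p2 : p ^+ 2 <= 4 * eta ^+ 2 * dot e e.
  apply: (@le_trans _ _ (dot (g x - g x') e ^+ 2)).
    by rewrite ler_pXn2r// ?nnegrE ?(ltW p0)// (le_trans (ltW p0)).
  apply: le_trans (cauchy_schwarz _ _) _; rewrite ler_wpM2r ?dot_ge0//.
  have -> : g x - g x' = (g x - g x0) - (g x' - g x0) by rewrite opprB subrKA.
  by apply: dot_sqrD_le; exact: ltW.
exists (g x - (p / dot e e) *: e); split.
  by rewrite dotDl dotNl dotZl divfK ?subrr// gt_eqF.
move=> q Kq.
have a1 : `|dot (g x - g x0) (q - x0)| <= eta * D.
  by apply: dot_le_of_sqr; [exact: ltW|exact: ltW|exact: ltW|exact: HD].
have a2 : 0 <= dot (g x) (x - x0).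
  have [->|xx0] := eqVneq x x0; first by rewrite subrr dot0r.
  have := sup x x0 bx Sx (boundary_closure hb Sx0); rewrite eq_sym => /(_ xx0).
  by rewrite -opprB dotNr oppr_lt0 => /ltW.
have a3 : `|p / dot e e * dot e (q - x)| <= 4 * eta * D.
  have b1 : dot e (q - x) ^+ 2 <= dot e e * (4 * D ^+ 2).
    apply: le_trans (cauchy_schwarz _ _) _; rewrite ler_wpM2l ?dot_ge0//.
    have -> : q - x = (q - x0) - (x - x0) by rewrite opprB subrKA.
    by apply: dot_sqrD_le => //; exact: HD.
  have -> : p / dot e e * dot e (q - x) = p * dot e (q - x) / dot e e by rewrite mulrAC.
  rewrite normrM normfV (gtr0_norm ee) ler_pdivrMr// -(@ler_pXn2r _ 2)// ?nnegrE.
    rewrite real_normK ?num_real// exprMn.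
    apply: le_trans (ler_pM (sqr_ge0 _) (sqr_ge0 _) p2 b1) _.
    by rewrite le_eqVlt; apply/orP; left; apply/eqP; ring.
  exact: (mulr_ge0 (mulr_ge0 (mulr_ge0 (ler0n _ 4) (ltW eta0)) (ltW D0)) (ltW ee)).
have a4 := Hmu q Kq.
have -> : dot (g x - (p / dot e e) *: e) (q - x) =
    dot (g x0) (q - x0) + dot (g x - g x0) (q - x0) - dot (g x) (x - x0) -
    p / dot e e * dot e (q - x).
  by rewrite dotDl dotNl dotZl !dotDr !dotNr !dotDl !dotNl; ring.
have a5 : eta * D = mu / 6 by rewrite /eta; field; rewrite gt_eqF.
move: a1 a3; rewrite -mulrA a5 !ler_norml; move: a2 a4 mu0.
by lra.
Qed.

End Patches.

Section Globalization.
Context {R : realType} {d : nat}.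
Implicit Types (u v w p q z n m e x y N : 'rV[R]_d) (t : R).
Variables (Oma Omb : set 'rV[R]_d).
Hypothesis hd : (3 <= d)%N.
Hypothesis ha : strictly_convex_closed_boundary Oma.
Hypothesis hb : strictly_convex_closed_boundary Omb.
Hypothesis nested : closure Oma `<=` Omb.

Let Sa := boundary Oma.
Let Sb := boundary Omb.
Let K := closure Oma.

Hypothesis caustic : forall x v, Sb x -> (forall t, ~ Oma (x + t *: v)) ->
  forall t, ~ Oma (x + t *: reflect_dir (normal Sb x) v).

Lemma flag_form_pair x x' m B B' : Sb x -> Sb x' -> x != x' ->
  dot m (x - x') = 0 -> (forall q, K q -> dot m (q - x) < 0) ->
  flag_form Oma Omb x B -> flag_form Oma Omb x' B' -> exists s, B - B' = sym2 (x - x') s.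
Proof.
move=> Sx Sx' xx' me sep [BT BE] [BT' BE']; set e := x - x'.
have e0 : e != 0 by rewrite subr_eq0.
have DT : (B - B')^T = B - B' by rewrite linearB /= BT BT'.
have DN N y : flag Oma N y x -> dot N e = 0 -> exists c, N *m (B - B') = c *: e.
  move=> F Ne; have [Sy sN Nxy] := F.
  have F' : flag Oma N y x'.
    split => //; have -> : x' - y = (x - y) - e by rewrite /e; apply/rowP => i; rewrite !mxE; ring.
    by rewrite dotDr dotNr Nxy Ne subrr.
  exists (- (kappa Omb N y x)^-1); rewrite mulmxDr mulmxN (BE _ _ F) (BE' _ _ F').
  have [_ _ Nxy'] := F'.
  rewrite (kappa_const hd ha hb nested caustic Sy sN Sx' Sx Nxy' Nxy).
  by apply/rowP => i; rewrite /e !mxE; ring.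
apply: sym2_of_kernel => // w we.
have ee : dot e e != 0 by rewrite dot_eq0.
exists (dot (w *m (B - B')) e / dot e e); apply/eqP; rewrite -subr_eq0; apply/eqP.
apply: (@flags_span _ _ Oma hd ha x m e _ sep me).
  by rewrite dotDl dotNl dotZl divfK ?subrr.
move=> N y F Ne; rewrite dotDl dotNl dotZl (dotC e N) Ne mulr0 subr0.
by rewrite (dot_mulmxC _ _ DT); have [c ->] := DN _ _ F Ne; rewrite dotZl dotC we mulr0.
Qed.

Lemma flag_form_quad : exists A r al, A^T = A /\ forall x, Sb x ->
  flag_form Oma Omb x (quad A r al x).
Proof.
have /choice[B HB] : forall x, exists B, Sb x -> flag_form Oma Omb x B.
  move=> x; have [Sx|nS] := pselect (Sb x); last by exists 0.
  by have [B FB] := flag_form_exists hd ha hb nested caustic Sx; exists B.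
pose agrees A r al x (eps : R) := forall z, Sb z -> ball x eps z -> B z = quad A r al z.
have patch x : Sb x -> exists2 eps : R, 0 < eps & exists A r al, agrees A r al x eps.
  move=> Sx; have [eps eps0 H] := local_separation hd ha hb nested Sx.
  exists eps => //.
  have [||A [r [al Hq]]] := @patch_quad R d [set z | Sb z /\ ball x eps z] B.
  - by move=> p q z [Sp _] [Sq _] [Sz _]; exact: (boundary_noncollinear hd hb).
  - move=> p q [Sp bp] [Sq bq] pq; have [m [me sep]] := H _ _ Sp Sq bp bq pq.
    exact: (flag_form_pair Sp Sq pq me sep (HB _ Sp) (HB _ Sq)).
  by exists A, r, al => z Sz bz; apply: Hq.
have [y0 Oy0] : Omb !=set0 by case: hb => -[].
have [x0 Sx0] : exists x0, Sb x0.
  have [u u0 _] := exists_orthogonal (0 : 'rV[R]_d) 0 hd.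
  by have [s _ [Ss _]] := ray_exit hb Oy0 u0; exists (y0 + s *: u).
have [eps0 eps0_gt0 [A [r [al H0]]]] := patch x0 Sx0.
have cSb : connected Sb by case: hb.
have all : forall x, Sb x -> exists2 eps : R, 0 < eps & agrees A r al x eps.
  apply: (connected_propagate cSb); first by exists x0 => //; exists eps0.
    move=> x Sx [eps eps_gt0 H]; apply/nbhs_ballP; exists (eps / 2) => /=; first by lra.
    move=> z bz Sz; exists (eps / 2); first by lra.
    move=> q Sq bq; apply: H => //; rewrite [eps]splitr; exact: ball_triangle bz bq.
  move=> x Sx H; have [eps eps_gt0 [A' [r' [al' H']]]] := patch x Sx.
  have e2 : 0 < eps / 2 by lra.
  have [y [Sy by_ [ey ey0 Hy]]] := H _ (nbhsx_ballx x _ e2).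
  pose rho := Num.min (eps / 2) ey.
  have rho0 : 0 < rho by rewrite lt_min e2.
  have [z1 [z2 [[Sz1 b1] [Sz2 b2] z1y z2y z12]]] := boundary_not_isolated hd hb Sy rho0.
  have both z : Sb z -> ball y rho z -> quad A r al z = quad A' r' al' z.
    move=> Sz bz; rewrite -Hy//; last by apply: le_ball bz; rewrite ge_min lexx orbT.
    apply: H' => //; rewrite [eps]splitr; apply: ball_triangle by_ _.
    by apply: le_ball bz; rewrite ge_min lexx.
  have [|||z|-> -> ->] := @quad_unique _ _ A r al A' r' al' y z1 z2; rewrite ?(eq_sym y)//.
    by rewrite !inE => /or3P[]/eqP->; apply: both => //; exact: ballxx.
  by exists eps.
have form x : Sb x -> flag_form Oma Omb x (quad A r al x).
  by move=> Sx; have [eps e0 H] := all x Sx; rewrite -H//; [exact: HB|exact: ballxx].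
exists A, r, al; split => //.
have [QT _] := form x0 Sx0; move: QT; rewrite /quad /sym2 !linearD /= linearZ /= !trmx_mul !trmxK.
by rewrite (addrC (x0^T *m r)) => /addIr/addIr.
Qed.

Lemma flag_on_boundary N y : Sa y -> supports Oma y N -> exists x x',
  [/\ Sb x, Sb x', flag Oma N y x, flag Oma N y x' & x != x'].
Proof.
move=> Sy sN; have Oy : Omb y by apply: nested; exact: (boundary_closure ha).
have [u u0 [Nu _]] := exists_orthogonal N N hd.
have [s s0 [Ss _]] := ray_exit hb Oy u0.
have nu0 : - u != 0 by rewrite oppr_eq0.
have [s' s'0 [Ss' _]] := ray_exit hb Oy nu0.
have F t : flag Oma N y (y + t *: u) by split => //; rewrite addBl dotZr Nu mulr0.
exists (y + s *: u), (y + s' *: - u); split => //; first by rewrite scalerN -scaleNr; exact: F.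
rewrite scalerN -scaleNr; apply/eqP => /addrI/(congr1 (dot u)); rewrite !dotZr.
have uu : dot u u != 0 by rewrite dot_eq0.
by move=> /(mulIf uu); lra.
Qed.

Lemma support_exists (Om : set 'rV[R]_d) N : strictly_convex_closed_boundary Om -> N != 0 ->
  exists2 y, boundary Om y & supports Om y N.
Proof.
move=> hOm N0; have [[_ _ [y0 Oy0] _] _ _ _] := hOm.
have K0 : closure Om !=set0 by exists y0; exact: subset_closure.
have [|y yin ymax] := @EVT_max_rV R d (dot N) (closure Om) K0 (closure_compact hOm).
  exact: continuous_subspaceT (@dot_continuous _ _ _).
have [|Sy sN] := contact_support hd hOm (set_mem yin) N0; last by exists y.
by move=> q Kq; rewrite dotDr dotNr subr_le0; apply: ymax; rewrite inE.
Qed.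

Lemma quadric_normals : exists (a : R) c (M : 'M[R]_d), [/\ 0 < a, M^T = M,
  forall y N, Sa y -> supports Oma y N ->
    0 < dot N (y - c) /\ dot N (y - c) *: (y - c) = N *m M &
  forall x n, Sb x -> supports Omb x n ->
    dot n (x - c) *: (x - c) = n *m (M + a^-1%:M)].
Proof.
have [A [r [al [AT form]]]] := flag_form_quad.
have inner y N : Sa y -> supports Oma y N -> exists k : R, [/\ 0 < k,
    k = - (dot N r + al * dot N y) & k *: y = N *m A + dot N y *: r].
  move=> Sy sN; have [x [x' [Sx Sx' F F' xx']]] := flag_on_boundary Sy sN.
  have [_ _ Nx] := F; have [_ _ Nx'] := F'.
  have [_ /(_ _ _ F) E] := form x Sx; have [_ /(_ _ _ F') E'] := form x' Sx'.
  have k0 := kappa_gt0 hd ha hb nested caustic Sx F.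
  move: E E'; rewrite (kappa_const hd ha hb nested caustic Sy sN Sx' Sx Nx' Nx).
  set k := (kappa _ _ _ _)^-1.
  have hx : dot N x = dot N y by move: Nx; rewrite dotDr dotNr; lra.
  have hx' : dot N x' = dot N y by move: Nx'; rewrite dotDr dotNr; lra.
  rewrite !mul_quad hx hx' => E E'.
  have kE : k = - (dot N r + al * dot N y).
    have : (k + (dot N r + al * dot N y)) *: (x - x') = 0.
      apply/rowP => i; have := congr1 (fun v : 'rV[R]_d => v 0 i) E.
      by have := congr1 (fun v : 'rV[R]_d => v 0 i) E'; rewrite !mxE; lra.
    by move=> /eqP; rewrite scaler_eq0 subr_eq0 (negbTE xx') orbF => /eqP; lra.
  exists k; split => //; first by rewrite invr_gt0.
  apply/rowP => i; have := congr1 (fun v : 'rV[R]_d => v 0 i) E.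
  have kx : k * x 0 i = - (dot N r + al * dot N y) * x 0 i by rewrite {1}kE.
  by rewrite !mxE; move: kx; lra.
have [[_ _ [q Oq] _] _ _ _] := ha.
pose a := - al.
have a0 : 0 < a.
  have [u u0 _] := exists_orthogonal (0 : 'rV[R]_d) 0 hd.
  have nu0 : - u != 0 by rewrite oppr_eq0.
  have [y Sy su] := support_exists ha u0; have [y' Sy' su'] := support_exists ha nu0.
  have [k [k0 kE _]] := inner _ _ Sy su; have [k' [k'0 k'E _]] := inner _ _ Sy' su'.
  have h1 := support_interior ha Sy su Oq; have h2 := support_interior ha Sy' su' Oq.
  move: kE k'E h1 h2; rewrite !(dotDr, dotNr, dotNl) => kE k'E h1 h2.
  have : 0 < a * (dot u y - dot u y') by rewrite /a; move: kE k'E k0 k'0; lra.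
  by rewrite pmulr_lgt0//; move: h1 h2; lra.
have [c ar] : exists c, r = a *: c.
  by exists (a^-1 *: r); rewrite scalerA divff ?scale1r ?gt_eqF.
pose M := a^-1 *: A + c^T *m c.
have NM N : a *: (N *m M) = N *m A + (a * dot N c) *: c.
  by rewrite /M mulmxDr -scalemxAr mul_outer scalerDr !scalerA divff ?scale1r ?gt_eqF.
have ane : a != 0 by rewrite gt_eqF.
exists a, c, M; split => //.
- by rewrite /M linearD /= linearZ /= trmx_mul trmxK AT.
- move=> y N Sy sN; have [k [k0 kE yE]] := inner _ _ Sy sN.
  have kE' : k = a * dot N (y - c).
    by rewrite kE dotDr dotNr ar dotZr /a; ring.
  split; first by move: k0; rewrite kE' pmulr_rgt0.
  apply: (scalerI ane); rewrite NM scalerA -kE'.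
  have -> : N *m A = k *: y - dot N y *: r by rewrite yE addrK.
  by rewrite ar; apply/rowP => i; rewrite !mxE kE' dotDr dotNr; ring.
- move=> x n Sx sn; have := flag_form_normal hd ha hb nested Sx sn (form x Sx).
  rewrite mul_quad => E; apply: (scalerI ane).
  rewrite [in RHS]mulmxDr [in RHS]scalerDr NM mul_mx_scalar !scalerA mulfV// scale1r.
  have alE : al = - a by rewrite /a opprK.
  move: E; rewrite alE ar !(dotDr, dotNr, dotZr) => E.
  apply/rowP => i; have := congr1 (fun v : 'rV[R]_d => v 0 i) E; rewrite !mxE => Ei.
  have -> : n 0 i = - - n 0 i by rewrite opprK.
  by rewrite -Ei; ring.
Qed.

End Globalization.

(** * Spectral theorem and confocal ellipsoids *)

Section Spectral.
Context {R : realType} {d : nat}.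
Implicit Types (u v w x : 'rV[R]_d) (M : 'M[R]_d).

Lemma sphere_section_compact k (P : 'M[R]_(k, d)) :
  compact [set v | dot v v = 1 /\ forall i, dot v (row i P) = 0].
Proof.
apply: bounded_closed_compact.
  exists 1; split; first exact: num_real.
  move=> b b1 v [v1 _]; apply: norm_le_of_dot; first by apply: le_trans (ltW b1).
  by rewrite v1 exprn_ege1// ltW.
rewrite (_ : [set v | _ /\ _] = [set v | dot v v = 1] `&`
    \bigcap_(i in [set: 'I_k]) [set v | dot (row i P) v = 0]); last first.
  apply/seteqP; split => v [v1 vP]; split => // i; first by move=> _ /=; rewrite dotC.
  by rewrite dotC; exact: vP.
apply: closedI.
  rewrite (_ : [set v | _] = (fun v => dot v v) @^-1` [set 1])//.
  apply: preimage_closed; last exact: closed_eq.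
  by move=> v _; exact: dot_self_continuous.
apply: closed_bigI => i _.
rewrite (_ : [set v | _] = (fun v => dot (row i P) v) @^-1` [set 0])//.
apply: preimage_closed; last exact: closed_eq.
by move=> v _; exact: dot_continuous.
Qed.

Lemma variation_eq0 (b c : R) : (forall t, 2 * t * b <= t ^+ 2 * c) -> b = 0.
Proof.
move=> H; have c1 : 0 < `|c| + 1 by rewrite ltr_wpDl.
have := H (b / (`|c| + 1)).
have -> : 2 * (b / (`|c| + 1)) * b = 2 * b ^+ 2 * (`|c| + 1) / (`|c| + 1) ^+ 2.
  by field; rewrite gt_eqF.
have -> : (b / (`|c| + 1)) ^+ 2 * c = b ^+ 2 * c / (`|c| + 1) ^+ 2.
  by field; rewrite gt_eqF.
rewrite ler_pM2r ?invr_gt0 ?exprn_gt0// => h.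
have cc : b ^+ 2 * c <= b ^+ 2 * `|c| by rewrite ler_wpM2l ?sqr_ge0 ?ler_norm.
have cp : 0 <= b ^+ 2 * `|c| by rewrite mulr_ge0 ?sqr_ge0.
apply/eqP; rewrite -sqrf_eq0 eq_le sqr_ge0 andbT.
by move: h cc cp; lra.
Qed.

Lemma orthogonal_eigenvector M k (P : 'M[R]_(k, d)) : M^T = M -> (k < d)%N ->
  (forall i, exists mu : R, row i P *m M = mu *: row i P) ->
  exists v (mu : R), [/\ dot v v = 1, forall i, dot v (row i P) = 0 & v *m M = mu *: v].
Proof.
move=> MT kd eig; pose C := [set v | dot v v = 1 /\ forall i, dot v (row i P) = 0].
have C0 : C !=set0.
  have : kermx P^T != 0.
    by rewrite kermx_eq0 /row_free neq_ltn (leq_ltn_trans (rank_leq_col _) kd).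
  move=> /rowV0Pn[u /sub_kermxP uP u0].
  have uu : 0 < dot u u by rewrite dot_gt0.
  have s0 : Num.sqrt (dot u u) != 0 by rewrite gt_eqF// sqrtr_gt0.
  exists ((Num.sqrt (dot u u))^-1 *: u); split.
    rewrite dotZl dotZr mulrA -expr2 exprVn sqr_sqrtr ?dot_ge0// mulVf// gt_eqF//.
  move=> i; rewrite dotZl; have -> : dot u (row i P) = 0; last by rewrite mulr0.
  have := congr1 (fun v : 'rV[R]_k => v 0 i) uP; rewrite !mxE => <-.
  by apply: eq_bigr => j _; rewrite !mxE.
pose f v := dot (v *m M) v.
have fc : continuous f.
  have -> : f = (fun v => \sum_i (dot (row i M) v) * v 0 i).
    apply/funext => v; apply: eq_bigr => i _; congr (_ * _).
    rewrite mxE; apply: eq_bigr => j _; rewrite mxE mulrC.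
    by congr (_ * _); rewrite -[in LHS]MT mxE.
  move=> v; apply: (@cvg_sumr R _ (nbhs v)) => i.
  by apply: cvgM; [exact: dot_continuous|exact: coord_continuous].
have [|v vC vmax] := @EVT_max_rV R d f C C0 (@sphere_section_compact _ P).
  exact: continuous_subspaceT.
move: vC; rewrite inE => -[v1 vP].
have max u : (forall i, dot u (row i P) = 0) -> f u <= f v * dot u u.
  move=> uP; have [->|u0] := eqVneq u 0; first by rewrite /f mul0mx !dot0l mulr0.
  have uu : 0 < dot u u by rewrite dot_gt0.
  have := vmax ((Num.sqrt (dot u u))^-1 *: u); rewrite inE.
  have sE : (Num.sqrt (dot u u))^-1 * (Num.sqrt (dot u u))^-1 = (dot u u)^-1.
    by rewrite -expr2 exprVn sqr_sqrtr// ltW.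
  have cu : C ((Num.sqrt (dot u u))^-1 *: u).
    split; first by rewrite dotZl dotZr mulrA sE mulVf// gt_eqF.
    by move=> i; rewrite dotZl uP mulr0.
  move=> /(_ cu); rewrite {1}/f -scalemxAl dotZl dotZr mulrA sE -/(f u).
  by rewrite mulrC ler_pdivrMr.
exists v, (f v); split => //; apply/eqP; rewrite -subr_eq0 -dot_eq0.
set z := v *m M - f v *: v.
have zP i : dot z (row i P) = 0.
  have [mu E] := eig i; rewrite /z dotDl dotNl dotZl vP mulr0 subr0.
  by rewrite (dot_mulmxC _ _ MT) E dotZl dotC vP mulr0.
have zv : dot v z = 0 by rewrite /z dotDr dotNr dotZr v1 mulr1 dotC subrr.
have -> : dot z z = dot (v *m M) z.
  by rewrite {1}/z dotDl dotNl dotZl zv mulr0 subr0.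
apply/eqP; apply: (@variation_eq0 _ (f v * dot z z - f z)) => t.
have symz : dot (z *m M) v = dot (v *m M) z by rewrite (dot_mulmxC _ _ MT).
have fE : f (v + t *: z) = f v + 2 * t * dot (v *m M) z + t ^+ 2 * f z.
  rewrite /f mulmxDl -scalemxAl; clearbody z.
  by rewrite !(dotDl, dotDr) !(dotZl, dotZr) symz; ring.
have nE : dot (v + t *: z) (v + t *: z) = 1 + t ^+ 2 * dot z z.
  by clearbody z; rewrite !(dotDl, dotDr) !(dotZl, dotZr) v1 (dotC z v) zv; ring.
have := max (v + t *: z); rewrite fE nE => H.
have {H} : f v + 2 * t * dot (v *m M) z + t ^+ 2 * f z <= f v * (1 + t ^+ 2 * dot z z).
  by apply: H => i; rewrite dotDl dotZl vP zP mulr0 addr0.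
by lra.
Qed.

Lemma spectral_theorem M : M^T = M -> exists (Q : 'M[R]_d) (mu : 'I_d -> R),
  is_orthogonal_mx Q /\ forall j, row j Q *m M = mu j *: row j Q.
Proof.
move=> MT.
suff H k : (k <= d)%N -> exists P : 'M[R]_(k, d), P *m P^T = 1%:M /\
    forall i, exists mu : R, row i P *m M = mu *: row i P.
  by have [Q [QQ /choice[mu eig]]] := H d (leqnn d); exists Q, mu.
elim: k => [_|k IH kd].
  by exists 0; split; [apply/matrixP => -[]|case].
have [P [PP eig]] := IH (ltnW kd).
have [v [nu [v1 vP vM]]] := orthogonal_eigenvector MT kd eig.
suff [QQ Qe] : (col_mx v P) *m (col_mx v P)^T = 1%:M /\
    forall i, exists mu : R, row i (col_mx v P) *m M = mu *: row i (col_mx v P).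
  by exists (col_mx v P).
split; last first.
  move=> i; case: (split_ordP i) => j ->; last by rewrite rowKd; exact: eig.
  by rewrite rowKu row_id; exists nu.
have vPT : v *m P^T = 0.
  apply/rowP => j; rewrite [RHS]mxE -(vP j) mxE; apply: eq_bigr => l _.
  by rewrite !mxE.
rewrite tr_col_mx mul_col_row PP vPT.
have -> : P *m v^T = 0 by rewrite -[LHS]trmxK trmx_mul trmxK vPT trmx0.
rewrite (mx11_scalar (v *m v^T)) -dot_mx v1.
by rewrite -scalar_mx_block.
Qed.

End Spectral.

Section Ellipsoids.
Context {R : realType} {d : nat}.
Implicit Types (u v w x y c N n : 'rV[R]_d) (M Q : 'M[R]_d).

Lemma normals_positive (Om : set 'rV[R]_d) c M : (3 <= d)%N ->
  strictly_convex_closed_boundary Om ->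
  (forall x n, boundary Om x -> supports Om x n ->
    0 < dot n (x - c) /\ dot n (x - c) *: (x - c) = n *m M) ->
  forall N, N != 0 -> 0 < dot (N *m M) N.
Proof.
move=> hd hOm H N N0; have [x Sx sN] := support_exists hd hOm N0.
by have [k0 <-] := H _ _ Sx sN; rewrite dotZl (dotC (x - c)) mulr_gt0.
Qed.

Lemma normals_quadric (Om : set 'rV[R]_d) c M : (3 <= d)%N ->
  strictly_convex_closed_boundary Om ->
  (forall x n, boundary Om x -> supports Om x n ->
    0 < dot n (x - c) /\ dot n (x - c) *: (x - c) = n *m M) ->
  boundary Om = [set x | exists N, x - c = N *m M /\ dot (N *m M) N = 1].
Proof.
move=> hd hOm H; apply/seteqP; split => [x Sx|x [N [xN N1]]].
  have [k k0 sn] := support_normal hd hOm Sx; have [] := H _ _ Sx sn.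
  move: (k *: _) => n; set l := dot n (x - c) => l0 E.
  have NM : (l^-1 *: n) *m M = x - c.
    by rewrite -scalemxAl -E scalerA mulVf ?scale1r// gt_eqF.
  exists (l^-1 *: n); split; first by rewrite NM.
  by rewrite NM dotZr dotC mulVf// gt_eqF.
have N0 : N != 0 by apply: contra_eq_neq N1 => ->; rewrite dot0r eq_sym oner_eq0.
have [x' Sx' sN] := support_exists hd hOm N0; have [l0 E] := H _ _ Sx' sN.
have l1 : dot N (x' - c) = 1.
  have := congr1 (dot N) E; rewrite dotZr (dotC N (N *m M)) N1 -expr2 => /eqP.
  rewrite sqrf_eq1 => /orP[/eqP//|/eqP h].
  by move: l0; rewrite h ltr0N1.
by move: E; rewrite l1 scale1r -xN => /addIr <-.
Qed.

Lemma orthogonal_parseval Q u v : is_orthogonal_mx Q ->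
  dot u v = \sum_j dot u (row j Q) * dot v (row j Q).
Proof.
move=> QQ; have QtQ : Q^T *m Q = 1%:M by exact: mulmx1C.
have -> : dot u v = dot (u *m Q^T) (v *m Q^T).
  by rewrite !dot_mx trmx_mul trmxK mulmxA -(mulmxA u) QtQ mulmx1.
apply: eq_bigr => j _; congr (_ * _); rewrite mxE; apply: eq_bigr => l _; by rewrite !mxE.
Qed.

Lemma orthogonal_rows Q i j : is_orthogonal_mx Q -> dot (row i Q) (row j Q) = (i == j)%:R.
Proof.
move=> /(congr1 (fun B : 'M[R]_d => B i j)); rewrite !mxE => <-.
by apply: eq_bigr => l _; rewrite !mxE.
Qed.

Lemma diagonal_quadric Q M (mu : 'I_d -> R) c : is_orthogonal_mx Q -> M^T = M ->
  (forall j, row j Q *m M = mu j *: row j Q) -> (forall j, 0 < mu j) ->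
  [set x | exists N, x - c = N *m M /\ dot (N *m M) N = 1] = quadric c Q mu.
Proof.
move=> QQ MT eig mu0.
have dM N j : dot (N *m M) (row j Q) = mu j * dot N (row j Q).
  by rewrite (dot_mulmxC _ _ MT) eig dotZl dotC.
have mne j : mu j != 0 by rewrite gt_eqF.
apply/seteqP; split => x; rewrite /quadric /coordinate /=.
  move=> [N [-> <-]]; rewrite (orthogonal_parseval _ _ QQ); apply: eq_bigr => j _.
  by rewrite dM; field.
move=> x1; exists (\sum_j (dot (x - c) (row j Q) / mu j) *: row j Q).
have NM : (\sum_j (dot (x - c) (row j Q) / mu j) *: row j Q) *m M = x - c.
  rewrite mulmx_suml; apply: dot_inj => w; rewrite dot_suml (orthogonal_parseval _ _ QQ).
  by apply: eq_bigr => j _; rewrite -scalemxAl eig scalerA divfK// dotZl (dotC w).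
split => //; rewrite NM -x1 dotC dot_suml; apply: eq_bigr => j _.
by rewrite dotZl (dotC (row j Q)) mulrAC -expr2.
Qed.

Lemma quadric_ellipsoid Q (mu : 'I_d -> R) c : is_orthogonal_mx Q -> (forall j, 0 < mu j) ->
  ellipsoid (quadric c Q mu).
Proof.
move=> QQ mu0; exists c, Q, (fun j => Num.sqrt (mu j)); split => // [j|].
  by rewrite sqrtr_gt0.
by congr quadric; apply/funext => j; rewrite sqr_sqrtr// ltW.
Qed.

Lemma shifted_quadrics_confocal Q (mu : 'I_d -> R) c (lam : R) : is_orthogonal_mx Q ->
  (forall j, 0 < mu j) -> 0 < lam ->
  confocal_ellipsoids (quadric c Q mu) (quadric c Q (fun j => mu j + lam)).
Proof.
move=> QQ mu0 lam0; have mulam j : 0 < mu j + lam by rewrite addr_gt0.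
have sq j : Num.sqrt (mu j) ^+ 2 = mu j by rewrite sqr_sqrtr// ltW.
split; [exact: quadric_ellipsoid|exact: quadric_ellipsoid|].
exists c, Q, (fun j => Num.sqrt (mu j)); split => //.
  exists 0 => [j|]; first by rewrite sq addr0 gt_eqF.
  by congr quadric; apply/funext => j; rewrite sq addr0.
exists lam => [j|]; first by rewrite sq gt_eqF.
by congr quadric; apply/funext => j; rewrite sq.
Qed.

End Ellipsoids.

Theorem theorem1p2 (R : realType) (d : nat) (hd : (3 <= d)%N)
    (Oma Omb : set 'rV[R]_d)
    (ha : strictly_convex_closed_boundary Oma)
    (hb : strictly_convex_closed_boundary Omb)
    (hnested : closure Oma `<=` Omb)
    (hcomm : billiard (boundary Oma) \o billiard (boundary Omb) =
             billiard (boundary Omb) \o billiard (boundary Oma)) :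
  confocal_ellipsoids (boundary Oma) (boundary Omb).
Proof.
have caustic := reflection_misses hd ha hb hcomm.
have [a [c [M [a0 MT innerN outerN]]]] := quadric_normals hd ha hb hnested caustic.
have innerP y n : boundary Oma y -> supports Oma y n ->
    0 < dot n (y - c) /\ dot n (y - c) *: (y - c) = n *m M.
  exact: innerN.
have outerP x n : boundary Omb x -> supports Omb x n ->
    0 < dot n (x - c) /\ dot n (x - c) *: (x - c) = n *m (M + a^-1%:M).
  move=> Sx sn; split; last exact: outerN.
  have [y Sy sy] := support_exists hd ha (support_neq0 hb Sx sn).
  have [n1 _] := innerP _ _ Sy sy.
  have n2 := support_inner hb hnested Sx sn (boundary_closure ha Sy).
  have -> : x - c = (y - c) - (y - x) by apply/rowP => i; rewrite !mxE; ring.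
  by rewrite dotDr dotNr subr_gt0 (lt_trans n2).
have [Q [mu [QQ eig]]] := spectral_theorem MT.
have mu0 j : 0 < mu j.
  have r1 : dot (row j Q) (row j Q) = 1 by rewrite orthogonal_rows// eqxx.
  have r0 : row j Q != 0 by rewrite -dot_eq0 r1 oner_eq0.
  by have := normals_positive hd ha innerP r0; rewrite eig dotZl r1 mulr1.
have a1 : 0 < a^-1 by rewrite invr_gt0.
rewrite (normals_quadric hd ha innerP) (normals_quadric hd hb outerP).
rewrite (diagonal_quadric c QQ MT eig mu0) (@diagonal_quadric _ _ Q _ (fun j => mu j + a^-1))//.
- exact: shifted_quadrics_confocal.
- by rewrite linearD /= tr_scalar_mx MT.
- by move=> j; rewrite mulmxDr eig mul_mx_scalar scalerDl.
- by move=> j; rewrite addr_gt0.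
Qed.
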